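(* Let $a>0$, $b>0$, $c=ab$, and let $\varphi_c(x)=ae^{-|x|}$, $\psi_c(x)=be^{-|x|}$ be the peakon profiles. Then the peakons are orbitally stable for the two-component Novikov system in the following sense. Assume that $u_0,v_0\in H^s(\mathbb{R})$ for some $s\ge 3$, that $(1-\partial_x^2)u_0$ and $(1-\partial_x^2)v_0$ are nonnegative, and that $\delta>0$ is such that $$\|u_0-\varphi_c\|_{H^1(\mathbb{R})}+\|v_0-\psi_c\|_{H^1(\mathbb{R})}<\delta .$$ Let $(u(t,x),v(t,x))$ be the corresponding strong solution of the Cauchy problem for the two-component Novikov system with $u(0,x)=u_0(x)$, $v(0,x)=v_0(x)$, and let $T>0$ be its maximal existence time. Then $$\sup_{t\in[0,T)}\Big(\|u(t,\cdot)-\varphi_c(\cdot-\xi(t))\|_{H^1(\mathbb{R})}+\|v(t,\cdot)-\psi_c(\cdot-\xi(t))\|_{H^1(\mathbb{R})}\Big)<A\,\delta^{1/4},$$ where $\xi(t)\in\mathbb{R}$ is a point at which $x\mapsto u(t,x)v(t,x)$ attains its maximum over $\mathbb{R}$, and the constant $A>0$ depends only on $a$, $b$, $\|u_0\|_{H^s(\mathbb{R})}$ and $\|v_0\|_{H^s(\mathbb{R})}$.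
   Context: The two-component Novikov system is $$m_t+uvm_x+(2vu_x+uv_x)m=0,\quad m=u-u_{xx},\qquad n_t+uvn_x+(2uv_x+vu_x)n=0,\quad n=v-v_{xx},$$ for $t>0$, $x\in\mathbb{R}$. For initial data in $H^s(\mathbb{R})\times H^s(\mathbb{R})$, $s>3/2$, it has a unique strong solution $(u,v)\in C([0,T);H^s\times H^s)\cap C^1([0,T);H^{s-1}\times H^{s-1})$ with maximal existence time $T>0$. The functions $(\varphi_c(x-ct),\psi_c(x-ct))$ are weak (distributional) traveling wave solutions of the system. $\|f\|_{H^1}^2=\int_{\mathbb{R}}(f^2+f_x^2)\,dx$. *)

(* Defs.v *)
From HB Require Import structures.
From mathcomp Require Import all_boot all_order all_algebra.
From mathcomp Require Import all_classical all_reals all_analysis.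

Set Implicit Arguments.
Unset Strict Implicit.
Unset Printing Implicit Defensive.

Import Order.TTheory GRing.Theory Num.Theory.
Import numFieldNormedType.Exports.

Local Open Scope classical_set_scope.
Local Open Scope ring_scope.

Section Sobolev.
Context {R : realType}.
Implicit Types (f g phi : R -> R) (s : R).

Local Notation mu := (@lebesgue_measure R).

Definition test_function phi : Prop :=
  (forall (n : nat) (x : R), derivable (derive1n n phi) x 1) /\
  (exists M : R, forall x : R, M < `|x| -> phi x = 0).

Definition is_weak_derivative f g : Prop :=
  [/\ locally_integrable [set: R] f,
      locally_integrable [set: R] g &
      forall phi, test_function phi ->
        (\int[mu]_x (f x * derive1 phi x))%R = - (\int[mu]_x (g x * phi x))%R].

(* A chosen representative of the (a.e. unique) weak derivative of f, and the
   zero function when f has no weak derivative. *)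
Definition wderiv f : R -> R := xget (fun=> 0) [set g | is_weak_derivative f g].

Definition wderivn (j : nat) f : R -> R := iter j wderiv f.

Definition L2_sqnorm f : \bar R := (\int[mu]_x (f x ^+ 2)%:E)%E.

Definition gagliardo_sqnorm (sigma : R) f : \bar R :=
  (\int[mu]_x \int[mu]_y
     ((f x - f y) ^+ 2 / `|x - y| `^ (1 + 2 * sigma))%:E)%E.

(* H^s(R) for real s >= 0, in the Sobolev-Slobodeckij form H^s = W^{s,2}: with
   k the integer part of s, the weak derivatives up to order k are in L^2 and,
   when s is not an integer, the k-th one has a finite Gagliardo seminorm of
   order s - k.  Elements are functions; their a.e. classes are not formed. *)
Definition sobolev_sqnorm s f : \bar R :=
  let k := Num.truncn s in
  let sigma := s - k%:R in
  (\sum_(j < k.+1) L2_sqnorm (wderivn j f) +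
   (if (0 < sigma)%R then gagliardo_sqnorm sigma (wderivn k f) else 0))%E.

Definition sobolev s : set (R -> R) :=
  [set f | [/\ measurable_fun [set: R] f,
     forall j : nat, (j < Num.truncn s)%N ->
       is_weak_derivative (wderivn j f) (wderivn j.+1 f) &
     (sobolev_sqnorm s f < +oo)%E]].

(* Only meaningful on [sobolev s]: [fine] sends +oo to 0. *)
Definition sobolev_norm s f : R := Num.sqrt (fine (sobolev_sqnorm s f)).

Definition H1_norm f : R :=
  Num.sqrt (\int[mu]_x (f x ^+ 2 + wderiv f x ^+ 2))%R.

Definition helmholtz f : R -> R := fun x => f x - wderiv (wderiv f) x.

Definition lifespan (T : \bar R) : set R := [set t | 0 <= t /\ (t%:E < T)%E].

(* w \in C([0,T); H^s), where w t is the function x |-> w(t,x). *)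
Definition sobolev_C0 s (T : \bar R) (w : R -> R -> R) : Prop :=
  (forall t, lifespan T t -> sobolev s (w t)) /\
  (forall t, lifespan T t ->
     sobolev_norm s (fun x => w r x - w t x)
       @[r --> within (lifespan T) (nbhs t)] --> (0 : R)).

(* wt is the time derivative of w on [0,T) in the norm of H^s (one-sided at
   t = 0). *)
Definition sobolev_time_derivative s (T : \bar R) (w wt : R -> R -> R) : Prop :=
  (forall t, lifespan T t -> sobolev s (w t) /\ sobolev s (wt t)) /\
  (forall t, lifespan T t ->
     sobolev_norm s (fun x => (w r x - w t x) / (r - t) - wt t x)
       @[r --> within (lifespan T) (dnbhs t)] --> (0 : R)).

Definition sobolev_C1 s (T : \bar R) (w : R -> R -> R) : Prop :=
  exists2 wt, sobolev_time_derivative s T w wt & sobolev_C0 s T wt.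

End Sobolev.

Section Novikov.
Context {R : realType}.
Implicit Types (u v : R -> R -> R) (s : R) (T : \bar R).

Local Notation mu := (@lebesgue_measure R).

(* m_t + u v m_x + (2 v u_x + u v_x) m = 0 on (0,T), m = u - u_xx.  For s >= 3,
   u in C([0,T); H^s) \cap C^1([0,T); H^{s-1}) makes every term an L^2 function
   of x: m(t) is in H^{s-2} and m_t is taken in H^{s-3}.  The second equation of
   the system is obtained by exchanging u and v. *)
Definition novikov_equation s T u v : Prop :=
  let m := fun t => helmholtz (u t) in
  exists2 mt, sobolev_time_derivative (s - 3) T m mt &
    forall t : R, 0 < t -> (t%:E < T)%E ->
      {ae mu, forall x : R,
        mt t x + u t x * v t x * wderiv (m t) x
        + (2 * v t x * wderiv (u t) x + u t x * wderiv (v t) x) * m t x = 0}.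

(* For s >= 3.  The elements u t, v t of H^s are represented by their
   continuous representatives, so that pointwise values make sense; the data
   are only prescribed up to a.e. equality. *)
Definition strong_solution s T (u0 v0 : R -> R) u v : Prop :=
  [/\ sobolev_C0 s T u /\ sobolev_C0 s T v,
      sobolev_C1 (s - 1) T u /\ sobolev_C1 (s - 1) T v,
      forall t, lifespan T t -> continuous (u t) /\ continuous (v t),
      novikov_equation s T u v /\ novikov_equation s T v u &
      {ae mu, forall x, u 0 x = u0 x} /\ {ae mu, forall x, v 0 x = v0 x}].

Definition maximal_strong_solution s T (u0 v0 : R -> R) u v : Prop :=
  [/\ (0 < T)%E,
      strong_solution s T u0 v0 u v &
      forall (T' : \bar R) (u' v' : R -> R -> R),
        strong_solution s T' u0 v0 u' v' -> (T' <= T)%E].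

Definition peakon (a : R) : R -> R := fun x => a * expR (- `|x|).

Definition is_max_point (f : R -> R) (z : R) : Prop := forall x, f x <= f z.

End Novikov.

(* Main.v *)
Require Import Defs.
From HB Require Import structures.
From mathcomp Require Import all_boot all_order all_algebra.
From mathcomp Require Import all_classical all_reals all_analysis measurable_realfun.
From mathcomp Require Import ring lra.

Set Implicit Arguments.
Unset Strict Implicit.
Unset Printing Implicit Defensive.

Import Order.TTheory GRing.Theory Num.Theory.
Import numFieldNormedType.Exports.

Local Open Scope classical_set_scope.
Local Open Scope ring_scope.

(* The flow conserves the energies E(u) = int u^2 + u_x^2 and E(v), and a quartic
   functional F. The momenta stay nonnegative because the L^2 norm of their
   negative part obeys a Gronwall inequality; hence |u_x| <= u and |v_x| <= v.
   Let M be the maximum of u v, attained at xi, and E0 = int u v + u_x v_x, which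
   is at most sqrt(E(u) E(v)). Integrating (u -+ u_x)(v -+ v_x) against a density
   bounded by 4 u v on either side of xi gives 4 M^2 - 4 M E0 + F <= 0, so 2 M is
   within O(sqrt delta) of its peakon value 2 a b. As 2 v(xi)^2 <= E(v), this
   bounds u(xi) from below by a - O(sqrt delta), and the squared H^1 distance of
   u to phi(. - xi), which is E(u) + 2 a^2 - 4 a u(xi), is O(sqrt delta). *)

(** * Lebesgue spaces and absolutely continuous functions *)

(** At the peakons E0 = 2 a b and F = 4 a^2 b^2, so the quadratic 4 M^2 - 4 M E0 + F is the perfect
    square (2 M - 2 a b)^2. Its double root is what turns an error of order delta in the conserved
    quantities into sqrt delta for M; the passage from the squared distance to the distance then
    gives the exponent 1/4. Only the product u v is controlled in this way; the separate amplitudes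
    are recovered because the energies bound each factor from above. For delta > 1 nothing is gained
    from closeness: there the triangle inequality and the conserved energies suffice, and this is
    where the Sobolev norms of the data enter the constant. The regularity is tight. For s = 3 the
    momentum m(t) is only in H^1 and m_t only in L^2, so time derivatives are limits in L^2 of
    difference quotients, and integrations by parts rest on absolutely continuous representatives.
    Moreover the weak derivatives in the hypotheses are choices, known up to null sets, and must
    first be identified with classical derivatives. *)

Section Lebesgue_spaces.
Context {R : realType}.
Implicit Types (f g h : R -> R) (D : set R) (c : R).

Local Notation mu := (@lebesgue_measure R).
Local Notation mfun f := (measurable_fun [set: R] f).

Lemma ae_imp (P Q : R -> Prop) : {ae mu, forall x, P x} ->
  (forall x, P x -> Q x) -> {ae mu, forall x, Q x}.
Proof. by move=> h PQ; apply: (@filterS _ _ (ae_filter_ringOfSetsType mu) _ _ _ h). Qed.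

Lemma ae_imp2 (P1 P2 Q : R -> Prop) : {ae mu, forall x, P1 x} ->
  {ae mu, forall x, P2 x} -> (forall x, P1 x -> P2 x -> Q x) ->
  {ae mu, forall x, Q x}.
Proof.
move=> h1 h2 PQ.
apply: (@filterS2 _ _ (ae_filter_ringOfSetsType mu) _ _ _ _ h1 h2); exact: PQ.
Qed.

Lemma ae_all (P : R -> Prop) : (forall x, P x) -> {ae mu, forall x, P x}.
Proof. by move=> h; apply: (@filterE _ _ (ae_filter_ringOfSetsType mu)). Qed.

Definition L1 D f := mu.-integrable D (EFin \o f).

Lemma L1_measurable D f : L1 D f -> measurable_fun D f.
Proof. by move=> /measurable_int/measurable_EFinP. Qed.

Lemma L1_le D f g : measurable D -> measurable_fun D f -> L1 D g ->
  (forall x, D x -> `|f x| <= g x) -> L1 D f.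
Proof.
move=> mD mf ig fg; apply: le_integrable ig => //.
  exact/measurable_EFinP.
move=> x Dx /=; rewrite lee_fin (le_trans (fg x Dx))//.
by rewrite ler_norm.
Qed.

Lemma L1D D f g : measurable D -> L1 D f -> L1 D g -> L1 D (fun x => f x + g x).
Proof. by move=> mD i j; exact: (integrableD _ i j). Qed.

Lemma L1B D f g : measurable D -> L1 D f -> L1 D g -> L1 D (fun x => f x - g x).
Proof. by move=> mD i j; exact: (integrableB _ i j). Qed.

Lemma L1Z D f c : measurable D -> L1 D f -> L1 D (fun x => c * f x).
Proof. by move=> mD i; exact: (integrableZl _ c i). Qed.

Lemma L1_norm D f : measurable D -> L1 D f -> L1 D (fun x => `|f x|).
Proof. by move=> mD i; have := integrable_norm i. Qed.

Lemma L1S D E f : measurable D -> measurable E -> E `<=` D -> L1 D f -> L1 E f.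
Proof. by move=> mD mE ED; apply: integrableS. Qed.

Lemma L1_ae D f g : measurable D -> measurable_fun D f -> L1 D g ->
  {ae mu, forall x, D x -> f x = g x} -> L1 D f.
Proof.
move=> mD mf ig fg; apply/integrableP; split; first exact/measurable_EFinP.
have mg := L1_measurable ig.
rewrite (@ae_eq_integral _ _ _ mu D (fun x => `|(EFin \o g) x|%E))//.
- by move/integrableP : ig => [].
- by apply: measurableT_comp => //; exact/measurable_EFinP.
- by apply: measurableT_comp => //; exact/measurable_EFinP.
- by apply: (ae_imp fg) => x /= h Dx; rewrite h.
Qed.

Lemma Int_ae D f g : measurable D -> measurable_fun D f -> measurable_fun D g ->
  {ae mu, forall x, D x -> f x = g x} ->
  \int[mu]_(x in D) f x = \int[mu]_(x in D) g x.
Proof.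
move=> mD mf mg fg; rewrite /Rintegral; congr fine; apply: ae_eq_integral => //.
- exact/measurable_EFinP.
- exact/measurable_EFinP.
- by apply: (ae_imp fg) => x /= h Dx; rewrite h.
Qed.

(** Replacing g by max(f, g), which agrees with g almost everywhere, makes the inequality hold at
    every point. *)
Lemma Int_le_ae f g : L1 setT f -> L1 setT g -> {ae mu, forall x, f x <= g x} ->
  \int[mu]_x f x <= \int[mu]_x g x.
Proof.
move=> If Ig fg.
have mf := L1_measurable If; have mg := L1_measurable Ig.
rewrite (@Int_ae setT g (fun x => Num.max (f x) (g x)))//.
- apply: le_Rintegral => //; last by move=> x _; rewrite le_max lexx.
  apply: (@L1_ae _ _ g) => //; first exact: measurable_maxr.
  by apply: (ae_imp fg) => x /= h _; exact/max_r.
- exact: measurable_maxr.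
- by apply: (ae_imp fg) => x /= h _; apply/esym/max_r.
Qed.

Lemma Int_ge0_eq0 f : L1 setT f -> (forall x, 0 <= f x) ->
  \int[mu]_x f x = 0 -> {ae mu, forall x, f x = 0}.
Proof.
move=> If f0 If0; have mf := L1_measurable If.
have : (\int[mu]_(x in setT) `|(EFin \o f) x|)%E = 0%E.
  under eq_integral do rewrite /= ger0_norm//.
  by rewrite -[LHS]fineK ?integrable_fin_num//; exact/congr1.
have mEf : measurable_fun setT (EFin \o f) by exact/measurable_EFinP.
move/(ae_eq_integral_abs mu measurableT mEf).
by apply: filterS => x /= /(_ I) [].
Qed.

Definition L2 f := mfun f /\ L1 setT (fun x => f x ^+ 2).

Lemma L2_measurable f : L2 f -> mfun f.
Proof. by case. Qed.
Hint Resolve L2_measurable : core.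

Lemma L2_L1M f g : L2 f -> L2 g -> L1 setT (fun x => f x * g x).
Proof.
move=> [mf f2] [mg g2]; apply: (@L1_le _ _ (fun x => f x ^+ 2 + g x ^+ 2)) => //.
- exact: measurable_funM.
- exact: L1D.
- move=> x _; rewrite ler_norml; apply/andP; split; nra.
Qed.

Lemma L2D f g : L2 f -> L2 g -> L2 (fun x => f x + g x).
Proof.
move=> [mf f2] [mg g2]; split; first exact: measurable_funD.
apply: (@L1_le _ _ (fun x => 2 * (f x ^+ 2 + g x ^+ 2))) => //.
- by apply: measurable_funX; exact: measurable_funD.
- by apply: L1Z => //; exact: L1D.
- move=> x _; rewrite ger0_norm ?sqr_ge0//; have := sqr_ge0 (f x - g x); nra.
Qed.

Lemma L2Z f c : L2 f -> L2 (fun x => c * f x).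
Proof.
move=> [mf f2]; split; first by apply: measurable_funM.
by apply: eq_integrable (L1Z (c ^+ 2) _ f2) => // x _ /=; rewrite exprMn.
Qed.

Lemma L2N f : L2 f -> L2 (fun x => - f x).
Proof.
by move=> /(L2Z (-1)); under eq_fun do rewrite mulN1r.
Qed.

Lemma L2B f g : L2 f -> L2 g -> L2 (fun x => f x - g x).
Proof. by move=> lf lg; apply: L2D => //; exact: L2N. Qed.

Lemma L2_bound f g c : mfun g -> L2 f -> (forall x, `|g x| <= c * `|f x|) -> L2 g.
Proof.
move=> mg [mf f2] gf; split => //.
apply: (@L1_le _ _ (fun x => c ^+ 2 * f x ^+ 2)) => //.
- exact: measurable_funX.
- exact: L1Z.
- move=> x _; rewrite -exprMn normrX -[leRHS]ger0_norm ?sqr_ge0// normrX.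
  rewrite ler_pXn2r ?nnegrE ?normr_ge0//.
  by rewrite (le_trans (gf x))// normrM ler_wpM2r// ler_norm.
Qed.

Lemma L2M_bounded f g c : mfun g -> (forall x, `|g x| <= c) -> L2 f ->
  L2 (fun x => f x * g x).
Proof.
move=> mg gc lf; apply: (@L2_bound f _ c) => //.
  by apply: measurable_funM => //; case: lf.
by move=> x; rewrite normrM mulrC ler_wpM2r.
Qed.

Lemma L2_ae f g : mfun f -> L2 g -> {ae mu, forall x, f x = g x} -> L2 f.
Proof.
move=> mf [mg g2] fg; split => //; apply: L1_ae g2 _ => //.
  exact: measurable_funX.
by apply: (ae_imp fg) => x /= ->.
Qed.

Lemma L2_L1loc f (a b : R) : L2 f -> L1 `[a, b] f.
Proof.
move=> [mf f2]; apply: (@L1_le _ _ (fun x => f x ^+ 2 + 1)) => //.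
- exact: measurable_funTS.
- apply: L1D => //; first exact: L1S f2.
  apply: measurable_bounded_integrable => //.
    by apply: compact_finite_measure; exact: segment_compact.
  by exists 1; split => // x x1 y _ /=; rewrite normr1 ltW.
- move=> x _; rewrite ler_norml; apply/andP; split; nra.
Qed.

Definition ip f g : R := \int[mu]_x (f x * g x).
Definition nrm f : R := Num.sqrt (ip f f).

Lemma ip_ge0 f : 0 <= ip f f.
Proof. by apply: Rintegral_ge0 => x _; rewrite -expr2 sqr_ge0. Qed.

Lemma nrm_ge0 f : 0 <= nrm f.
Proof. exact: sqrtr_ge0. Qed.

Lemma sqr_nrm f : nrm f ^+ 2 = ip f f.
Proof. by rewrite sqr_sqrtr// ip_ge0. Qed.

Lemma ipC f g : ip f g = ip g f.
Proof. by apply: eq_Rintegral => x _; rewrite mulrC. Qed.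

Lemma ipDl f g h : L2 f -> L2 g -> L2 h ->
  ip (fun x => f x + g x) h = ip f h + ip g h.
Proof.
move=> lf lg lh; rewrite /ip -RintegralD//; [|exact: L2_L1M|exact: L2_L1M].
by apply: eq_Rintegral => x _; rewrite mulrDl.
Qed.

Lemma ipZl f g c : L2 f -> L2 g -> ip (fun x => c * f x) g = c * ip f g.
Proof.
move=> lf lg; rewrite /ip -RintegralZl//; last exact: L2_L1M.
by apply: eq_Rintegral => x _; rewrite mulrA.
Qed.

Lemma ipBl f g h : L2 f -> L2 g -> L2 h ->
  ip (fun x => f x - g x) h = ip f h - ip g h.
Proof.
move=> lf lg lh; rewrite /ip -RintegralB//; [|exact: L2_L1M|exact: L2_L1M].
by apply: eq_Rintegral => x _; rewrite mulrBl.
Qed.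

Lemma ipBr f g h : L2 f -> L2 g -> L2 h ->
  ip h (fun x => f x - g x) = ip h f - ip h g.
Proof. by move=> lf lg lh; rewrite ipC ipBl// !(ipC h). Qed.

Lemma ipDr f g h : L2 f -> L2 g -> L2 h ->
  ip h (fun x => f x + g x) = ip h f + ip h g.
Proof. by move=> lf lg lh; rewrite ipC ipDl// !(ipC h). Qed.

Lemma ipZr f g c : L2 f -> L2 g -> ip f (fun x => c * g x) = c * ip f g.
Proof. by move=> lf lg; rewrite ipC ipZl// (ipC f). Qed.

Lemma ip_ae f f' g g' : mfun f -> mfun f' -> mfun g -> mfun g' ->
  {ae mu, forall x, f x = f' x} -> {ae mu, forall x, g x = g' x} ->
  ip f g = ip f' g'.
Proof.
move=> mf mf' mg mg' ff' gg'; apply: Int_ae => //; try exact: measurable_funM.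
by apply: (ae_imp2 ff' gg') => x -> ->.
Qed.

Lemma nrm_ae f f' : mfun f -> mfun f' ->
  {ae mu, forall x, f x = f' x} -> nrm f = nrm f'.
Proof. by move=> mf mf' ff'; congr Num.sqrt; apply: ip_ae. Qed.

Lemma sqr_nrmD f g c : L2 f -> L2 g ->
  ip (fun x => f x + c * g x) (fun x => f x + c * g x) =
  ip f f + 2 * c * ip f g + c ^+ 2 * ip g g.
Proof.
move=> lf lg; have lcg := L2Z c lg; have lD := L2D lf lcg.
rewrite ipDl// !ipDr// !ipZl// ipZr// (ipC g f) ipZr//; ring.
Qed.

Lemma cauchy_schwarz f g : L2 f -> L2 g -> `|ip f g| <= nrm f * nrm g.
Proof.
move=> lf lg; rewrite -[leRHS]ger0_norm ?mulr_ge0 ?nrm_ge0//.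
rewrite -ler_sqr ?nnegrE// -!normrX !ger0_norm ?sqr_ge0// exprMn !sqr_nrm.
have H c : 0 <= ip f f + 2 * c * ip f g + c ^+ 2 * ip g g.
  by rewrite -sqr_nrmD// ip_ge0.
have [g0|] := eqVneq (ip g g) 0; last first.
  rewrite neq_lt ltNge ip_ge0/= => g0.
  (* The minimiser of the quadratic in [c]. *)
  have := H (- (ip f g / ip g g)).
  have -> : ip f f + 2 * - (ip f g / ip g g) * ip f g +
     (- (ip f g / ip g g)) ^+ 2 * ip g g =
     (ip f f * ip g g - ip f g ^+ 2) / ip g g by field; rewrite gt_eqF.
  by rewrite pmulr_lge0 ?invr_gt0// subr_ge0.
rewrite g0 mulr0; have [->|fg0] := eqVneq (ip f g) 0; first by rewrite expr0n.
(* With <g, g> = 0 the form is affine in [c]; this value of [c] makes it equal to -1 unless <f, g> =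
   0. *)
have := H (- ((ip f f + 1) / (2 * ip f g))).
rewrite g0 mulr0 addr0.
have -> : ip f f + 2 * - ((ip f f + 1) / (2 * ip f g)) * ip f g = -1.
  by field.
by rewrite ler0N1.
Qed.

Lemma nrmD f g : L2 f -> L2 g -> nrm (fun x => f x + g x) <= nrm f + nrm g.
Proof.
move=> lf lg; rewrite -ler_sqr ?nnegrE ?addr_ge0 ?nrm_ge0//.
have -> : (fun x => f x + g x) = (fun x => f x + 1 * g x).
  by under [RHS]eq_fun do rewrite mul1r.
rewrite sqr_nrm sqr_nrmD// sqrrD !sqr_nrm.
have := cauchy_schwarz lf lg; have := ler_norm (ip f g); nra.
Qed.

Lemma nrmZ f c : L2 f -> nrm (fun x => c * f x) = `|c| * nrm f.
Proof.
move=> lf; have lcf := L2Z c lf.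
by rewrite /nrm ipZl// ipZr// mulrA -expr2 sqrtrM ?sqr_ge0// sqrtr_sqr.
Qed.

Lemma nrmN f : L2 f -> nrm (fun x => - f x) = nrm f.
Proof.
move=> lf; rewrite -[RHS]mul1r -[X in X * _](@normrN1 R) -nrmZ//.
by under [in RHS]eq_fun do rewrite mulN1r.
Qed.

Lemma nrmB f g : L2 f -> L2 g -> nrm (fun x => f x - g x) <= nrm f + nrm g.
Proof. by move=> lf lg; rewrite -(nrmN lg) nrmD//; exact: L2N. Qed.

Lemma nrm_triangle f g h : L2 f -> L2 g -> L2 h ->
  nrm (fun x => f x - h x) <= nrm (fun x => f x - g x) + nrm (fun x => g x - h x).
Proof.
move=> lf lg lh; have := nrmD (L2B lf lg) (L2B lg lh).
by under eq_fun do rewrite addrA subrK.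
Qed.

Lemma nrm_le f g c : mfun g -> L2 f -> 0 <= c -> (forall x, `|g x| <= c * `|f x|) ->
  nrm g <= c * nrm f.
Proof.
move=> mg lf c0 gf; have lg := L2_bound mg lf gf.
rewrite -ler_sqr ?nnegrE ?mulr_ge0 ?nrm_ge0// exprMn !sqr_nrm.
rewrite -ipZl// /ip; have lcf := L2Z (c ^+ 2) lf.
apply: le_Rintegral => //; [exact: L2_L1M|exact: L2_L1M|].
move=> x _; rewrite -expr2 -mulrA -expr2 -exprMn.
rewrite -[leLHS]ger0_norm ?sqr_ge0// -[leRHS]ger0_norm ?sqr_ge0// !normrX.
by rewrite ler_pXn2r ?nnegrE// normrM (ger0_norm c0).
Qed.

Lemma nrm_eq0 f : L2 f -> nrm f = 0 -> {ae mu, forall x, f x = 0}.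
Proof.
move=> lf /eqP; rewrite sqrtr_eq0 => f0.
have {}f0 : ip f f = 0 by apply/eqP; rewrite eq_le f0 ip_ge0.
have h0 x : 0 <= f x * f x by rewrite -expr2 sqr_ge0.
apply: (ae_imp (Int_ge0_eq0 (L2_L1M lf lf) h0 f0)) => x /eqP.
by rewrite mulf_eq0 orbb => /eqP.
Qed.

End Lebesgue_spaces.

(** * Absolutely continuous functions: product and chain rules *)

Section Absolutely_continuous.
Context {R : realType}.
Implicit Types (f g h k w : R -> R) (a b x y c C : R).

Local Notation mu := (@lebesgue_measure R).

Lemma L1M_bounded (D : set R) f g c : measurable D -> measurable_fun D g ->
  (forall x, D x -> `|g x| <= c) -> L1 D f -> L1 D (fun x => f x * g x).
Proof.
move=> mD mg gc If; apply: (@L1_le _ _ _ (fun x => c * `|f x|)) => //.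
- by apply: measurable_funM => //; exact: L1_measurable If.
- by apply: L1Z => //; exact: L1_norm.
- by move=> x Dx; rewrite normrM mulrC ler_wpM2r// gc.
Qed.

Lemma Int_itv_split a b c g : a <= c -> c <= b -> L1 `[a, b] g ->
  \int[mu]_(x in `[a, b]) g x =
  \int[mu]_(x in `[a, c]) g x + \int[mu]_(x in `[c, b]) g x.
Proof.
move=> ac cb Ig; rewrite -(@Rintegral_itv_obnd_cbnd _ c (BRight b)).
  rewrite -(Rintegral_itvB Ig); last by rewrite bnd_simp.
    by rewrite addrC subrK.
  by rewrite bnd_simp.
apply: L1S Ig => //; apply: subset_itvr.
by rewrite bnd_simp.
Qed.

Lemma Int_itv_le a b x y w : (forall a b, L1 `[a, b] w) -> (forall x, 0 <= w x) ->
  a <= x -> x <= y -> y <= b ->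
  \int[mu]_(t in `[x, y]) w t <= \int[mu]_(t in `[a, b]) w t.
Proof.
move=> Iw w0 ax xy yb; rewrite (@Int_itv_split a b x)//; last by apply: (le_trans xy).
rewrite (@Int_itv_split x b y)//.
have I0 p q : 0 <= \int[mu]_(t in `[p, q]) w t by apply: Rintegral_ge0.
by rewrite addrCA lerDl addr_ge0.
Qed.

Lemma abs_Int_le (D : set R) f g : measurable D -> L1 D f -> L1 D g ->
  (forall x, D x -> `|f x| <= g x) ->
  `|\int[mu]_(x in D) f x| <= \int[mu]_(x in D) g x.
Proof.
move=> mD If Ig fg; apply: (le_trans (le_normr_Rintegral _ _)) => //.
by apply: le_Rintegral => //; exact: L1_norm.
Qed.

(* Bisection: halving the increment of [V] divides the square by four and
   doubles the number of terms. *)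
Lemma square_error_cst (F V : R -> R) a b C : a <= b ->
  {within `[a, b], continuous V} ->
  (forall x y, a <= x -> x <= y -> y <= b -> V x <= V y) ->
  (forall x y, a <= x -> x <= y -> y <= b ->
     `|F y - F x| <= C * (V y - V x) ^+ 2) ->
  F b = F a.
Proof.
move=> ab cV ndV FV.
have bis n : forall p q, a <= p -> p <= q -> q <= b ->
    `|F q - F p| * 2 ^+ n <= C * (V q - V p) ^+ 2.
  elim: n => [p q ap pq qb|n IH p q ap pq qb]; first by rewrite expr0 mulr1 FV.
  have cV' : {within `[p, q], continuous V}.
    apply: continuous_subspaceW cV; apply: subset_itv; rewrite bnd_simp//.
  have Vpq := ndV _ _ ap pq qb.
  have [|m] := @IVT _ V p q ((V p + V q) / 2) pq cV'.
    by rewrite min_l// max_r//; apply/andP; split; lra.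
  rewrite in_itv/= => /andP[pm mq] Vm.
  have am := le_trans ap pm; have mb := le_trans mq qb.
  have := IH p m ap pm mb; have := IH m q am mq qb.
  rewrite Vm (exprS 2 n) => h1 h2.
  have h3 : `|F q - F p| <= `|F q - F m| + `|F m - F p|.
    by rewrite (le_trans _ (ler_normD _ _))// addrA subrK.
  have h4 : `|F q - F p| * 2 ^+ n <= (`|F q - F m| + `|F m - F p|) * 2 ^+ n.
    by rewrite ler_wpM2r// exprn_ge0.
  have e1 : C * (V q - (V p + V q) / 2) ^+ 2 = C * (V q - V p) ^+ 2 / 4 by field.
  have e2 : C * ((V p + V q) / 2 - V p) ^+ 2 = C * (V q - V p) ^+ 2 / 4 by field.
  rewrite e1 in h1; rewrite e2 in h2; rewrite mulrDl in h4.
  rewrite mulrCA; clear -h1 h2 h4.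
  move: h1 h2 h4; move: (C * _) (_ * 2 ^+ n) (_ * 2 ^+ n) (_ * 2 ^+ n).
  by move=> d p1 p2 p3 h1 h2 h4; lra.
apply/eqP; rewrite -subr_eq0 -normr_le0 leNgt; apply/negP => F0.
pose M := C * (V b - V a) ^+ 2.
have [n Mn] : exists n, M / `|F b - F a| < n%:R.
  by exists (Num.bound (M / `|F b - F a|)); apply: archi_boundP; rewrite divr_ge0//
    (le_trans _ (FV _ _ _ _ _)).
have := bis n a b (lexx _) ab (lexx _).
rewrite -/M; apply/negP; rewrite -ltNge.
rewrite ltr_pdivrMr// in Mn; apply: (lt_le_trans Mn).
by rewrite mulrC ler_wpM2l// -natrX ler_nat ltnW// ltn_expl.
Qed.

(** Absolute continuity as a relation with the derivative: f is a primitive of the locally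
    integrable g. Keeping g as an argument replaces differentiating f almost everywhere. *)
Definition AC f g := (forall a b, L1 `[a, b] g) /\
  (forall a b, a <= b -> f b - f a = \int[mu]_(x in `[a, b]) g x).

Lemma parameterized_continuous a b g : a <= b -> L1 `[a, b] g ->
  {within `[a, b], continuous (fun x => \int[mu]_(t in `[a, x]) g t)}.
Proof. by move=> ab Ig; exact: (parameterized_integral_continuous ab Ig). Qed.

(** Product and chain rules reduce to this criterion: [h] minus the integral of [k] has increments
    quadratic in those of the integral of [w], so [square_error_cst] makes it constant. The
    continuity of the integral of [w] is what allows the halving. *)
Lemma AC_square_error h k w : (forall a b, L1 `[a, b] k) ->
  (forall a b, L1 `[a, b] w) -> (forall x, 0 <= w x) ->
  (forall a b, a <= b -> exists C, forall x y, a <= x -> x <= y -> y <= b ->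
    `|h y - h x - \int[mu]_(t in `[x, y]) k t|
      <= C * (\int[mu]_(t in `[x, y]) w t) ^+ 2) ->
  AC h k.
Proof.
move=> Ik Iw w0 H; split => // a b ab.
have [C HC] := H a b ab.
have split_at (u : R -> R) x y : (forall a b, L1 `[a, b] u) -> a <= x -> x <= y ->
    \int[mu]_(t in `[a, y]) u t - \int[mu]_(t in `[a, x]) u t =
    \int[mu]_(t in `[x, y]) u t.
  by move=> Iu ax xy; rewrite (@Int_itv_split a y x)//; ring.
have := @square_error_cst (fun x => h x - \int[mu]_(t in `[a, x]) k t)
  (fun x => \int[mu]_(t in `[a, x]) w t) a b C ab.
rewrite set_itv1 Rintegral_set1 subr0 => E.
apply/eqP; rewrite subr_eq addrC -subr_eq; apply/eqP; apply: E.
- exact: parameterized_continuous.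
- by move=> x y ax xy yb; apply: Int_itv_le.
- move=> x y ax xy yb; rewrite split_at//.
  have -> : h y - \int[mu]_(t in `[a, y]) k t - (h x - \int[mu]_(t in `[a, x]) k t)
    = h y - h x - (\int[mu]_(t in `[a, y]) k t - \int[mu]_(t in `[a, x]) k t) by ring.
  by rewrite split_at// HC.
Qed.

Lemma AC_cst c : AC (fun=> c) (fun=> 0).
Proof.
split=> [a b|a b ab]; first exact: integrable0.
by rewrite subrr Rintegral_cst// mul0r.
Qed.

Lemma ACD f f' g g' : AC f f' -> AC g g' ->
  AC (fun x => f x + g x) (fun x => f' x + g' x).
Proof.
move=> [If hf] [Ig hg]; split=> [a b|a b ab]; first exact: L1D.
by rewrite RintegralD//; [rewrite -hf// -hg//; ring|exact: If|exact: Ig].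
Qed.

Lemma ACZ f f' c : AC f f' -> AC (fun x => c * f x) (fun x => c * f' x).
Proof.
move=> [If hf]; split=> [a b|a b ab]; first exact: L1Z.
by rewrite RintegralZl//; [rewrite -hf//; ring|exact: If].
Qed.

Lemma AC_osc f f' w a b x y s : AC f f' -> (forall a b, L1 `[a, b] w) ->
  (forall x, `|f' x| <= w x) -> x <= s -> s <= y ->
  `|f s - f x| <= \int[mu]_(t in `[x, y]) w t /\
  `|f y - f s| <= \int[mu]_(t in `[x, y]) w t.
Proof.
move=> [If hf] Iw fw xs sy.
have w0 t : 0 <= w t by rewrite (le_trans _ (fw t)).
by split; rewrite hf//; (apply: le_trans; [apply: abs_Int_le|apply: Int_itv_le]) => //;
  try exact: If; try exact: Iw.
Qed.

Lemma AC_continuous f f' : AC f f' -> continuous f.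
Proof.
move=> [If hf] x.
have xx : x - 1 <= x + 1 by lra.
have H : {within `[x - 1, x + 1], continuous f}.
  have c1 := @parameterized_continuous (x - 1) (x + 1) f' xx (If _ _).
  have : {within `[x - 1, x + 1], continuous
     (fun y => f (x - 1) + \int[mu]_(t in `[x - 1, y]) f' t)}.
    by move=> y; apply: cvgD; [exact: cvg_cst|exact: c1].
  apply: subspace_eq_continuous => y; rewrite inE/= in_itv/= => /andP[xy _].
  by rewrite /from_subspace/= -hf//; ring.
have xx' : x - 1 < x + 1 by lra.
move/(continuous_within_itvP _ xx') : H => [H _ _].
by apply: H; rewrite in_itv/=; apply/andP; split; lra.
Qed.

Lemma continuous_mfun f (D : set R) : measurable D -> continuous f -> measurable_fun D f.
Proof.
by move=> mD cf; apply: measurable_funTS; exact: continuous_measurable_fun.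
Qed.

Lemma AC_bounded f f' a b : AC f f' -> exists C, 0 <= C /\ forall x, `[a, b]%classic x -> `|f x| <= C.
Proof.
move=> acf; have [ba|ab] := ltP b a.
  exists 0; split => // x /=; rewrite in_itv/= => /andP[ax xb].
  by have := le_lt_trans (le_trans ax xb) ba; rewrite ltxx.
exists (`|f a| + \int[mu]_(t in `[a, b]) `|f' t|); split.
  by rewrite addr_ge0// Rintegral_ge0.
move=> x /=; rewrite in_itv/= => /andP[ax xb].
have [+ _] := @AC_osc f f' (fun x => `|f' x|) a b a b x acf
   (fun a b => L1_norm (measurable_itv _) (acf.1 a b)) (fun=> lexx _) ax xb.
by have := ler_normD (f a) (f x - f a); rewrite addrC subrK; lra.
Qed.

Lemma ACM f f' g g' : AC f f' -> AC g g' ->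
  AC (fun x => f x * g x) (fun x => f' x * g x + f x * g' x).
Proof.
move=> acf acg; have [If hf] := acf; have [Ig hg] := acg.
have mf a b : measurable_fun `[a, b] f.
  by apply: continuous_mfun => //; exact: AC_continuous acf.
have mg a b : measurable_fun `[a, b] g.
  by apply: continuous_mfun => //; exact: AC_continuous acg.
have I1 a b : L1 `[a, b] (fun x => f' x * g x).
  by have [C [_ HC]] := AC_bounded a b acg; exact: L1M_bounded HC _.
have I2 a b : L1 `[a, b] (fun x => f x * g' x).
  have [C [_ HC]] := AC_bounded a b acf.
  have := @L1M_bounded `[a, b]%classic g' f C (measurable_itv _) (mf a b) HC (Ig a b).
  by under [X in L1 _ X -> _]eq_fun do rewrite mulrC.
pose w x := `|f' x| + `|g' x|.
have Iw a b : L1 `[a, b] w by apply: L1D => //; exact: L1_norm.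
have w0 x : 0 <= w x by rewrite addr_ge0.
apply: (@AC_square_error _ _ w) => // [a b|a b ab]; first exact: L1D.
exists 1 => x y ax xy yb; rewrite mul1r.
set W := \int[mu]_(t in `[x, y]) w t.
have W0 : 0 <= W by apply: Rintegral_ge0.
(* Since f y g y - f x g x = g y (f y - f x) + f x (g y - g x), only oscillations of f and g on
   [x, y] remain, each at most [W]. *)
have -> : f y * g y - f x * g x - \int[mu]_(t in `[x, y]) (f' t * g t + f t * g' t) =
  \int[mu]_(t in `[x, y]) (f' t * (g y - g t) + (f x - f t) * g' t).
  have -> : \int[mu]_(t in `[x, y]) (f' t * (g y - g t) + (f x - f t) * g' t) =
     \int[mu]_(t in `[x, y]) ((g y * f' t + f x * g' t) - (f' t * g t + f t * g' t)).
    by apply: eq_Rintegral => t _; ring.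
  rewrite RintegralB//; last first.
    exact: (L1D (measurable_itv _) (I1 _ _) (I2 _ _)).
    by apply: (L1D (measurable_itv _) (L1Z _ (measurable_itv _) (If _ _))
         (L1Z _ (measurable_itv _) (Ig _ _))).
  rewrite [in RHS]RintegralD//; last first.
    exact: (L1Z _ (measurable_itv _) (Ig _ _)).
    exact: (L1Z _ (measurable_itv _) (If _ _)).
  rewrite !RintegralZl//; [|exact: Ig|exact: If].
  rewrite -hf// -hg//; ring.
have -> : W ^+ 2 = \int[mu]_(t in `[x, y]) (W * w t).
  by rewrite RintegralZl//; exact: Iw.
have mtail t : `[x, y]%classic t -> `|f' t * (g y - g t) + (f x - f t) * g' t| <= W * w t.
  rewrite /= in_itv/= => /andP[xt ty].
  have [+ _] := @AC_osc f f' w a b x y t acf Iw (fun x => ler_wpDr (normr_ge0 _) (lexx _)) xt ty.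
  have [_ +] := @AC_osc g g' w a b x y t acg Iw (fun x => ler_wpDl (normr_ge0 _) (lexx _)) xt ty.
  rewrite -/W => h1 h2; rewrite (le_trans (ler_normD _ _))// !normrM.
  rewrite /w mulrDr mulrC lerD// ler_wpM2r// distrC//.
have Imain : L1 `[x, y] (fun t => f' t * (g y - g t) + (f x - f t) * g' t).
  apply: (@L1_le _ _ _ (fun t => W * w t)) => //; last by apply: L1Z.
  apply: measurable_funD; apply: measurable_funM.
  - exact: L1_measurable (If _ _).
  - by apply: measurable_funB => //.
  - by apply: measurable_funB => //.
  - exact: L1_measurable (Ig _ _).
by apply: abs_Int_le => //; exact: L1Z.
Qed.

(** The hypotheses on [phi] are a quantitative C^{1,1} condition rather than C^2, so as to cover the
    square of the negative part. *)
Lemma AC_comp (phi phi' : R -> R) C f f' : 0 <= C -> measurable_fun [set: R] phi' ->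
  (forall x y, `|phi y - phi x - phi' x * (y - x)| <= C * (y - x) ^+ 2) ->
  (forall x y, `|phi' y - phi' x| <= C * `|y - x|) ->
  AC f f' -> AC (fun x => phi (f x)) (fun x => phi' (f x) * f' x).
Proof.
move=> C0 mphi h1 h2 acf; have [If hf] := acf.
have mf (D : set R) : measurable D -> measurable_fun D f.
  by move=> mD; apply: continuous_mfun => //; exact: AC_continuous acf.
have mpf (D : set R) : measurable D -> measurable_fun D (phi' \o f).
  by move=> mD; apply: measurableT_comp => //; exact: mf.
pose w x := `|f' x|.
have Iw a b : L1 `[a, b] w by exact: L1_norm.
have osc x s y : x <= s -> s <= y -> `|f s - f x| <= \int[mu]_(t in `[x, y]) w t.
  move=> xs sy.
  by have [] := @AC_osc f f' w x y x y s acf Iw (fun=> lexx _) xs sy.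
have I1 a b : L1 `[a, b] (fun x => phi' (f x) * f' x).
  have [M [M0 HM]] := AC_bounded a b acf.
  under [X in L1 _ X]eq_fun do rewrite mulrC.
  apply: (@L1M_bounded _ f' (phi' \o f) (`|phi' 0| + C * M)) => //; first exact: mpf.
  move=> x xab /=; have := h2 0 (f x); rewrite subr0 => h.
  have := ler_normD (phi' 0) (phi' (f x) - phi' 0); rewrite addrC subrK.
  by have := ler_wpM2l C0 (HM x xab); lra.
apply: (@AC_square_error _ _ w) => //; first by move=> x; exact: normr_ge0.
move=> a b ab; exists (2 * C) => x y ax xy yb.
set W := \int[mu]_(t in `[x, y]) w t.
have W0 : 0 <= W by apply: Rintegral_ge0 => t _; exact: normr_ge0.
have Id : L1 `[x, y] (fun t => (phi' (f t) - phi' (f x)) * f' t).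
  apply: (@L1_le _ _ _ (fun t => C * W * w t)) => //; last 2 first.
  - exact: L1Z.
  - move=> t /=; rewrite in_itv/= => /andP[xt ty]; rewrite normrM ler_wpM2r//.
    by rewrite (le_trans (h2 _ _))// ler_wpM2l// osc.
  apply: measurable_funM; last exact: L1_measurable (If _ _).
  by apply: measurable_funB => //; exact: mpf.
have -> : phi (f y) - phi (f x) - \int[mu]_(t in `[x, y]) (phi' (f t) * f' t) =
   (phi (f y) - phi (f x) - phi' (f x) * (f y - f x)) -
    \int[mu]_(t in `[x, y]) ((phi' (f t) - phi' (f x)) * f' t).
  have -> : \int[mu]_(t in `[x, y]) ((phi' (f t) - phi' (f x)) * f' t) =
    \int[mu]_(t in `[x, y]) (phi' (f t) * f' t - phi' (f x) * f' t).
    by apply: eq_Rintegral => t _; ring.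
  rewrite RintegralB//; [|exact: I1|exact: (L1Z _ (measurable_itv _) (If _ _))].
  rewrite RintegralZl//; [|exact: If].
  by rewrite hf//; ring.
apply: (le_trans (ler_normB _ _)).
have e1 : `|phi (f y) - phi (f x) - phi' (f x) * (f y - f x)| <= C * W ^+ 2.
  rewrite (le_trans (h1 _ _))// ler_wpM2l// -[leLHS]ger0_norm ?sqr_ge0// normrX.
  by rewrite ler_pXn2r ?nnegrE// osc.
have e2 : `|\int[mu]_(t in `[x, y]) ((phi' (f t) - phi' (f x)) * f' t)| <= C * W ^+ 2.
  have -> : C * W ^+ 2 = \int[mu]_(t in `[x, y]) (C * W * w t).
    by rewrite RintegralZl//; [rewrite /W; ring|exact: Iw].
  apply: abs_Int_le => //; first exact: L1Z.
  move=> t /=; rewrite in_itv/= => /andP[xt ty]; rewrite normrM ler_wpM2r//.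
  by rewrite (le_trans (h2 _ _))// ler_wpM2l// osc.
lra.
Qed.

End Absolutely_continuous.

(** * Integrals over half-lines and decay at infinity *)

Section Global_integrals.
Context {R : realType}.
Implicit Types (f g h k : R -> R) (a b x y c : R).

Local Notation mu := (@lebesgue_measure R).

Lemma Int_tail_cvg0 k (D : (set R)^nat) : L1 setT k ->
  (forall n, measurable (D n)) ->
  (forall x, exists N, forall n, (N <= n)%N -> ~ D n x) ->
  \int[mu]_(x in D n) `|k x| @[n --> \oo] --> (0 : R).
Proof.
move=> Ik mD D0; have mk := L1_measurable Ik.
pose F n x := (`|k x| * \1_(D n) x)%:E.
have mF n : measurable_fun [set: R] (F n).
  apply/measurable_EFinP; apply: measurable_funM; first exact: measurableT_comp.
  exact: measurable_indic.
have m0 : measurable_fun [set: R] (cst 0%E : R -> \bar R) by [].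
have [] := @dominated_convergence _ _ R mu setT measurableT F (cst 0%E)
  (fun x => `|k x|%:E) mF m0 _ _ _.
- apply: ae_all => x _; have [N HN] := D0 x.
  apply: cvg_near_cst; exists N => // n /= Nn; rewrite /F indicE memNset ?mulr0//.
  exact: HN.
- exact: L1_norm.
- apply: ae_all => x n _; rewrite /F indicE lee_fin ger0_norm ?mulr_ge0//.
  by case: (x \in D n); rewrite ?mulr1 ?mulr0.
move=> _ _; rewrite integral0 => H.
have -> : (fun n => \int[mu]_(x in D n) `|k x|) =
  fine \o (fun n => (\int[mu]_x F n x)%E).
  apply/funext => n /=; rewrite Rintegral_mkcond /Rintegral; congr fine.
  apply: eq_integral => x _; rewrite /F patchE indicE.
  by case: (x \in D n); rewrite ?mulr1 ?mulr0.
by apply: fine_cvg.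
Qed.

(** Markov's inequality. On half-lines, which have infinite measure, it prevents an integrable
    function from staying away from 0. *)
Lemma L1_infinite_low k c (D : set R) : measurable D -> L1 D k -> 0 < c ->
  (forall x, D x -> c <= `|k x|) -> (mu D < +oo)%E.
Proof.
move=> mD Ik c0 H; have /integrableP[_ foo] := Ik.
have : (c%:E * mu D <= \int[mu]_(x in D) `|(k x)%:E|)%E.
  rewrite -integral_cst//; apply: ge0_le_integral => //.
  - by move=> x _; rewrite lee_fin ltW.
  - by apply: measurableT_comp => //; apply/measurable_EFinP; exact: L1_measurable Ik.
move=> /le_lt_trans/(_ foo).
rewrite ltey; apply: contraPP => /negP; rewrite -leNgt leye_eq => /eqP ->.
by rewrite gt0_muley ?lte_fin.
Qed.

Lemma mu_rayNy x : mu `]-oo, x] = +oo%E.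
Proof. by have := lebesgue_measure_itv `]-oo, x] => /= ->; rewrite ltNyr. Qed.

Lemma mu_rayy x : mu `[x, +oo[ = +oo%E.
Proof. by have := lebesgue_measure_itv `[x, +oo[; rewrite /= ltry. Qed.

Lemma Int_rayNy_split k x y : L1 setT k -> x <= y ->
  \int[mu]_(t in `]-oo, y]) k t =
  \int[mu]_(t in `]-oo, x]) k t + \int[mu]_(t in `[x, y]) k t.
Proof.
move=> Ik xy; rewrite -(@Rintegral_itv_obnd_cbnd _ x (BRight y)).
  rewrite -(@Rintegral_itvB _ k -oo%O (BRight y) x)//.
  - by rewrite addrC subrK.
  - by apply: L1S Ik.
by apply: L1S Ik.
Qed.

Lemma Int_rayy_split k x y : L1 setT k -> x <= y ->
  \int[mu]_(t in `[x, +oo[) k t =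
  \int[mu]_(t in `[x, y]) k t + \int[mu]_(t in `[y, +oo[) k t.
Proof.
move=> Ik xy; rewrite -(@Rintegral_itv_obnd_cbnd _ y +oo%O).
  rewrite -(@Rintegral_itvB _ k (BLeft x) +oo%O y)//.
  - by rewrite addrC subrK.
  - by apply: L1S Ik.
by apply: L1S Ik.
Qed.

Lemma IntT_split k x : L1 setT k ->
  \int[mu]_t k t = \int[mu]_(t in `]-oo, x]) k t + \int[mu]_(t in `[x, +oo[) k t.
Proof.
move=> Ik; rewrite -(@Rintegral_itv_obnd_cbnd _ x +oo%O); last exact: L1S Ik.
rewrite -set_itvNyy -(@Rintegral_itvB _ k -oo%O +oo%O x)//.
- by rewrite addrC subrK.
- by rewrite set_itvNyy.
Qed.

(** The integrability of [k] gives [h] a limit l at minus infinity. If l were not 0, [h] would be at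
    least |l| / 2 in absolute value on a whole half-line, against its integrability. *)
Lemma AC_rayNy h k x : AC h k -> L1 setT h -> L1 setT k ->
  \int[mu]_(t in `]-oo, x]) k t = h x.
Proof.
move=> [_ hk] Ih Ik; set l := h x - \int[mu]_(t in `]-oo, x]) k t.
apply/esym/eqP; rewrite -subr_eq0 -/l; apply/negPn/negP => l0.
have hl y : y <= x -> h y - l = \int[mu]_(t in `]-oo, y]) k t.
  move=> yx; have := hk _ _ yx; rewrite /l (Int_rayNy_split Ik yx); lra.
have := @Int_tail_cvg0 k (fun n => `]-oo, - n%:R]%classic) Ik (fun n => measurable_itv _).
have D0 y : exists N, forall n, (N <= n)%N -> ~ `]-oo, - n%:R]%classic y.
  exists (Num.bound `|- y|).+1 => n Nn /=; rewrite in_itv/= => yn.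
  have : - y < n%:R.
    apply: (le_lt_trans (ler_norm _)); apply: (lt_le_trans (archi_boundP (normr_ge0 _))).
    by rewrite ler_nat; exact: ltnW.
  lra.
move=> /(_ D0) /cvgrPdist_lt /(_ (`|l| / 2)).
have l2 : 0 < `|l| / 2 by rewrite divr_gt0// normr_gt0.
move=> /(_ l2) [N _ /(_ N (leqnn N))] /=; rewrite sub0r normrN ger0_norm ?Rintegral_ge0// => small.
pose y := Num.min x (- N%:R).
have yx : y <= x by rewrite ge_min lexx.
have yN : y <= - N%:R by rewrite ge_min lexx orbT.
suff : (mu `]-oo, y] < +oo)%E by rewrite mu_rayNy.
apply: (@L1_infinite_low h (`|l| / 2)) => //; first by apply: L1S Ih.
move=> z /=; rewrite in_itv/= => zy.
have zx := le_trans zy yx.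
have : `|h z - l| < `|l| / 2.
  rewrite hl//; apply: le_lt_trans small.
  apply: (le_trans (le_normr_Rintegral _ _)) => //; first exact: L1S Ik.
  rewrite (@Int_rayNy_split (fun t => `|k t|) z (- N%:R)); last 2 first.
  - exact: L1_norm.
  - exact: le_trans zy yN.
  by rewrite lerDl Rintegral_ge0.
have := ler_normD (h z) (l - h z); have -> : h z + (l - h z) = l by ring.
rewrite (distrC l); lra.
Qed.

Lemma AC_rayy h k x : AC h k -> L1 setT h -> L1 setT k ->
  \int[mu]_(t in `[x, +oo[) k t = - h x.
Proof.
move=> [_ hk] Ih Ik; set l := h x + \int[mu]_(t in `[x, +oo[) k t.
apply/eqP; rewrite -addr_eq0 addrC -/l; apply/negPn/negP => l0.
have hl y : x <= y -> l - h y = \int[mu]_(t in `[y, +oo[) k t.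
  move=> xy; have := hk _ _ xy; rewrite /l (Int_rayy_split Ik xy); lra.
have := @Int_tail_cvg0 k (fun n => `[n%:R, +oo[%classic) Ik (fun n => measurable_itv _).
have D0 y : exists N, forall n, (N <= n)%N -> ~ `[n%:R, +oo[%classic y.
  exists (Num.bound `|y|).+1 => n Nn /=; rewrite in_itv/= andbT => yn.
  have : y < n%:R.
    apply: (le_lt_trans (ler_norm _)); apply: (lt_le_trans (archi_boundP (normr_ge0 _))).
    by rewrite ler_nat; exact: ltnW.
  lra.
move=> /(_ D0) /cvgrPdist_lt /(_ (`|l| / 2)).
have l2 : 0 < `|l| / 2 by rewrite divr_gt0// normr_gt0.
move=> /(_ l2) [N _ /(_ N (leqnn N))] /=; rewrite sub0r normrN ger0_norm ?Rintegral_ge0// => small.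
pose y := Num.max x N%:R.
have yx : x <= y by rewrite le_max lexx.
have yN : N%:R <= y by rewrite le_max lexx orbT.
suff : (mu `[y, +oo[ < +oo)%E by rewrite mu_rayy.
apply: (@L1_infinite_low h (`|l| / 2)) => //; first by apply: L1S Ih.
move=> z /=; rewrite in_itv/= andbT => zy.
have zx := le_trans yx zy.
have : `|l - h z| < `|l| / 2.
  rewrite hl//; apply: le_lt_trans small.
  apply: (le_trans (le_normr_Rintegral _ _)) => //; first exact: L1S Ik.
  rewrite (@Int_rayy_split (fun t => `|k t|) N%:R z); last 2 first.
  - exact: L1_norm.
  - exact: le_trans yN zy.
  by rewrite lerDr Rintegral_ge0.
have := ler_normD (h z) (l - h z); rewrite addrC subrK; lra.
Qed.

Lemma AC_IntT h k : AC h k -> L1 setT h -> L1 setT k -> \int[mu]_t k t = 0.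
Proof.
by move=> ac Ih Ik; rewrite (IntT_split 0 Ik) (AC_rayNy 0 ac)// (AC_rayy 0 ac)// subrr.
Qed.

(** By the two ray formulas, the absolute value of [h] at x is at most the integral of |k| over the
    half-line from x that points away from 0. *)
Lemma AC_decay h k e : AC h k -> L1 setT h -> L1 setT k -> 0 < e ->
  exists2 M : R, 0 < M & forall x, M <= `|x| -> `|h x| < e.
Proof.
move=> ac Ih Ik e0.
have mD (n : nat) : measurable (`]-oo, - n%:R]%classic `|` `[n%:R, +oo[%classic : set R).
  by apply: measurableU; exact: measurable_itv.
have D0 y : exists N : nat, forall n : nat, (N <= n)%N -> ~ (`]-oo, - n%:R]%classic `|` `[n%:R, +oo[%classic) y.
  exists (Num.bound `|y|).+1 => n Nn /=.
  have : `|y| < n%:R.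
    apply: (lt_le_trans (archi_boundP (normr_ge0 _))).
    by rewrite ler_nat; exact: ltnW.
  rewrite ltr_norml => /andP[y1 y2].
  by rewrite !in_itv/= andbT => -[]; lra.
have := Int_tail_cvg0 Ik mD D0.
move=> /cvgrPdist_lt /(_ e e0) [N _ /(_ N.+1 (leqnSn N))] /=; rewrite sub0r normrN.
rewrite ger0_norm ?Rintegral_ge0// => small.
exists N.+1%:R => // x Nx; apply: le_lt_trans small.
have In : L1 setT (fun x => `|k x|) by exact: L1_norm.
have aux (A B : set R) : measurable A -> measurable B -> A `<=` B ->
    `|\int[mu]_(t in A) k t| <= \int[mu]_(t in B) `|k t|.
  move=> mA mB AB; apply: (le_trans (le_normr_Rintegral _ _)) => //; first exact: L1S Ik.
  rewrite -(setDUK AB) Rintegral_setU//; last 3 first.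
  - exact: measurableD.
  - by rewrite setDUK//; exact: L1S In.
  - by apply/disj_setPS => z [zA [_]]; exact.
  by rewrite lerDl Rintegral_ge0.
have [x0|x0] := leP 0 x.
  rewrite -normrN -(AC_rayy x ac)//; apply: aux => // z /=.
  rewrite !in_itv/= !andbT => xz; right.
  by rewrite (le_trans _ xz)// -(ger0_norm x0).
rewrite -(AC_rayNy x ac)//; apply: aux => // z /=.
rewrite !in_itv/= !andbT => xz; left.
by rewrite (le_trans xz)//; move: Nx; rewrite ltr0_norm//; lra.
Qed.

End Global_integrals.

(** * The space H^1 on the line *)

Section H1_functions.
Context {R : realType}.
Implicit Types (f g h k : R -> R) (a b x y c : R).

Local Notation mu := (@lebesgue_measure R).

(** Pairs of the continuous representative and some representative of its derivative: the values of
    [f] are meaningful at points, those of [g] only up to null sets ([H1_ae]). *)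
Definition H1 f g := [/\ AC f g, L2 f & L2 g].

Lemma H1D f f' g g' : H1 f f' -> H1 g g' ->
  H1 (fun x => f x + g x) (fun x => f' x + g' x).
Proof. by move=> [? ? ?] [? ? ?]; split; [exact: ACD|exact: L2D|exact: L2D]. Qed.

Lemma H1Z f f' c : H1 f f' -> H1 (fun x => c * f x) (fun x => c * f' x).
Proof. by move=> [? ? ?]; split; [exact: ACZ|exact: L2Z|exact: L2Z]. Qed.

Lemma H1N f f' : H1 f f' -> H1 (fun x => - f x) (fun x => - f' x).
Proof.
move=> /(H1Z (-1)); under eq_fun do rewrite mulN1r.
by under [X in H1 _ X]eq_fun do rewrite mulN1r.
Qed.

Lemma H1B f f' g g' : H1 f f' -> H1 g g' ->
  H1 (fun x => f x - g x) (fun x => f' x - g' x).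
Proof. by move=> hf hg; apply: H1D => //; exact: H1N. Qed.

Lemma AC_ae f g g' : AC f g -> (forall a b, L1 `[a, b] g') ->
  {ae mu, forall x, g x = g' x} -> AC f g'.
Proof.
move=> [Ig h] Ig' gg'; split => // a b ab; rewrite h//.
apply: Int_ae => //; [exact: L1_measurable (Ig a b)|exact: L1_measurable (Ig' a b)|].
by apply: (ae_imp gg').
Qed.

Lemma H1_ae f g g' : H1 f g -> measurable_fun [set: R] g' ->
  {ae mu, forall x, g x = g' x} -> H1 f g'.
Proof.
move=> [h lf lg] mg' gg'.
have lg' : L2 g' by apply: L2_ae lg _ => //; apply: (ae_imp gg').
by split => //; apply: AC_ae gg' => // a b; exact: L2_L1loc.
Qed.

Lemma H1_continuous f g : H1 f g -> continuous f.
Proof. by case=> + _ _; exact: AC_continuous. Qed.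

Lemma H1_L1M f f' g g' : H1 f f' -> H1 g g' ->
  [/\ AC (fun x => f x * g x) (fun x => f' x * g x + f x * g' x),
      L1 setT (fun x => f x * g x) & L1 setT (fun x => f' x * g x + f x * g' x)].
Proof.
move=> [acf lf lf'] [acg lg lg']; split; [exact: ACM|exact: L2_L1M|].
by apply: L1D => //; exact: L2_L1M.
Qed.

(** f(x)^2 is the integral of 2 f f' over the left ray and of -2 f f' over the right one, and both
    integrands are at most f^2 + f'^2. The constant is sharp, with equality for a peakon at its
    crest, and the amplitude estimate depends on this sharpness. *)
Lemma H1_sup f f' x : H1 f f' -> 2 * f x ^+ 2 <= ip f f + ip f' f'.
Proof.
move=> hf; have [ac I1 I2] := H1_L1M hf hf; case: hf => _ lf lf'.
have Is : L1 setT (fun x => f x * f x + f' x * f' x).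
  by apply: L1D => //; exact: L2_L1M.
rewrite /ip -RintegralD//; last exact: L2_L1M.
rewrite (IntT_split x Is).
have e1 : f x ^+ 2 <= \int[mu]_(t in `]-oo, x]) (f t * f t + f' t * f' t).
  rewrite expr2 -(AC_rayNy x ac I1 I2); apply: le_Rintegral => //.
  - by apply: L1S I2.
  - by apply: L1S Is.
  - by move=> t _; have := sqr_ge0 (f t - f' t); lra.
have e2 : f x ^+ 2 <= \int[mu]_(t in `[x, +oo[) (f t * f t + f' t * f' t).
  rewrite expr2 -[leLHS]opprK -(AC_rayy x ac I1 I2).
  have <- : \int[mu]_(t in `[x, +oo[) ((-1) * (f' t * f t + f t * f' t)) =
    - \int[mu]_(t in `[x, +oo[) (f' t * f t + f t * f' t).
    by rewrite RintegralZl ?mulN1r//; apply: L1S I2.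
  apply: le_Rintegral => //.
  - by apply: L1Z => //; apply: L1S I2.
  - by apply: L1S Is.
  - by move=> t _; have := sqr_ge0 (f t + f' t); lra.
lra.
Qed.

Lemma H1_sup_norm f f' x : H1 f f' -> `|f x| <= nrm f + nrm f'.
Proof.
move=> hf; rewrite -ler_sqr ?nnegrE ?addr_ge0 ?nrm_ge0//.
rewrite -normrX ger0_norm ?sqr_ge0// sqrrD !sqr_nrm.
have := H1_sup x hf; have := mulr_ge0 (nrm_ge0 f) (nrm_ge0 f').
have := ip_ge0 f; have := ip_ge0 f'; lra.
Qed.

Lemma H1_bounded f f' : H1 f f' -> exists2 C, 0 <= C & forall x, `|f x| <= C.
Proof.
move=> hf; exists (nrm f + nrm f'); first by rewrite addr_ge0 ?nrm_ge0.
by move=> x; exact: H1_sup_norm.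
Qed.

Lemma H1M f f' g g' : H1 f f' -> H1 g g' ->
  H1 (fun x => f x * g x) (fun x => f' x * g x + f x * g' x).
Proof.
move=> hf hg; have [ac I1 I2] := H1_L1M hf hg.
have [C _ HC] := H1_bounded hf; have [E _ HE] := H1_bounded hg.
case: hf hg => _ lf lf' [_ lg lg']; split=> //.
  by apply: L2M_bounded HE _ => //; exact: L2_measurable.
apply: L2D; first by apply: L2M_bounded HE _ => //; exact: L2_measurable.
under eq_fun do rewrite mulrC.
by apply: L2M_bounded HC _ => //; exact: L2_measurable.
Qed.

Lemma H1_decay f f' g g' e : H1 f f' -> H1 g g' -> 0 < e ->
  exists2 M : R, 0 < M & forall x, M <= `|x| -> `|f x * g x| < e.
Proof. by move=> hf hg e0; have [ac I1 I2] := H1_L1M hf hg; exact: (AC_decay ac). Qed.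

Lemma H1_rayNy f f' g g' x : H1 f f' -> H1 g g' ->
  \int[mu]_(t in `]-oo, x]) (f' t * g t + f t * g' t) = f x * g x.
Proof. by move=> hf hg; have [ac I1 I2] := H1_L1M hf hg; exact: (AC_rayNy x ac). Qed.

Lemma H1_rayy f f' g g' x : H1 f f' -> H1 g g' ->
  \int[mu]_(t in `[x, +oo[) (f' t * g t + f t * g' t) = - (f x * g x).
Proof. by move=> hf hg; have [ac I1 I2] := H1_L1M hf hg; exact: (AC_rayy x ac). Qed.

(** The conditions at 0 keep the composition and its derivative square integrable. *)
Lemma H1_comp (phi phi' : R -> R) C f f' : 0 <= C -> measurable_fun [set: R] phi' ->
  phi 0 = 0 -> phi' 0 = 0 ->
  (forall x y, `|phi y - phi x - phi' x * (y - x)| <= C * (y - x) ^+ 2) ->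
  (forall x y, `|phi' y - phi' x| <= C * `|y - x|) ->
  H1 f f' -> H1 (fun x => phi (f x)) (fun x => phi' (f x) * f' x).
Proof.
move=> C0 mphi p0 p'0 h1 h2 hf; have [B B0 HB] := H1_bounded hf.
have [acf lf lf'] := hf.
have ac := AC_comp C0 mphi h1 h2 acf.
have p'f x : `|phi' (f x)| <= C * B.
  have := h2 0 (f x); rewrite p'0 !subr0 => h; rewrite (le_trans h)//.
  by rewrite ler_wpM2l.
have mphi' : measurable_fun [set: R] (fun x => phi' (f x)).
  by apply: measurableT_comp => //; exact: L2_measurable.
split => //.
- have mp : measurable_fun [set: R] (fun x => phi (f x)).
    by apply: continuous_mfun => //; exact: AC_continuous ac.
  apply: (@L2_bound _ f _ (C * B)) => // x.
  have := h1 0 (f x); rewrite p0 p'0 mul0r !subr0 => h; rewrite (le_trans h)//.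
  rewrite -mulrA ler_wpM2l// -[leLHS]ger0_norm ?sqr_ge0// normrX expr2 ler_wpM2r//.
- under eq_fun do rewrite mulrC.
  by apply: L2M_bounded p'f _.
Qed.

Lemma AC_C1 f f' : (forall x, is_derive x 1 f (f' x)) -> continuous f' -> AC f f'.
Proof.
move=> df cf.
have If a b : L1 `[a, b] f'.
  apply: continuous_compact_integrable; first exact: segment_compact.
  exact: continuous_subspaceT.
split=> // a b; rewrite le_eqVlt => /predU1P[->|ab].
  by rewrite subrr set_itv1 Rintegral_set1.
have der x : derivable f x 1 by case: (df x).
have cff : continuous f.
  by move=> x; apply: differentiable_continuous; apply/derivable1_diffP.
rewrite /Rintegral (@continuous_FTC2 _ f' f)//.
- exact: continuous_subspaceT.
- split => //.
  + by apply: cvg_at_right_filter; exact: cff.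
  + by apply: cvg_at_left_filter; exact: cff.
- by move=> x _; rewrite derive1E; case: (df x).
Qed.

Lemma AC_is_derive f f' x : AC f f' -> {for x, continuous f'} -> is_derive x 1 f (f' x).
Proof.
move=> [If hf] cf.
have xx : x < x + 1 by lra.
have xx' : x - 1 < x by lra.
have [dF F'] := continuous_FTC1_closed xx (If (x - 1) (x + 1)) xx' cf.
have dF1 : is_derive x 1 (fun y => \int[mu]_(t in `[x - 1, y]) f' t) (f' x).
  by split; [exact: dF|move: F'; rewrite derive1E].
have dc : is_derive x 1 (fun y => f (x - 1) + \int[mu]_(t in `[x - 1, y]) f' t) (f' x).
  have := @is_deriveD _ _ _ (cst (f (x - 1))) _ x 1 _ _ (is_derive_cst _ _ _) dF1.
  by rewrite add0r.
have [d1 e1] := dc.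
have near_eq : \forall y \near x, f (x - 1) + \int[mu]_(t in `[x - 1, y]) f' t = f y.
  near=> y; rewrite -hf; first ring.
  by near: y; exact: lt_le_nbhsr.
by apply: near_eq_is_derive near_eq dc => //; rewrite ?oner_eq0.
Unshelve. all: by end_near.
Qed.

End H1_functions.

(** * Test functions and weak derivatives *)

Section Smooth_functions.
Context {R : realType}.
Implicit Types (f g : R -> R) (a b x y c : R).

(** Unlike [derive1n], the recursion differentiates [f] first, so that an explicit formula for the
    derivative can be fed back into an induction. *)
Fixpoint Cn (n : nat) f : Prop :=
  if n is m.+1 then (forall x, derivable f x 1) /\ Cn m (derive1 f) else True.

Lemma Cn_derivable f : (forall n, Cn n f) ->
  forall n x, derivable (derive1n n f) x 1.
Proof.
move=> Cf n; have : Cn n.+1 f by exact: Cf.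
elim: n f {Cf} => [f [] //|n IH f].
rewrite derive1Sn => -[_]; exact: IH.
Qed.

Lemma Cn_is_derive n f f' : (forall x, is_derive x 1 f (f' x)) -> Cn n f' -> Cn n.+1 f.
Proof.
move=> df Cf'; split; first by move=> x; case: (df x).
have -> // : derive1 f = f'.
by apply/funext => x; rewrite derive1E; case: (df x).
Qed.

Lemma CnS n f : Cn n.+1 f -> Cn n f.
Proof.
by elim: n f => [//|n IH f [df Cf]]; split => //; exact: IH.
Qed.

Lemma is_derive_derive1 f x : derivable f x 1 -> is_derive x 1 f (derive1 f x).
Proof. by move=> df; split => //; rewrite derive1E. Qed.

Lemma CnD n f g : Cn n f -> Cn n g -> Cn n (fun x => f x + g x).
Proof.
elim: n f g => [//|n IH f g [df Cf] [dg Cg]].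
apply: (@Cn_is_derive _ _ (fun x => derive1 f x + derive1 g x)); last exact: IH.
by move=> x; apply: is_deriveD; exact: is_derive_derive1.
Qed.

Lemma CnM n f g : Cn n f -> Cn n g -> Cn n (fun x => f x * g x).
Proof.
elim: n f g => [//|n IH f g Cf Cg]; have [df Cf'] := Cf; have [dg Cg'] := Cg.
apply: (@Cn_is_derive _ _ (fun x => f x * derive1 g x + derive1 f x * g x)).
  move=> x.
  apply: (is_derive_eq (is_deriveM (is_derive_derive1 (df x)) (is_derive_derive1 (dg x)))).
  by rewrite /GRing.scale/= [g x * _]mulrC.
by apply: CnD; apply: IH => //; exact: CnS.
Qed.

Lemma Cn_cst n c : Cn n (fun=> c).
Proof.
elim: n c => [//|n IH c]; by apply: (@Cn_is_derive _ _ (fun=> 0)); exact: IH.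
Qed.

Lemma is_derive_affine f a b x : derivable f (a * x + b) 1 ->
  is_derive x 1 (fun y => f (a * y + b)) (a * derive1 f (a * x + b)).
Proof.
move=> df.
have daff : is_derive x 1 (fun y : R => a * y + b) a.
  have := is_deriveD (is_deriveZ a (is_derive_id x 1)) (is_derive_cst b x 1).
  by rewrite addr0 /GRing.scale/= mulr1.
have := @is_derive1_comp _ f (fun y : R => a * y + b) x _ _ (is_derive_derive1 df) daff.
by rewrite mulrC.
Qed.

Lemma Cn_affine n f a b : Cn n f -> Cn n (fun x => f (a * x + b)).
Proof.
elim: n f => [//|n IH f [df Cf]].
apply: (@Cn_is_derive _ _ (fun x => a * derive1 f (a * x + b))).
  by move=> x; exact: is_derive_affine.
by apply: CnM; [exact: Cn_cst|exact: IH].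
Qed.

(* The functions P(1/x) exp(-1/x), extended by 0 to x <= 0, are stable under
   derivation: P becomes X^2 (P - P'). *)
Definition flat (p : {poly R}) x : R := if 0 < x then p.[x^-1] * expR (- x^-1) else 0.

(** exp(y) is the (n+1)-st power of exp(y / (n+1)), which is at least 1 + y / (n+1). *)
Lemma expR_ge_pow n y : 0 <= y -> (y / n.+1%:R) ^+ n.+1 <= expR y.
Proof.
move=> y0; have n0 : (0 : R) < n.+1%:R by rewrite ltr0n.
have {2}-> : y = n.+1%:R * (y / n.+1%:R) by field; rewrite gt_eqF.
rewrite expRM_natl ler_pXn2r ?nnegrE ?expR_ge0 ?divr_ge0 ?(ltW n0)//.
by apply: le_trans (expR_ge1Dx _); rewrite lerDr.
Qed.

(** The range y >= 1 is enough, as y stands for 1/x with x near 0 on the right; there every power of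
    y is dominated by the highest one. *)
Lemma poly_exp_bounded (p : {poly R}) : exists2 C, 0 <= C &
  forall y, 1 <= y -> `|p.[y]| * expR (- y) <= C.
Proof.
have [N HN] : exists N, forall y, 1 <= y ->
    `|p.[y]| <= (\sum_(i < size p) `|p`_i|) * y ^+ N.
  exists (size p) => y y1; rewrite horner_coef (le_trans (ler_norm_sum _ _ _))//.
  rewrite mulr_suml ler_sum// => i _; rewrite normrM ler_wpM2l//.
  rewrite normrX ger0_norm ?(le_trans _ y1)// ler_weXn2l// ltnW//.
pose S := \sum_(i < size p) `|p`_i|.
have S0 : 0 <= S by apply: sumr_ge0.
exists (S * N.+1%:R ^+ N.+1); first by rewrite mulr_ge0 ?exprn_ge0.
move=> y y1; have y0 : 0 <= y by rewrite (le_trans _ y1).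
rewrite expRN ler_pdivrMr ?expR_gt0// (le_trans (HN _ y1))// -mulrA ler_wpM2l//.
have := expR_ge_pow N y0; rewrite expr_div_n ler_pdivrMr ?exprn_gt0 ?ltr0n// mulrC.
apply: le_trans; rewrite exprS ler_peMl// exprn_ge0//.
Qed.

Lemma flat_derive p x : is_derive x 1 (flat p) (flat ('X ^+ 2 * (p - p^`())) x).
Proof.
have [x0|x0|<-] := ltgtP 0 x.
- have dxi : is_derive x 1 (fun y : R => y^-1) (- x ^- 2).
    have := @is_deriveV _ id x 1 1 (lt0r_neq0 x0) (is_derive_id x 1).
    by rewrite /GRing.scale/= mulr1.
  have dp : is_derive (x^-1) 1 (fun y => p.[y]) (p^`().[x^-1]).
    by split; [exact: derivable_horner|rewrite -derive1E -derivE].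
  have d1 := @is_derive1_comp _ _ _ x _ _ dp dxi.
  have d2 := @is_derive1_comp _ _ _ x _ _ (is_derive_expR (- x^-1)) (is_deriveN dxi).
  have d3 := is_deriveM d1 d2.
  apply: (near_eq_is_derive (f := fun y : R => p.[y^-1] * expR (- y^-1))).
    near=> y; rewrite /flat ifT//.
    by near: y; exact: lt_nbhsr.
  apply: is_derive_eq d3 _.
  change (p.[x^-1] * (expR (- x^-1) * - - x ^- 2) +
    expR (- x^-1) * (p^`().[x^-1] * - x ^- 2) = flat ('X ^+ 2 * (p - p^`())) x).
  rewrite /flat x0 hornerM hornerXn hornerD hornerN exprVn.
  by move: (expR _) (x ^- 2) p.[_] p^`().[_] => ? ? ? ?; ring.
- have -> : flat ('X ^+ 2 * (p - p^`())) x = 0 by rewrite /flat ltNge (ltW x0).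
  apply: (near_eq_is_derive (f := cst 0)).
  near=> y; rewrite /flat ifF//; apply/negbTE; rewrite -leNgt ltW//.
  by near: y; exact: lt_nbhsl.
- have -> : flat ('X ^+ 2 * (p - p^`())) 0 = 0 by rewrite /flat ltxx.
  (* The difference quotient at 0 is [h] times the value of X^2 p exp(-X) at 1/h: bounding X^2 p
     instead of X p leaves the factor [h], which tends to 0. *)
  have [C C0 HC] := poly_exp_bounded ('X ^+ 2 * p).
  have H : h^-1 *: (flat p (h + 0) - flat p 0) @[h --> 0^'] --> (0 : R).
    apply/cvgrPdist_le => e e0; near=> h.
    rewrite sub0r normrN /GRing.scale/= addr0 {2}/flat ltxx subr0 /flat.
    case: ifPn => [h0|_]; last by rewrite mulr0 normr0 ltW.
    have h1 : 1 <= h^-1.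
      rewrite invr_ge1 ?unitfE ?gt_eqF//; near: h.
      exists 1 => //= z /=; rewrite sub0r normrN => z1 _.
      by rewrite (le_trans (ler_norm _))// ltW.
    have := HC _ h1; rewrite !hornerE/= => H.
    have hi : 0 <= h^-1 by rewrite invr_ge0 ltW.
    rewrite normrM (ger0_norm (exprn_ge0 2 hi)) in H.
    have -> : `|h^-1 * p.[h^-1] * expR (- h^-1)| =
        h * ((h^-1) ^+ 2 * `|p.[h^-1]| * expR (- h^-1)).
      rewrite normrM (ger0_norm (expR_ge0 _)) normrM (ger0_norm hi).
      by field; rewrite gt_eqF.
    apply: (@le_trans _ _ (h * C)); first by rewrite ler_wpM2l// ltW.
    have : h * (C + 1) <= e.
      rewrite -ler_pdivlMr ?ltr_wpDl//; near: h.
      exists (e / (C + 1)) => /=; first by rewrite divr_gt0// ltr_wpDl.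
      move=> z /=; rewrite sub0r normrN => z1 _.
      by rewrite (le_trans (ler_norm _))// ltW.
    by rewrite mulrDr mulr1; move: h0; lra.
  have H1 : h^-1 *: (flat p (h *: 1 + 0) - flat p 0) @[h --> 0^'] --> (0 : R).
    have -> // : (fun h : R => h^-1 *: (flat p (h *: 1 + 0) - flat p 0)) =
      (fun h => h^-1 *: (flat p (h + 0) - flat p 0)).
    by apply/funext => h; rewrite /GRing.scale/= mulr1.
  by split; [apply/cvg_ex; exists 0|exact: (cvg_lim _ H1)].
Unshelve. all: by end_near.
Qed.

Lemma Cn_flat n p : Cn n (flat p).
Proof.
elim: n p => [//|n IH p].
by apply: (@Cn_is_derive _ _ (flat ('X ^+ 2 * (p - p^`())))) => // x; exact: flat_derive.
Qed.

(** Flat at 0 and, by reflection, at 1. Its mass is left unnormalised and appears below as the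
    factor [step 1]. *)
Definition mollifier x : R := flat 1 x * flat 1 (1 - x).

Lemma Cn_mollifier n : Cn n mollifier.
Proof.
apply: CnM; first exact: Cn_flat.
have := @Cn_affine n _ (-1) 1 (Cn_flat n 1).
by under [X in Cn _ X]eq_fun do rewrite mulN1r addrC.
Qed.

Lemma flat1_ge0 x : 0 <= flat 1 x.
Proof. by rewrite /flat; case: ifP => // _; rewrite hornerE mul1r expR_ge0. Qed.

Lemma flat1_le1 x : flat 1 x <= 1.
Proof.
rewrite /flat; case: ifP => // x0; rewrite hornerE mul1r -expR0 ler_expR.
by rewrite oppr_le0 invr_ge0 ltW.
Qed.

Lemma mollifier_ge0 x : 0 <= mollifier x.
Proof. by rewrite mulr_ge0 ?flat1_ge0. Qed.

Lemma mollifier_le1 x : mollifier x <= 1.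
Proof. by rewrite -[leRHS]mulr1 ler_pM ?flat1_ge0 ?flat1_le1. Qed.

Lemma mollifier_out x : x <= 0 \/ 1 <= x -> mollifier x = 0.
Proof.
move=> [x0|x1]; rewrite /mollifier /flat.
  by rewrite ltNge x0 mul0r.
by rewrite subr_gt0 (ltNge x 1) x1 mulr0.
Qed.

Lemma mollifier_gt0 x : 0 < x < 1 -> 0 < mollifier x.
Proof.
have f1 y : 0 < y -> 0 < flat 1 y.
  by move=> y0; rewrite /flat y0 hornerE mul1r expR_gt0.
by move=> /andP[x0 x1]; rewrite mulr_gt0 ?f1 ?subr_gt0.
Qed.

End Smooth_functions.

(** * Test functions, bumps and Lebesgue points *)

Section Weak_derivatives.
Context {R : realType}.
Implicit Types (f g h k phi : R -> R) (a b x y c e : R).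

Local Notation mu := (@lebesgue_measure R).

Lemma L1_locally_integrable f : measurable_fun [set: R] f -> (forall a b, L1 `[a, b] f) ->
  locally_integrable [set: R] f.
Proof.
move=> mf If; split => //; first exact: openT.
move=> K _ cK; have [M [_ HM]] := compact_bounded cK.
have /integrableP[_] := If (- (M + 1)) (M + 1).
apply: le_lt_trans; apply: ge0_subset_integral => //=.
- by apply: closed_measurable; apply: compact_closed => //; exact: Rhausdorff.
- by do 2 apply: measurableT_comp => //; exact: measurable_funTS.
- move=> x Kx /=; rewrite in_itv/= -ler_norml; apply: HM Kx.
  by rewrite ltrDl.
Qed.

Lemma locally_integrable_L1 f a b : locally_integrable [set: R] f -> L1 `[a, b] f.
Proof.
move=> [mf _ h]; apply/integrableP; split.
  by apply/measurable_EFinP; exact: measurable_funTS.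
by apply: h => //; exact: segment_compact.
Qed.

Lemma support_itv a b f : (forall x, ~ `[a, b]%classic x -> f x = 0) -> f \_ `[a, b] = f.
Proof.
move=> f0; apply/funext => x; rewrite patchE; case: ifPn => // /negP xab.
by rewrite f0// => h; apply: xab; rewrite inE.
Qed.

Lemma L1_support a b f : (forall x, ~ `[a, b]%classic x -> f x = 0) ->
  L1 `[a, b] f -> L1 setT f.
Proof.
move=> f0 If.
have [+ _] := @integrable_mkcond _ _ R mu _ (EFin \o f) (measurable_itv `[a, b]).
move=> /(_ If).
by rewrite restrict_EFin support_itv.
Qed.

Lemma Int_support a b f : (forall x, ~ `[a, b]%classic x -> f x = 0) ->
  \int[mu]_x f x = \int[mu]_(x in `[a, b]) f x.
Proof. by move=> f0; rewrite [RHS]Rintegral_mkcond support_itv. Qed.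

Lemma test_function_C1 phi : test_function phi ->
  [/\ AC phi (derive1 phi), continuous phi, continuous (derive1 phi) &
   exists M, [/\ 0 <= M, forall x, ~ `[- M, M]%classic x -> phi x = 0,
     forall x, ~ `[- M, M]%classic x -> derive1 phi x = 0, phi M = 0 & phi (- M) = 0]].
Proof.
move=> [dphi [M HM]].
have d0 x : derivable phi x 1 by exact: (dphi 0%N).
have d1 x : derivable (derive1 phi) x 1 by have := dphi 1%N x; rewrite derive1n1.
have c0 : continuous phi.
  by move=> x; apply: differentiable_continuous; apply/derivable1_diffP.
have c1 : continuous (derive1 phi).
  by move=> x; apply: differentiable_continuous; apply/derivable1_diffP.
split => //; first by apply: AC_C1 => // x; exact: is_derive_derive1.
(* The radius in [test_function] may be negative and says nothing about its own boundary points;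
   this one is nonnegative and makes [phi] vanish at the endpoints too, so that no boundary terms
   arise. *)
have M1 : 0 <= `|M| + 1 by rewrite addr_ge0.
have out x : `|M| < `|x| -> phi x = 0.
  by move=> Mx; apply: HM; apply: le_lt_trans Mx; exact: ler_norm.
have outN x : ~ `[- (`|M| + 1), `|M| + 1]%classic x -> `|M| < `|x|.
  rewrite /= in_itv/= -ler_norml => /negP; rewrite -ltNge => h.
  by apply: lt_trans h; rewrite ltrDl.
exists (`|M| + 1); split => //.
- by move=> x /outN; exact: out.
- move=> x /outN Mx.
  have [_ <-] : is_derive x 1 phi 0; last by rewrite derive1E.
  apply: (near_eq_is_derive (f := cst 0)); near=> y; rewrite out//; near: y.
  exists (`|x| - `|M|) => /=; first by rewrite subr_gt0.
  by move=> y /= xy; have := ler_normD (x - y) y; rewrite subrK; move: xy; lra.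
- by apply: out; rewrite (ger0_norm M1) ltrDl.
- by apply: out; rewrite normrN (ger0_norm M1) ltrDl.
Unshelve. all: by end_near.
Qed.

Lemma L1M_test f phi M : (forall a b, L1 `[a, b] f) -> continuous phi ->
  (forall x, ~ `[- M, M]%classic x -> phi x = 0) -> L1 setT (fun x => f x * phi x).
Proof.
move=> If cphi phi0; apply: (@L1_support (- M) M).
  by move=> x /phi0 ->; rewrite mulr0.
have cw : {within `[- M, M], continuous phi} by exact: continuous_subspaceT.
have cimg := continuous_compact cw (@segment_compact R (- M) M).
have [B [_ HB]] := compact_bounded cimg.
apply: (@L1M_bounded _ _ f phi (B + 1)) => //.
- exact: continuous_mfun.
- by move=> x xM; apply: (HB (B + 1)); [rewrite ltrDl|exists x].
Qed.

Lemma AC_weak_derivative f g : AC f g -> measurable_fun [set: R] g ->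
  is_weak_derivative f g.
Proof.
move=> acf mg; have cf := AC_continuous acf.
have If a b : L1 `[a, b] f.
  apply: continuous_compact_integrable; first exact: segment_compact.
  exact: continuous_subspaceT.
have Ig := acf.1.
split.
- by apply: L1_locally_integrable => //; exact: continuous_mfun.
- exact: L1_locally_integrable.
move=> phi /test_function_C1[acp cp cp' [M [M0 p0 p'0 pM pNM]]].
have I1 := L1M_test If cp' p'0; have I2 := L1M_test Ig cp p0.
apply/eqP; rewrite -addr_eq0 -RintegralD//; apply/eqP.
have /= [_ h] := ACM acf acp.
have NM : - M <= M by lra.
rewrite (@Int_support (- M) M).
  have := h (- M) M NM; rewrite pM pNM !mulr0 subrr => hh; rewrite [RHS]hh.
  by apply: eq_Rintegral => x _; rewrite addrC.
by move=> x xM; rewrite p0// p'0// !mulr0 addr0.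
Qed.

Lemma continuous_mollifier : continuous (@mollifier R).
Proof.
move=> x; apply: differentiable_continuous; apply/derivable1_diffP.
by have [+ _] := @Cn_mollifier R 1; exact.
Qed.

(** The primitive starts at -1, left of the support of the mollifier, so that 0 is an interior point
    for the fundamental theorem of calculus. *)
Definition step x : R := \int[mu]_(t in `[-1, x]) @mollifier R t.

Lemma mollifier_itv a b : L1 `[a, b] (@mollifier R).
Proof.
apply: continuous_compact_integrable; first exact: segment_compact.
by apply: continuous_subspaceT; exact: continuous_mollifier.
Qed.

Lemma step_left x : x <= 0 -> step x = 0.
Proof.
move=> x0; rewrite /step; under eq_Rintegral => t.
  rewrite inE/= in_itv/= => /andP[_ tx]; rewrite mollifier_out; last by left; exact: le_trans tx x0.
  over.
by rewrite Rintegral_cst// mul0r.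
Qed.

Lemma step_right x : 1 <= x -> step x = step 1.
Proof.
move=> x1; rewrite /step (@Int_itv_split _ (-1) x 1)//; last exact: mollifier_itv.
under [X in _ + X]eq_Rintegral => t.
  rewrite inE/= in_itv/= => /andP[tx _]; rewrite mollifier_out; last by right.
  over.
by rewrite Rintegral_cst// mul0r addr0.
Qed.

Lemma step_derive x : is_derive x 1 step (mollifier x).
Proof.
have [x0|x0] := ltP x 0.
  rewrite mollifier_out; last by left; exact: ltW.
  apply: (near_eq_is_derive (f := cst 0)).
  near=> y; rewrite step_left//; near: y; exact: lt_le_nbhsl.
have xx : x < x + 1 by rewrite ltrDl.
have x1 : -1 < x by apply: lt_le_trans x0; rewrite ltrN10.
have [d e] := continuous_FTC1_closed xx (mollifier_itv (-1) (x + 1)) x1 (@continuous_mollifier x).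
by split; [exact: d|move: e; rewrite derive1E].
Unshelve. all: by end_near.
Qed.

Lemma step_ge0 x : 0 <= step x.
Proof. by apply: Rintegral_ge0 => t _; exact: mollifier_ge0. Qed.

Lemma step_le x : step x <= step 1.
Proof.
have [x0|x0] := leP x 0; first by rewrite step_left// step_ge0.
have [x1|x1] := leP 1 x; first by rewrite (step_right x1).
rewrite /step (@Int_itv_split _ (-1) 1 x) ?lerDl ?Rintegral_ge0//.
- by move=> t _; exact: mollifier_ge0.
- by rewrite (le_trans _ (ltW x0))// lerN10.
- exact: ltW.
- exact: mollifier_itv.
Qed.

(** If the mass vanished, [step] would be constant, and its derivative [mollifier] would vanish at
    1/2. *)
Lemma step1_gt0 : 0 < step 1.
Proof.
rewrite lt_neqAle step_ge0 andbT; apply/eqP => s0.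
have step0 x : step x = 0.
  by apply/eqP; rewrite eq_le step_ge0 andbT s0 step_le.
have := step_derive (1 / 2); have -> : step = cst 0 by apply/funext => x; rewrite step0.
move=> [_]; rewrite derive_cst => /esym/eqP; apply/negP; rewrite gt_eqF//.
by apply: mollifier_gt0; apply/andP; split; lra.
Qed.

Lemma Cn_step n : Cn n step.
Proof.
by apply: CnS; apply: (@Cn_is_derive _ _ _ (@mollifier R)); [exact: step_derive|exact: Cn_mollifier].
Qed.

(** A transition from 0 to [step 1] over [a, a + e], written with an affine argument to match
    [Cn_affine] and [is_derive_affine]. *)
Definition step_at a e x := step (e^-1 * x + - (a / e)).

Lemma step_at_arg a e x : 0 < e -> e^-1 * x + - (a / e) = (x - a) / e.
Proof. by move=> e0; field; rewrite gt_eqF. Qed.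

Lemma step_at_left a e x : 0 < e -> x <= a -> step_at a e x = 0.
Proof.
move=> e0 xa; rewrite /step_at step_at_arg// step_left//.
by rewrite pmulr_lle0 ?invr_gt0// subr_le0.
Qed.

Lemma step_at_right a e x : 0 < e -> a + e <= x -> step_at a e x = step 1.
Proof.
move=> e0 ax; rewrite /step_at step_at_arg// step_right//.
by rewrite ler_pdivlMr// mul1r lerBrDl.
Qed.

Definition bump_at a e x : R := e^-1 * @mollifier R (e^-1 * x + - (a / e)).

Lemma step_at_derive a e x : is_derive x 1 (step_at a e) (bump_at a e x).
Proof.
have d : derivable step (e^-1 * x + - (a / e)) 1 by case: (step_derive (e^-1 * x + - (a / e))).
apply: (is_derive_eq (is_derive_affine d)).
by rewrite /bump_at derive1E; case: (step_derive (e^-1 * x + - (a / e))) => _ ->.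
Qed.

Lemma continuous_bump_at a e : continuous (bump_at a e).
Proof.
move=> x; apply: differentiable_continuous; apply/derivable1_diffP.
have [+ _] := CnM (Cn_cst 1 e^-1) (@Cn_affine R 1 (@mollifier R) e^-1 (- (a / e)) (Cn_mollifier 1)).
exact.
Qed.

Lemma bump_at_out a e x : 0 < e -> ~ `[a, a + e]%classic x -> bump_at a e x = 0.
Proof.
move=> e0; rewrite /= in_itv/= => /negP; rewrite negb_and -!ltNge => h.
rewrite /bump_at step_at_arg// mollifier_out ?mulr0//; case/orP: h => h.
  by left; rewrite pmulr_lle0 ?invr_gt0// subr_le0 ltW.
by right; rewrite ler_pdivlMr// mul1r lerBrDl ltW.
Qed.

Lemma bump_at_le a e x : 0 < e -> `|bump_at a e x| <= e^-1.
Proof.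
move=> e0; have b0 : 0 <= bump_at a e x by rewrite mulr_ge0 ?invr_ge0 ?mollifier_ge0 ?ltW.
rewrite (ger0_norm b0) /bump_at.
by rewrite ler_piMr ?mollifier_le1 ?invr_ge0 ?(ltW e0).
Qed.

Lemma Int_bump_at a e : 0 < e -> \int[mu]_x bump_at a e x = step 1.
Proof.
move=> e0; rewrite (@Int_support a (a + e)); last by move=> x; exact: bump_at_out.
have [_ <-] := AC_C1 (fun x => step_at_derive a e x) (@continuous_bump_at a e).
  by rewrite step_at_right// step_at_left// subr0.
by rewrite lerDl ltW.
Qed.

Lemma L1M_bump_at f a e : (forall a b, L1 `[a, b] f) -> 0 < e ->
  L1 setT (fun x => f x * bump_at a e x).
Proof.
move=> If e0; apply: (@L1M_test f _ (`|a| + e) If (@continuous_bump_at a e)).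
move=> x xa; apply: bump_at_out => // xa'; apply: xa; move: xa'.
rewrite /= !in_itv/= => /andP[h1 h2]; have := ler_norm a; have := ler_norm (- a).
by rewrite normrN => h3 h4; apply/andP; split; lra.
Qed.

Lemma lebesgue_pt_bump f a : (forall a b, L1 `[a, b] f) -> lebesgue_pt f a ->
  forall d : R, 0 < d -> exists2 e0 : R, 0 < e0 & forall e, 0 < e -> e < e0 ->
  `|\int[mu]_x (f x * bump_at a e x) - f a * step 1| <= d.
Proof.
move=> If; rewrite /lebesgue_pt => H d d0.
have d4 : 0 < d / 4 by lra.
have /= := H [set z | (z < (d / 4)%:E)%E].
case.
  by apply: open_nbhs_nbhs; split; [exact: open_ereal_lt_ereal|rewrite /= lte_fin].
move=> r /= r0 Hr.
exists (r / 2); first lra.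
move=> e e0 er.
(* The bump lives on [a, a + e], inside the ball of radius 2 e, and has height at most 1/e, four
   times the inverse of the measure 4 e of that ball: this is the origin of d / 4. *)
have := Hr (2 * e); rewrite /= sub0r normrN ger0_norm; last by lra.
have er2 : 2 * e < r by lra.
have e2 : 0 < 2 * e by lra.
move=> /(_ er2 e2); rewrite /davg /iavg (lebesgue_measure_ball _ (ltW e2)).
have Ifa : forall p q, L1 `[p, q] (fun x => f x - f a).
  move=> p q; apply: L1B => //; apply: continuous_compact_integrable.
    exact: segment_compact.
  by apply: continuous_subspaceT => x; exact: cst_continuous.
have Iba : L1 (ball a (2 * e)) (fun x => `|f x - f a|).
  apply: L1_norm; first exact: measurable_ball.
  apply: L1S (Ifa (a - 2 * e) (a + 2 * e)) => //; first exact: measurable_ball.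
  by rewrite ball_itv; exact: subset_itv_oo_cc.
have -> : (\int[mu]_(y in ball a (2 * e)) `|((center (f a) \o f) y)%:E|)%E =
   (\int[mu]_(y in ball a (2 * e)) `|f y - f a|)%:E.
  rewrite /Rintegral fineK; first exact: eq_integral.
  by apply: integrable_fin_num => //; exact: measurable_ball.
have -> : ((2 * e) *+ 2)%:E^-1%E = ((4 * e)^-1)%:E :> \bar R.
  rewrite inver gt_eqF; last by rewrite mulrn_wgt0.
  by rewrite -mulr_natr; congr (_^-1)%:E; ring.
rewrite -EFinM lte_fin => main.
have Ib := L1M_bump_at a Ifa e0.
have I1 := L1M_bump_at a If e0.
have I2 : L1 setT (fun x => f a * bump_at a e x).
  apply: (@L1M_bump_at (fun=> f a)) => // p q; apply: continuous_compact_integrable.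
    exact: segment_compact.
  by apply: continuous_subspaceT => x; exact: cst_continuous.
have Ibb : L1 setT (bump_at a e).
  have Iu (p q : R) : L1 `[p, q] (fun=> 1).
    apply: continuous_compact_integrable; first exact: segment_compact.
    by apply: continuous_subspaceT => x; exact: cst_continuous.
  by have := L1M_bump_at a Iu e0; under [X in L1 _ X -> _]eq_fun do rewrite mul1r.
have -> : \int[mu]_x (f x * bump_at a e x) - f a * step 1 =
   \int[mu]_x ((f x - f a) * bump_at a e x).
  rewrite -(@Int_bump_at a e)// -RintegralZl// -RintegralB//.
  by apply: eq_Rintegral => x _; ring.
rewrite (@Int_support a (a + e)); last by move=> x xa; rewrite bump_at_out ?mulr0.
have sub : `[a, a + e]%classic `<=` ball a (2 * e).
  move=> x; rewrite ball_itv /= !in_itv/= => /andP[h1 h2]; apply/andP; split; lra.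
apply: (le_trans (le_normr_Rintegral _ _)) => //; first exact: L1S Ib.
apply: (@le_trans _ _ (e^-1 * \int[mu]_(x in `[a, a + e]) `|f x - f a|)).
  rewrite -RintegralZl//; last by apply: L1S Iba => //; exact: measurable_ball.
  apply: le_Rintegral => //.
  - by apply: L1_norm => //; apply: L1S Ib.
  - by apply: L1Z => //; apply: L1S Iba => //; exact: measurable_ball.
  - by move=> x _; rewrite normrM mulrC ler_wpM2r// bump_at_le.
have le2 : \int[mu]_(x in `[a, a + e]) `|f x - f a| <= \int[mu]_(y in ball a (2 * e)) `|f y - f a|.
  rewrite /Rintegral fine_le//.
  - by apply: integrable_fin_num => //; apply: L1S Iba => //; exact: measurable_ball.
  - by apply: integrable_fin_num => //; exact: measurable_ball.
  - apply: ge0_subset_integral => //; [exact: measurable_ball|].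
    by apply/measurable_EFinP; exact: L1_measurable Iba.
have ei : 0 <= e^-1 by rewrite invr_ge0 ltW.
have := ler_wpM2l ei le2.
have : e^-1 * \int[mu]_(y in ball a (2 * e)) `|f y - f a| = 4 *
  ((4 * e)^-1 * \int[mu]_(y in ball a (2 * e)) `|f y - f a|) by field; rewrite gt_eqF.
move=> -> h; apply: (le_trans h).
by move/ltW: main; rewrite ler_pdivlMr// mulrC.
Qed.

End Weak_derivatives.

(** * Weak derivatives and absolutely continuous representatives *)

Section Weak_derivative_representative.
Context {R : realType}.
Implicit Types (f g h k phi : R -> R) (a b x y c e : R).

Local Notation mu := (@lebesgue_measure R).

Definition cutoff a b e x : R := step_at a e x - step_at b e x.

Lemma test_cutoff a b e : a <= b -> 0 < e -> test_function (cutoff a b e).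
Proof.
move=> ab e0; split.
  apply: Cn_derivable => n; rewrite /cutoff.
  have h p : Cn n (step_at p e) by apply: Cn_affine; exact: Cn_step.
  have := CnD (h a) (CnM (Cn_cst n (-1)) (h b)).
  by under [X in Cn _ X -> _]eq_fun do rewrite mulN1r.
exists (`|a| + `|b| + e) => x xM.
have [xa|ax] := leP x a.
  by rewrite /cutoff !step_at_left ?subrr// (le_trans xa).
have bx : b + e <= x.
  move: xM; have [x0|x0] := leP 0 x.
    by rewrite (ger0_norm x0); have := ler_norm b; have := normr_ge0 a; lra.
  rewrite (ltr0_norm x0); have := ler_norm (- a); rewrite normrN.
  by have := normr_ge0 b; lra.
by rewrite /cutoff !step_at_right ?subrr// (le_trans _ bx)// lerD2r.
Qed.

Lemma derive1_cutoff a b e x : derive1 (cutoff a b e) x = bump_at a e x - bump_at b e x.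
Proof.
rewrite derive1E.
have := is_deriveB (step_at_derive a e x) (step_at_derive b e x).
by case.
Qed.

(* The cutoffs tend to the indicator of ]a, b], and their derivatives are the
   difference of two bumps concentrating at a and b. *)
Lemma weak_derivative_lebesgue_pt f g a b : is_weak_derivative f g ->
  a < b -> lebesgue_pt f a -> lebesgue_pt f b ->
  f b - f a = \int[mu]_(x in `[a, b]) g x.
Proof.
move=> [lf lg wfg] ab La Lb.
have If p q : L1 `[p, q] f by exact: locally_integrable_L1.
have Ig p q : L1 `[p, q] g by exact: locally_integrable_L1.
have mg : measurable_fun [set: R] g by case: lg.
pose K : R := step 1.
have K0 : 0 < K := @step1_gt0 R.
pose e_ (n : nat) : R := n.+1%:R^-1.
have e_gt0 n : 0 < e_ n by rewrite invr_gt0 ltr0n.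
have e_lim d : 0 < d -> exists N : nat, forall n, (N <= n)%N -> e_ n < d.
  move=> d0; exists (Num.bound (d^-1)) => n Nn.
  rewrite -[ltRHS]invrK ltf_pV2 ?posrE ?invr_gt0 ?ltr0n//.
  have := archi_boundP (ltW (_ : 0 < d^-1)); rewrite invr_gt0 => /(_ d0).
  by move=> /lt_le_trans; apply; rewrite ler_nat (leq_trans Nn).
pose F n x := (g x * cutoff a b (e_ n) x)%:E.
pose G x := (K * (g x * \1_(`]a, b]) x))%:E.
have cc n : continuous (cutoff a b (e_ n)).
  by have [_ ? _ _] := test_function_C1 (test_cutoff (ltW ab) (e_gt0 n)).
have mF n : measurable_fun [set: R] (F n).
  apply/measurable_EFinP; apply: measurable_funM => //.
  by apply: continuous_mfun => //.
have mG : measurable_fun [set: R] G.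
  apply/measurable_EFinP; apply: measurable_funM => //; apply: measurable_funM => //.
(* Since [e_ n] is at most 1, all cutoffs vanish outside [a, b + 1], and they stay between -K and
   K. *)
have ID : L1 setT (fun x => K * (`|g x| * \1_(`[a, b + 1]) x)).
  apply: L1Z => //; apply: (@L1_support _ a (b + 1)).
    by move=> x xab; rewrite indicE memNset ?mulr0.
  apply: (@L1_le _ _ _ (fun x => `|g x|)) => //.
  - by apply: measurable_funTS; apply: measurable_funM => //; apply: measurableT_comp.
  - exact: L1_norm.
  - move=> x _; rewrite normrM normr_id ler_piMr// indicE.
    by case: (_ \in _); rewrite ?normr1 ?normr0.
have hlim : {ae mu, forall x, [set: R] x -> F n x @[n --> \oo] --> G x}.
  apply: ae_all => x _.
  have [xa|ax] := leP x a.
    apply: cvg_near_cst; near=> n.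
    rewrite /F /G /cutoff !step_at_left// ?(le_trans xa)// ?(ltW ab)// subrr mulr0.
    rewrite indicE memNset ?mulr0//= in_itv/= => /andP[ax _].
    by have := lt_le_trans ax xa; rewrite ltxx.
  have [xb|bx] := leP x b.
    have xa0 : 0 < x - a by lra.
    have [N HN] := e_lim _ xa0.
    apply: cvg_near_cst; exists N => // n /= Nn; have := HN n Nn => h.
    rewrite /F /G /cutoff step_at_right//; last lra.
    rewrite step_at_left// subr0 indicE mem_set; last by rewrite /= in_itv/= ax xb.
    by rewrite mulr1 mulrC.
  have xb0 : 0 < x - b by lra.
  have [N HN] := e_lim _ xb0.
  apply: cvg_near_cst; exists N => // n /= Nn; have := HN n Nn => h.
  rewrite /F /G /cutoff !step_at_right//; [|lra|lra].
  rewrite subrr mulr0 indicE memNset ?mulr0//= in_itv/= => /andP[_ xb].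
  by have := lt_le_trans bx xb; rewrite ltxx.
have hdom : {ae mu, forall x, forall n, [set: R] x ->
    (`|F n x| <= (K * (`|g x| * \1_(`[a, b + 1]) x))%:E)%E}.
  apply: ae_all => x n _.
  rewrite /F lee_fin normrM mulrCA ler_wpM2l//.
  have e1 : e_ n <= 1 by rewrite invf_le1 ?ltr0n// ler1n.
  rewrite indicE; case: (boolP (x \in `[a, b + 1]%classic)) => xab.
    rewrite mulr1 ler_norml; have h p := @step_le R (((e_ n)^-1 * x + - (p / e_ n))).
    have h' p := @step_ge0 R (((e_ n)^-1 * x + - (p / e_ n))).
    rewrite /cutoff /step_at; have := h a; have := h b; have := h' a; have := h' b.
    by rewrite -/K => ? ? ? ?; apply/andP; split; lra.
  rewrite mulr0 normr_le0; apply/eqP; move: xab; rewrite notin_setE /= in_itv/=.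
  move/negP; rewrite negb_and -!ltNge => /orP[xa|bx].
    by rewrite /cutoff !step_at_left ?subrr// ltW// (lt_trans xa).
  by rewrite /cutoff !step_at_right ?subrr//; lra.
have [_ _ lim1] := @dominated_convergence _ _ R mu setT measurableT F G
  (fun x => (K * (`|g x| * \1_(`[a, b + 1]) x))%:E) mF mG hlim ID hdom.
(* The two sides of the weak formula are computed in the limit: [lim2] by dominated convergence,
   [lim3] by the Lebesgue points. *)
have key : - (K * \int[mu]_(x in `[a, b]) g x) = K * (f a - f b).
  have lim2 : (\int[mu]_x (g x * cutoff a b (e_ n) x))%R @[n --> \oo] -->
      K * \int[mu]_(x in `[a, b]) g x.
    have -> : K * \int[mu]_(x in `[a, b]) g x = fine (\int[mu]_x G x)%E.
      rewrite -[RHS]/(Rintegral mu setT (fun x => K * (g x * \1_(`]a, b]) x))).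
      have Iab : L1 setT (fun x => g x * \1_(`]a, b]) x).
        apply: (@L1_support _ a b).
          move=> x xab; rewrite indicE memNset ?mulr0// => xab'; apply: xab.
          exact: subset_itv_oc_cc.
        apply: (@L1_le _ _ _ (fun x => `|g x|)) => //.
        - by apply: measurable_funTS; apply: measurable_funM.
        - exact: L1_norm.
        - move=> x _; rewrite normrM ler_piMr// indicE.
          by case: (_ \in _); rewrite ?normr1 ?normr0.
      rewrite RintegralZl//; congr (_ * _).
      rewrite -Rintegral_itv_obnd_cbnd//; last first.
        by apply: L1S (Ig a b) => //; exact: subset_itv_oc_cc.
      rewrite Rintegral_mkcond; apply: eq_Rintegral => x _.
      by rewrite patchE indicE; case: (_ \in _); rewrite ?mulr1 ?mulr0.
    apply: fine_cvg; rewrite fineK//.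
    apply: integrable_fin_num => //.
    apply: le_integrable ID => // x _ /=.
    rewrite lee_fin !normrM (ger0_norm (ltW K0)) normr_id !ler_wpM2l ?(ltW K0)//.
    rewrite !indicE; case: (boolP (x \in `]a, b]%classic)) => [|_]; rewrite ?normr0 ?normr_ge0//.
    rewrite inE /= in_itv/= => /andP[ax xb]; rewrite mem_set// /= in_itv/= (ltW ax)/=.
    by rewrite (le_trans xb)// lerDl.
  have lim3 : (\int[mu]_x (f x * derive1 (cutoff a b (e_ n)) x))%R @[n --> \oo] -->
      K * (f a - f b).
    apply/cvgrPdist_le => d d0.
    have d2 : 0 < d / 2 by lra.
    have [ea ea0 Ha] := lebesgue_pt_bump If La d2.
    have [eb eb0 Hb] := lebesgue_pt_bump If Lb d2.
    have [N1 HN1] := e_lim ea ea0; have [N2 HN2] := e_lim eb eb0.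
    exists (maxn N1 N2) => // n /=; rewrite geq_max => /andP[n1 n2].
    have := Ha _ (e_gt0 n) (HN1 n n1); have := Hb _ (e_gt0 n) (HN2 n n2).
    have Ia := L1M_bump_at a If (e_gt0 n); have Ib := L1M_bump_at b If (e_gt0 n).
    have -> : \int[mu]_x (f x * derive1 (cutoff a b (e_ n)) x) =
       \int[mu]_x (f x * bump_at a (e_ n) x) - \int[mu]_x (f x * bump_at b (e_ n) x).
      rewrite -RintegralB//; apply: eq_Rintegral => x _.
      by rewrite derive1_cutoff mulrBr.
    rewrite -/K; set p := \int[mu]_x (f x * bump_at a (e_ n) x).
    set q := \int[mu]_x (f x * bump_at b (e_ n) x) => h1 h2.
    have regroup (k x y r w : R) : k * (x - y) - (r - w) = (w - y * k) - (r - x * k).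
      by ring.
    rewrite regroup.
    by apply: (le_trans (ler_normB _ _)); lra.
  have E : (fun n => \int[mu]_x (f x * derive1 (cutoff a b (e_ n)) x)) =
      (fun n => - \int[mu]_x (g x * cutoff a b (e_ n) x)).
    by apply/funext => n; rewrite (wfg _ (test_cutoff (ltW ab) (e_gt0 n))).
  rewrite E in lim3.
  have lim4 : (- \int[mu]_x (g x * cutoff a b (e_ n) x)) @[n --> \oo] -->
      - (K * \int[mu]_(x in `[a, b]) g x) by exact: cvgN.
  by rewrite -(cvg_lim _ lim3)// -(cvg_lim _ lim4).
have : K * (f b - f a) = K * \int[mu]_(x in `[a, b]) g x by lra.
by move/mulfI; apply; rewrite gt_eqF.
Unshelve. all: by end_near.
Qed.

Lemma ae_exists (P : R -> Prop) : {ae mu, forall x, P x} -> exists x, P x.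
Proof.
move=> h; apply: contrapT => nP; have : (mu `[0%R, 1%R] = 0)%E.
  case: h => A [mA A0 PA]; apply/eqP; rewrite eq_le measure_ge0 andbT -A0.
  apply: le_measure; rewrite ?inE//= => x _; apply: PA => /= Px; apply: nP.
  by exists x.
have := lebesgue_measure_itv `[0%R : R, 1%R] => /= ->.
by rewrite lte_fin ltr01 -EFinB => -[] /eqP; rewrite subr0 oner_eq0.
Qed.

Lemma AC_primitive g : (forall a b, L1 `[a, b] g) -> exists F, AC F g.
Proof.
move=> Ig; exists (fun x => if 0 <= x then \int[mu]_(t in `[0, x]) g t
   else - \int[mu]_(t in `[x, 0]) g t); split => // a b ab.
have [a0|a0] := leP 0 a.
  by rewrite (le_trans a0 ab) (@Int_itv_split _ 0 b a)// addrAC subrr add0r.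
have [b0|b0] := leP 0 b.
  by rewrite (@Int_itv_split _ a b 0)// ?ltW// opprK addrC.
rewrite (@Int_itv_split _ a 0 b)// ?ltW//; ring.
Qed.

(** At Lebesgue points [f] obeys the fundamental theorem of calculus, so it differs there from a
    primitive of [g] by a constant, which is read off at one of them. *)
Lemma weak_derivative_AC f g : is_weak_derivative f g ->
  exists2 F, AC F g & {ae mu, forall x, f x = F x}.
Proof.
move=> wfg; have [lf lg _] := wfg.
have Ig p q : L1 `[p, q] g by exact: locally_integrable_L1.
have [F acF] := AC_primitive Ig.
have Leb := lebesgue_differentiation lf.
have [p Lp] := ae_exists Leb.
exists (fun x => F x + (f p - F p)).
  by have := ACD acF (AC_cst (f p - F p)); under [X in AC _ X -> _]eq_fun do rewrite addr0.
apply: (ae_imp Leb) => x Lx.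
have [xp|px|->] := ltgtP x p; last by rewrite addrC subrK.
  by have := weak_derivative_lebesgue_pt wfg xp Lx Lp; rewrite -(acF.2 _ _ (ltW xp)); lra.
by have := weak_derivative_lebesgue_pt wfg px Lp Lx; rewrite -(acF.2 _ _ (ltW px)); lra.
Qed.

Lemma continuous_ae_eq f g : continuous f -> continuous g ->
  {ae mu, forall x, f x = g x} -> forall x, f x = g x.
Proof.
move=> cf cg fg x; apply/eqP; rewrite -subr_eq0; apply/negPn/negP => d0.
have cd : continuous (fun x => f x - g x).
  by move=> y; apply: cvgB; [exact: cf|exact: cg].
have d1 : 0 < `|f x - g x| by rewrite normr_gt0.
have /cvgrPdist_lt/(_ _ d1) [e /= e0 He] := cd x.
have : (mu (ball x e) = 0)%E.
  case: fg => A [mA A0 PA]; apply/eqP; rewrite eq_le measure_ge0 andbT -A0.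
  apply: le_measure; rewrite ?inE//=; first exact: measurable_ball.
  move=> y xy; apply: PA => /= fgy; have := He y xy.
  by rewrite fgy subrr subr0 ltxx.
rewrite (lebesgue_measure_ball _ (ltW e0)) => -[] /eqP; rewrite mulrn_eq0/=.
by rewrite gt_eqF.
Qed.

Lemma test_bump_at a e : 0 < e -> test_function (bump_at a e).
Proof.
move=> e0; split.
  by apply: Cn_derivable => n; apply: CnM; [exact: Cn_cst|apply: Cn_affine; exact: Cn_mollifier].
exists (`|a| + e) => x xM; apply: bump_at_out => //= xa; move: xa xM.
rewrite in_itv/= => /andP[h1 h2]; apply/negP; rewrite -leNgt.
have := ler_norm a; have := ler_norm (- a); rewrite normrN => h3 h4.
by rewrite ler_norml; apply/andP; split; lra.
Qed.

(** Tested against a narrow bump at a Lebesgue point, g1 - g2 gives 0, yet also nearly [step 1]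
    times its value there. *)
Lemma weak_derivative_unique f g1 g2 : is_weak_derivative f g1 ->
  is_weak_derivative f g2 -> {ae mu, forall x, g1 x = g2 x}.
Proof.
move=> [_ l1 w1] [_ l2 w2].
have lk := locally_integrableB l1 l2.
apply: (ae_imp (lebesgue_differentiation lk)) => x Lx.
have I1 p q : L1 `[p, q] g1 by exact: locally_integrable_L1.
have I2 p q : L1 `[p, q] g2 by exact: locally_integrable_L1.
have Ik p q : L1 `[p, q] (g1 \- g2)%R by exact: locally_integrable_L1.
apply/eqP; rewrite -subr_eq0; apply/negPn/negP => k0.
have K0 := @step1_gt0 R.
have d0 : 0 < `|g1 x - g2 x| * step 1 / 2 by rewrite !mulr_gt0 ?normr_gt0.
have [e0 e00 He] := lebesgue_pt_bump Ik Lx d0.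
have e20 : 0 < e0 / 2 by lra.
have e2 : e0 / 2 < e0 by lra.
have := He _ e20 e2.
have -> : \int[mu]_t ((g1 \- g2)%R t * bump_at x (e0 / 2) t) = 0.
  have := w2 _ (test_bump_at x e20); rewrite (w1 _ (test_bump_at x e20)).
  have J1 := L1M_bump_at x I1 e20; have J2 := L1M_bump_at x I2 e20.
  move/oppr_inj => E; transitivity (\int[mu]_t (g1 t * bump_at x (e0 / 2) t -
    g2 t * bump_at x (e0 / 2) t)).
    by apply: eq_Rintegral => t _; rewrite mulrBl.
  by rewrite RintegralB// E subrr.
rewrite sub0r normrN normrM (gtr0_norm K0) /=.
have : 0 < `|g1 x - g2 x| * step 1 by rewrite mulr_gt0 ?normr_gt0.
lra.
Qed.

Lemma H1_weak_derivative f g : H1 f g -> is_weak_derivative f g.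
Proof. by move=> [ac _ lg]; apply: AC_weak_derivative => //; exact: L2_measurable. Qed.

Lemma weak_derivative_ae f f' g g' : is_weak_derivative f g ->
  measurable_fun [set: R] f' -> measurable_fun [set: R] g' ->
  {ae mu, forall x, f x = f' x} -> {ae mu, forall x, g x = g' x} ->
  is_weak_derivative f' g'.
Proof.
move=> [lf lg w] mf' mg' ff' gg'.
have loc (u u' : R -> R) : measurable_fun [set: R] u' -> {ae mu, forall x, u x = u' x} ->
    locally_integrable [set: R] u -> locally_integrable [set: R] u'.
  move=> mu' uu' lu; apply: L1_locally_integrable => // a b.
  apply: (@L1_ae _ _ _ u) => //; first exact: measurable_funTS.
    exact: locally_integrable_L1.
  by apply: (ae_imp uu') => x ->.
have lf' := loc _ _ mf' ff' lf; have lg' := loc _ _ mg' gg' lg.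
have mf : measurable_fun [set: R] f by case: lf.
have mg : measurable_fun [set: R] g by case: lg.
split => // phi tphi; have [_ c c' _] := test_function_C1 tphi.
transitivity (\int[mu]_x (f x * derive1 phi x)).
  apply: Int_ae => //.
  - by apply: measurable_funM => //; exact: continuous_mfun.
  - by apply: measurable_funM => //; exact: continuous_mfun.
  - by apply: (ae_imp ff') => x ->.
rewrite w//; congr (- _); apply: Int_ae => //.
- by apply: measurable_funM => //; exact: continuous_mfun.
- by apply: measurable_funM => //; exact: continuous_mfun.
- by apply: (ae_imp gg') => x ->.
Qed.

Lemma wderivP f g : is_weak_derivative f g -> is_weak_derivative f (wderiv f).
Proof. by move=> h; rewrite /wderiv; exact: (xgetPex (fun=> 0) (ex_intro _ g h)). Qed.

Lemma wderiv_ae f g : is_weak_derivative f g -> {ae mu, forall x, wderiv f x = g x}.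
Proof. by move=> h; apply: weak_derivative_unique (wderivP h) h. Qed.

Lemma weak_measurable f g : is_weak_derivative f g ->
  measurable_fun [set: R] f /\ measurable_fun [set: R] g.
Proof. by move=> [[? _ _] [? _ _] _]. Qed.

Lemma wderiv_eq_ae f f' g : is_weak_derivative f g -> measurable_fun [set: R] f' ->
  {ae mu, forall x, f x = f' x} -> {ae mu, forall x, wderiv f' x = g x}.
Proof.
move=> w mf' ff'; apply: wderiv_ae; apply: (weak_derivative_ae w) => //.
- by have [] := weak_measurable w.
- exact: ae_all.
Qed.

Lemma weak_derivative_H1 f g : is_weak_derivative f g -> L2 f -> L2 g ->
  exists2 F, H1 F g & {ae mu, forall x, f x = F x}.
Proof.
move=> w lf lg; have [F acF fF] := weak_derivative_AC w.
exists F => //; split => //; apply: (L2_ae _ lf).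
  by apply: continuous_mfun => //; exact: AC_continuous acF.
by apply: (ae_imp fF).
Qed.

End Weak_derivative_representative.

(** * Sobolev spaces *)

Section Sobolev_spaces.
Context {R : realType}.
Implicit Types (f g h : R -> R) (a b c s sigma : R).

Local Notation mu := (@lebesgue_measure R).

Lemma weak_derivative_lin f f' g g' a c : is_weak_derivative f f' ->
  is_weak_derivative g g' ->
  is_weak_derivative (fun x => a * f x + c * g x) (fun x => a * f' x + c * g' x).
Proof.
move=> [lf lf' wf] [lg lg' wg].
have lin (u v : R -> R) : locally_integrable [set: R] u -> locally_integrable [set: R] v ->
    locally_integrable [set: R] (fun x => a * u x + c * v x).
  move=> lu lv; apply: L1_locally_integrable.
    by apply: measurable_funD; apply: measurable_funM => //; [case: lu|case: lv].
  by move=> p q; apply: L1D => //; apply: L1Z => //; exact: locally_integrable_L1.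
split; [exact: lin|exact: lin|].
move=> phi tphi; have [_ cp cp' [M [M0 p0 p'0 _ _]]] := test_function_C1 tphi.
have I (u : R -> R) : locally_integrable [set: R] u -> forall p q, L1 `[p, q] u.
  by move=> lu p q; exact: locally_integrable_L1.
have If := L1M_test (I _ lf) cp' p'0; have Ig := L1M_test (I _ lg) cp' p'0.
have If' := L1M_test (I _ lf') cp p0; have Ig' := L1M_test (I _ lg') cp p0.
transitivity (\int[mu]_x (a * (f x * derive1 phi x) + c * (g x * derive1 phi x))).
  by apply: eq_Rintegral => x _; ring.
rewrite RintegralD//; [|exact: L1Z|exact: L1Z].
rewrite !RintegralZl// wf// wg//.
transitivity (- \int[mu]_x (a * (f' x * phi x) + c * (g' x * phi x))); last first.
  by congr (- _); apply: eq_Rintegral => x _; ring.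
rewrite RintegralD//; [|exact: L1Z|exact: L1Z].
rewrite !RintegralZl//; ring.
Qed.

Lemma L2_sqnorm_lty f : measurable_fun [set: R] f -> (L2_sqnorm f < +oo)%E -> L2 f.
Proof.
move=> mf foo; split => //; apply/integrableP; split.
  by apply/measurable_EFinP; exact: measurable_funX.
apply: le_lt_trans foo; rewrite /L2_sqnorm le_eqVlt; apply/orP; left; apply/eqP.
by apply: eq_integral => x _ /=; rewrite ger0_norm// sqr_ge0.
Qed.

Lemma L2_sqnormE f : L2 f -> L2_sqnorm f = (ip f f)%:E.
Proof.
move=> lf; rewrite /ip /Rintegral fineK.
  by apply: eq_integral => x _; rewrite expr2.
by apply: integrable_fin_num => //; exact: L2_L1M.
Qed.

Lemma L2_sqnorm_ge0 f : (0 <= L2_sqnorm f)%E.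
Proof. by apply: integral_ge0 => x _; rewrite lee_fin sqr_ge0. Qed.

(** Uncurried, so that the measurability of the inner integral follows from Tonelli's theorem. *)
Definition gagliardo_kernel sigma f (z : R * R) : \bar R :=
  ((f z.1 - f z.2) ^+ 2 / `|z.1 - z.2| `^ (1 + 2 * sigma))%:E.

Lemma gagliardo_kernel_ge0 sigma f z : (0 <= gagliardo_kernel sigma f z)%E.
Proof. by rewrite lee_fin divr_ge0 ?sqr_ge0 ?powR_ge0. Qed.

Lemma measurable_gagliardo_kernel sigma f : measurable_fun [set: R] f ->
  measurable_fun [set: R * R] (gagliardo_kernel sigma f).
Proof.
move=> mf; apply/measurable_EFinP; apply: measurable_funM.
  apply: measurable_funX; apply: measurable_funB.
    exact: (measurableT_comp mf measurable_fst).
  exact: (measurableT_comp mf measurable_snd).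
have -> : (fun z : R * R => (`|z.1 - z.2| `^ (1 + 2 * sigma))^-1) =
    (fun z : R * R => `|z.1 - z.2| `^ (- (1 + 2 * sigma))).
  by apply/funext => z; rewrite powRN.
apply: (measurableT_comp (measurable_powR _)); apply: measurableT_comp => //.
by apply: measurable_funB; [exact: measurable_fst|exact: measurable_snd].
Qed.

Lemma measurable_gagliardo_slice sigma f x : measurable_fun [set: R] f ->
  measurable_fun [set: R] (fun y => gagliardo_kernel sigma f (x, y)).
Proof.
move=> mf; apply: (measurableT_comp (measurable_gagliardo_kernel sigma mf)).
exact: measurable_pair1.
Qed.

Lemma measurable_gagliardo sigma f : measurable_fun [set: R] f ->
  measurable_fun [set: R] (fun x => \int[mu]_y gagliardo_kernel sigma f (x, y))%E.
Proof.
move=> mf.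
have := @measurable_fun_fubini_tonelli_F _ _ _ _ R mu
  (gagliardo_kernel sigma f) (measurable_gagliardo_kernel sigma mf)
  (gagliardo_kernel_ge0 sigma f).
exact.
Qed.

(** Needed for noninteger s: [sobolev_norm] is informative only on [sobolev s], to which difference
    quotients must therefore belong. The bound is (a p + c q)^2 <= 2 a^2 p^2 + 2 c^2 q^2; [h] is
    given only up to null sets because iterated weak derivatives are choices. *)
Lemma gagliardo_lin sigma f g h a c : measurable_fun [set: R] f ->
  measurable_fun [set: R] g -> measurable_fun [set: R] h ->
  {ae mu, forall x, h x = a * f x + c * g x} ->
  (gagliardo_sqnorm sigma f < +oo)%E -> (gagliardo_sqnorm sigma g < +oo)%E ->
  (gagliardo_sqnorm sigma h < +oo)%E.
Proof.
move=> mf mg mh hE foo goo; pose K := gagliardo_kernel sigma.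
pose I u x := (\int[mu]_y K u (x, y))%E.
have I0 u x : (0 <= I u x)%E.
  by apply: integral_ge0 => y _; exact: gagliardo_kernel_ge0.
have C0 (d : R) : 0 <= 2 * d ^+ 2 by rewrite mulr_ge0 ?sqr_ge0.
have K0 u (d : R) z : (0 <= (2 * d ^+ 2)%:E * K u z)%E.
  by rewrite mule_ge0 ?lee_fin ?C0//; exact: gagliardo_kernel_ge0.
have mI u d : measurable_fun [set: R] u ->
    measurable_fun [set: R] (fun x => (2 * d ^+ 2)%:E * I u x)%E.
  by move=> mfu; apply: measurable_funeM; exact: measurable_gagliardo.
have H : (gagliardo_sqnorm sigma h <=
    \int[mu]_x ((2 * a ^+ 2)%:E * I f x + (2 * c ^+ 2)%:E * I g x))%E.
  apply: ae_ge0_le_integral => //.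
  - by move=> x _; exact: I0.
  - exact: measurable_gagliardo.
  - by move=> x _; rewrite adde_ge0// mule_ge0 ?lee_fin.
  - by apply: emeasurable_funD; exact: mI.
  apply: (ae_imp hE) => x hx _.
  rewrite /I -ge0_integralZl_EFin//; last 2 first.
  - by move=> y _; exact: gagliardo_kernel_ge0.
  - exact: measurable_gagliardo_slice.
  rewrite -ge0_integralZl_EFin//; last 2 first.
  - by move=> y _; exact: gagliardo_kernel_ge0.
  - exact: measurable_gagliardo_slice.
  rewrite -ge0_integralD//; last 2 first.
  - by apply: measurable_funeM; exact: measurable_gagliardo_slice.
  - by apply: measurable_funeM; exact: measurable_gagliardo_slice.
  apply: ae_ge0_le_integral => //.
  - by move=> y _; exact: (gagliardo_kernel_ge0 sigma h (x, y)).
  - exact: (measurable_gagliardo_slice sigma x mh).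
  - by move=> y _; rewrite adde_ge0// K0.
  - by apply: emeasurable_funD; apply: measurable_funeM; exact: measurable_gagliardo_slice.
  apply: (ae_imp hE) => y hy _.
  rewrite /K /gagliardo_kernel -!EFinM -EFinD lee_fin/= hx hy !mulrA -mulrDl.
  rewrite ler_wpM2r ?invr_ge0 ?powR_ge0//.
  have := sqr_ge0 (a * (f x - f y) - c * (g x - g y)); nra.
apply: (le_lt_trans H).
rewrite ge0_integralD//; last 4 first.
- by move=> x _; rewrite mule_ge0 ?lee_fin.
- exact: mI.
- by move=> x _; rewrite mule_ge0 ?lee_fin.
- exact: mI.
rewrite !ge0_integralZl_EFin//; try exact: measurable_gagliardo.
apply: lte_add_pinfty; apply: lte_mul_pinfty;
  [by rewrite lee_fin|by []|exact: foo|by rewrite lee_fin|by []|exact: goo].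
Qed.

Lemma sobolev_sqnormE_lty s f : sobolev s f ->
  (forall j, (j <= Num.truncn s)%N -> (L2_sqnorm (wderivn j f) < +oo)%E) /\
  (0 < s - (Num.truncn s)%:R ->
     (gagliardo_sqnorm (s - (Num.truncn s)%:R) (wderivn (Num.truncn s) f) < +oo)%E).
Proof.
move=> [_ _]; rewrite /sobolev_sqnorm.
set S := (\sum_(j < _) _)%E; set G := (if _ then _ else _) => foo.
have S0 : (0 <= S)%E by apply: sume_ge0 => i _; exact: L2_sqnorm_ge0.
have G0 : (0 <= G)%E.
  rewrite /G; case: ifP => // _; apply: integral_ge0 => x _; apply: integral_ge0 => y _.
  by rewrite lee_fin divr_ge0 ?sqr_ge0 ?powR_ge0.
split.
  move=> j jk; have jk1 : (j < (Num.truncn s).+1)%N by [].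
  apply: le_lt_trans foo; apply: (@le_trans _ _ S); last by rewrite leeDl.
  rewrite /S (bigD1 (Ordinal jk1))//= leeDl// sume_ge0// => i _.
  exact: L2_sqnorm_ge0.
move=> sg; move: foo; rewrite /G sg; apply: le_lt_trans.
by rewrite leeDr.
Qed.

Lemma sobolev_weak s f j : sobolev s f -> (j < Num.truncn s)%N ->
  is_weak_derivative (wderivn j f) (wderivn j.+1 f).
Proof. by move=> [_ + _]; apply. Qed.

Lemma sobolev_L2 s f j : sobolev s f -> (j <= Num.truncn s)%N -> L2 (wderivn j f).
Proof.
move=> sf jk; have [h _] := sobolev_sqnormE_lty sf.
apply: L2_sqnorm_lty; last exact: h.
case: j jk => [_|j jk]; first by case: sf.
by have [] := weak_measurable (sobolev_weak sf jk).
Qed.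

Lemma nrm_wderivn_sobolev s f j : sobolev s f -> (j <= Num.truncn s)%N ->
  nrm (wderivn j f) <= sobolev_norm s f.
Proof.
move=> sf jk; rewrite /nrm /sobolev_norm ler_wsqrtr//.
have -> : ip (wderivn j f) (wderivn j f) = fine (L2_sqnorm (wderivn j f)).
  by rewrite L2_sqnormE//; exact: sobolev_L2 jk.
have [_ _ foo] := sf; have [h _] := sobolev_sqnormE_lty sf.
have S0 : (0 <= \sum_(j < (Num.truncn s).+1) L2_sqnorm (wderivn j f))%E.
  by apply: sume_ge0 => i _; exact: L2_sqnorm_ge0.
have le1 : (L2_sqnorm (wderivn j f) <= sobolev_sqnorm s f)%E.
  apply: (@le_trans _ _ (\sum_(j < (Num.truncn s).+1) L2_sqnorm (wderivn j f))%E).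
    have jk1 : (j < (Num.truncn s).+1)%N by [].
    rewrite (bigD1 (Ordinal jk1))//= leeDl// sume_ge0// => i _.
    exact: L2_sqnorm_ge0.
  rewrite /sobolev_sqnorm leeDl//; case: ifP => // _.
  apply: integral_ge0 => x _; apply: integral_ge0 => y _.
  by rewrite lee_fin divr_ge0 ?sqr_ge0 ?powR_ge0.
rewrite fine_le// ge0_fin_numE ?L2_sqnorm_ge0//; first exact: h.
by rewrite (le_trans _ le1)// L2_sqnorm_ge0.
Qed.

(** [wderiv] chooses independently for the combination and for its terms, hence an almost everywhere
    identity, proved by induction on the order of derivation. *)
Lemma sobolev_lin s f g a c : sobolev s f -> sobolev s g ->
  sobolev s (fun x => a * f x + c * g x) /\
  forall j, (j <= Num.truncn s)%N -> {ae mu, forall x,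
    wderivn j (fun x => a * f x + c * g x) x = a * wderivn j f x + c * wderivn j g x}.
Proof.
move=> sf sg; set h := fun x => a * f x + c * g x.
have lc j : (j <= Num.truncn s)%N ->
    measurable_fun [set: R] (fun x => a * wderivn j f x + c * wderivn j g x).
  move=> jk; apply: L2_measurable; apply: L2D; apply: L2Z.
    exact: (sobolev_L2 sf jk).
  exact: (sobolev_L2 sg jk).
have main j : (j <= Num.truncn s)%N -> measurable_fun [set: R] (wderivn j h) /\
    {ae mu, forall x, wderivn j h x = a * wderivn j f x + c * wderivn j g x}.
  elim: j => [_|j IH jk].
    by split; [exact: (lc 0%N)|exact: ae_all].
  have [mh hE] := IH (ltnW jk).
  have w := weak_derivative_lin a c (sobolev_weak sf jk) (sobolev_weak sg jk).
  have hE' : {ae mu, forall x, a * wderivn j f x + c * wderivn j g x = wderivn j h x}.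
    by apply: (ae_imp hE) => x ->.
  have w' := weak_derivative_ae w mh (lc _ jk) hE' (ae_all (fun=> erefl)).
  split; first by have [] := weak_measurable (wderivP w').
  exact: (wderiv_ae w').
have mainL2 j : (j <= Num.truncn s)%N -> L2 (wderivn j h).
  move=> jk; have [mh hE] := main j jk; apply: (L2_ae mh _ hE).
  by apply: L2D; apply: L2Z; [exact: sobolev_L2 sf jk|exact: sobolev_L2 sg jk].
split; last by move=> j jk; have [] := main j jk.
split.
- by have [] := main 0%N (leq0n _).
- move=> j jk; have [mh hE] := main j (ltnW jk).
  have w := weak_derivative_lin a c (sobolev_weak sf jk) (sobolev_weak sg jk).
  have hE' : {ae mu, forall x, a * wderivn j f x + c * wderivn j g x = wderivn j h x}.
    by apply: (ae_imp hE) => x ->.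
  exact: wderivP (weak_derivative_ae w mh (lc _ jk) hE' (ae_all (fun=> erefl))).
- rewrite /sobolev_sqnorm lte_add_pinfty//.
    apply: lte_sum_pinfty => i _; rewrite L2_sqnormE ?ltry//.
    by apply: mainL2; rewrite -ltnS.
  case: ifP => // sg0.
  have [mh hE] := main _ (leqnn _).
  have [_ /(_ sg0) gf] := sobolev_sqnormE_lty sf.
  have [_ /(_ sg0) gg] := sobolev_sqnormE_lty sg.
  apply: (gagliardo_lin _ _ mh hE) => //.
    by apply: L2_measurable; exact: sobolev_L2 sf _.
  by apply: L2_measurable; exact: sobolev_L2 sg _.
Qed.

End Sobolev_spaces.

(** * Derivatives in time *)

Section Time_calculus.
Context {R : realType}.
Context (T : \bar R).
Implicit Types (f g h w z : R -> R -> R) (a b c t r : R).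

Local Notation mu := (@lebesgue_measure R).
Local Notation punctured t := (within (lifespan T) (dnbhs (t : R))).

(** The limit along [punctured t] in epsilon form; at t = 0 it is one-sided, since r ranges over
    [lifespan T]. *)
Definition plim t (E : R -> R) (l : R) : Prop := forall e, 0 < e ->
  exists2 d, 0 < d & forall r, lifespan T r -> r != t -> `|r - t| < d -> `|E r - l| < e.

Lemma plimP (E : R -> R) t (l : R) : E r @[r --> punctured t] --> l <-> plim t E l.
Proof.
split.
  move=> /cvgrPdist_lt H e e0; have [d /= d0 Hd] := H e e0; exists d => // r Tr rt rd.
  by rewrite distrC; apply: Hd => //=; rewrite distrC.
move=> H; apply/cvgrPdist_lt => e e0; have [d d0 Hd] := H e e0.
by exists d => // r /= rd rt Tr; rewrite distrC; apply: Hd => //; rewrite distrC.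
Qed.

Lemma punctured_filter t : Filter (punctured t).
Proof. exact: within_filter. Qed.

Lemma plimD t E F l k : plim t E l -> plim t F k -> plim t (fun r => E r + F r) (l + k).
Proof.
move=> /plimP hE /plimP hF; apply/plimP.
exact: (@cvgD _ _ _ _ (punctured_filter t) _ _ _ _ hE hF).
Qed.

Lemma plimM t E F l k : plim t E l -> plim t F k -> plim t (fun r => E r * F r) (l * k).
Proof.
move=> /plimP hE /plimP hF; apply/plimP.
exact: (@cvgM _ _ _ (punctured_filter t) _ _ _ _ hE hF).
Qed.

Lemma plim_cst t l : plim t (fun=> l) l.
Proof. by move=> e e0; exists 1 => // r _ _ _; rewrite subrr normr0. Qed.

Lemma plim_id t : plim t (fun r => r - t) 0.
Proof. by move=> e e0; exists e => // r _ _; rewrite subr0. Qed.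

Lemma plim_dist t : plim t (fun r => `|r - t|) 0.
Proof. by move=> e e0; exists e => // r _ _; rewrite subr0 normr_id. Qed.

Lemma eq_plim t E F l : (forall r, lifespan T r -> r != t -> E r = F r) ->
  plim t E l -> plim t F l.
Proof.
move=> EF h e e0; have [d d0 Hd] := h e e0; exists d => // r Tr rt rd.
by rewrite -EF//; exact: Hd.
Qed.

Lemma plim_sub0 t E l : plim t (fun r => E r - l) 0 -> plim t E l.
Proof.
move=> h; have := plimD h (plim_cst t l); rewrite add0r.
by apply: eq_plim => r _ _; rewrite subrK.
Qed.

Lemma squeeze_plim (E B : R -> R) t :
  (forall r, lifespan T r -> r != t -> `|E r| <= B r) -> plim t B 0 -> plim t E 0.
Proof.
move=> EB HB e e0; have [d d0 Hd] := HB e e0; exists d => // r Tr rt rd.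
have := Hd r Tr rt rd; rewrite !subr0; apply: le_lt_trans.
by rewrite (le_trans (EB r Tr rt))// ler_norm.
Qed.

Lemma lifespan_itv t0 t : lifespan T t0 -> 0 <= t -> t <= t0 -> lifespan T t.
Proof. by move=> [_ h] t0' tt; split=> //; apply: le_lt_trans h; rewrite lee_fin. Qed.

Definition time_derivative (E D : R -> R) := forall t, lifespan T t ->
  plim t (fun r => (E r - E t) / (r - t)) (D t).

Lemma time_derivative_continuous (E : R -> R) t0 : lifespan T t0 ->
  (forall t, lifespan T t -> plim t (fun r => E r - E t) 0) ->
  {within `[0, t0], continuous E}.
Proof.
move=> Tt0 H; apply/subspace_continuousP => t; rewrite /= in_itv/= => /andP[t1 t2].
have Ht := H t (lifespan_itv Tt0 t1 t2).
apply/cvgrPdist_lt => e e0; have [d d0 Hd] := Ht e e0.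
exists d => // r /= rd; rewrite in_itv/= => /andP[r1 r2].
have [->|rt] := eqVneq r t; first by rewrite subrr normr0.
have rd' : `|r - t| < d by rewrite distrC.
have := Hd r (lifespan_itv Tt0 r1 r2) rt rd'; rewrite subr0.
by rewrite /from_subspace/= distrC.
Qed.

Lemma time_derivative_diff (E D : R -> R) : time_derivative E D ->
  forall t, lifespan T t -> plim t (fun r => E r - E t) 0.
Proof.
move=> H t Tt; have := plimM (H t Tt) (plim_id t); rewrite mulr0.
by apply: eq_plim => r _ rt; rewrite divfK// subr_eq0.
Qed.

Lemma time_derivative_is_derive (E D : R -> R) t0 t : time_derivative E D ->
  lifespan T t0 -> 0 < t -> t < t0 -> is_derive t 1 E (D t).
Proof.
move=> H Tt0 t1 t2.
have Ht := H t (lifespan_itv Tt0 (ltW t1) (ltW t2)).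
have lim : h^-1 *: (E (h *: 1 + t) - E t) @[h --> 0^'] --> D t.
  apply/cvgrPdist_lt => e e0; have [d d0 Hd] := Ht e e0.
  exists (Num.min d (Num.min t (t0 - t))) => /=.
    by rewrite !lt_min d0 t1 subr_gt0.
  move=> h /=; rewrite sub0r normrN !lt_min => /and3P[h1 h2 h3] h0.
  have Th : lifespan T (h + t).
    have := ler_norm h; have := ler_norm (- h); rewrite normrN => n1 n2.
    by apply: (lifespan_itv Tt0); lra.
  have -> : h *: (1 : R) = h by rewrite /GRing.scale/= mulr1.
  have := Hd (h + t) Th; rewrite addrK distrC /GRing.scale/= mulrC; apply => //.
  by rewrite -subr_eq0 addrK.
by split; [apply/cvg_ex; exists (D t)|exact: cvg_lim lim].
Qed.

(** The equation holds only for t > 0, so the value of the derivative at 0 is not known; continuity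
    there is all that the mean value theorem requires. *)
Lemma time_derivative0_cst (E D : R -> R) t0 : time_derivative E D ->
  (forall t, 0 < t -> lifespan T t -> D t = 0) -> lifespan T t0 -> E t0 = E 0.
Proof.
move=> H D0 Tt0; have [t00 _] := Tt0.
move: (t00); rewrite le_eqVlt => /predU1P[<- //|t0gt].
have [|c] := @MVT R E D 0 t0 t0gt _ (time_derivative_continuous Tt0 (time_derivative_diff H)).
  move=> x; rewrite in_itv/= => /andP[x1 x2].
  exact: (time_derivative_is_derive H Tt0).
rewrite in_itv/= => /andP[c1 c2]; rewrite D0//; last by apply: (lifespan_itv Tt0); exact: ltW.
by rewrite mul0r => /eqP; rewrite subr_eq0 => /eqP.
Qed.

(** exp(-K t) E(t) starts at 0 and has a nonpositive derivative. *)
Lemma time_gronwall (E D : R -> R) K t0 : time_derivative E D ->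
  (forall t, 0 < t -> t < t0 -> D t <= K * E t) -> lifespan T t0 ->
  (forall t, 0 <= E t) -> E 0 = 0 -> E t0 = 0.
Proof.
move=> H DK Tt0 E0 E00; have [t00 _] := Tt0.
move: (t00); rewrite le_eqVlt => /predU1P[<- //|t0gt].
have dexp (x : R) : is_derive x 1 (fun s : R => expR (- K * s)) (expR (- K * x) * - K).
  have := @is_derive1_comp _ expR (fun s : R => - K * s) x _ _ (is_derive_expR _)
    (is_deriveZ (- K) (is_derive_id x 1)).
  by rewrite /GRing.scale/= mulr1.
pose P x := expR (- K * x) * E x.
pose P' x := expR (- K * x) * D x + E x * (expR (- K * x) * - K).
have [||c] := @MVT R P P' 0 t0 t0gt.
- move=> x; rewrite in_itv/= => /andP[x1 x2].
  exact: is_deriveM (dexp x) (time_derivative_is_derive H Tt0 x1 x2).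
- have cE := time_derivative_continuous Tt0 (time_derivative_diff H).
  apply/subspace_continuousP => x xab; apply: cvgM.
    have cexp : continuous (fun s : R => expR (- K * s)).
      move=> y; apply: differentiable_continuous; apply/derivable1_diffP.
      by case: (dexp y).
    by apply: cvg_within_filter; exact: cexp.
  by move/subspace_continuousP : cE; apply.
rewrite in_itv/= => /andP[c1 c2] PE.
have le0 : P' c <= 0.
  rewrite /P'; have -> : expR (- K * c) * D c + E c * (expR (- K * c) * - K) =
     expR (- K * c) * (D c - K * E c) by ring.
  by rewrite pmulr_rle0 ?expR_gt0// subr_le0 DK.
have : P t0 <= 0.
  have := PE; rewrite {2}/P E00 mulr0 !subr0 => ->.
  by rewrite mulr_le0_ge0.
rewrite /P pmulr_rle0 ?expR_gt0// => Ele.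
by apply/eqP; rewrite eq_le Ele E0.
Qed.

Definition L2_derivative t f (w : R -> R) : Prop :=
  [/\ forall r, lifespan T r -> L2 (f r), L2 w &
      plim t (fun r => nrm (fun x => (f r x - f t x) / (r - t) - w x)) 0].

Lemma L2_quotient t f r : lifespan T t -> lifespan T r ->
  (forall r, lifespan T r -> L2 (f r)) -> L2 (fun x => (f r x - f t x) / (r - t)).
Proof.
move=> Tt Tr lf; under eq_fun do rewrite mulrC.
by apply: L2Z; apply: L2B; exact: lf.
Qed.

Lemma L2_derivative_diff t f (w : R -> R) : lifespan T t -> L2_derivative t f w ->
  plim t (fun r => nrm (fun x => f r x - f t x)) 0.
Proof.
move=> Tt [lf lw lim].
apply: (@squeeze_plim _ (fun r => `|r - t| *
   (nrm (fun x => (f r x - f t x) / (r - t) - w x) + nrm w))).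
  move=> r Tr rt; rewrite ger0_norm ?nrm_ge0//.
  have lq := L2_quotient Tt Tr lf.
  have -> : (fun x => f r x - f t x) = (fun x => (r - t) * ((f r x - f t x) / (r - t))).
    by apply/funext => x; rewrite mulrC divfK// subr_eq0.
  rewrite nrmZ// ler_wpM2l//.
  have := nrmD (L2B lq lw) lw; by under [X in nrm X <= _ -> _]eq_fun do rewrite subrK.
have := plimM (plim_dist t) (plimD lim (plim_cst t (nrm w))).
by rewrite mul0r.
Qed.

Lemma ip_derivative t f g (w z : R -> R) : lifespan T t ->
  L2_derivative t f w -> L2_derivative t g z ->
  plim t (fun r => (ip (f r) (g r) - ip (f t) (g t)) / (r - t))
    (ip w (g t) + ip (f t) z).
Proof.
move=> Tt df dg; have [lf lw limf] := df; have [lg lz limg] := dg.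
have gdiff := L2_derivative_diff Tt dg.
have lft := lf _ Tt; have lgt := lg _ Tt.
apply: plim_sub0.
  pose A r := nrm (fun x => (f r x - f t x) / (r - t) - w x).
  pose B r := nrm (fun x => g r x - g t x).
  pose C r := nrm (fun x => (g r x - g t x) / (r - t) - z x).
  apply: (@squeeze_plim _ (fun r => A r * (B r + nrm (g t)) + nrm w * B r +
    nrm (f t) * C r)).
    move=> r Tr rt; have lfr := lf _ Tr; have lgr := lg _ Tr.
    have qf := L2_quotient Tt Tr lf; have qg := L2_quotient Tt Tr lg.
    (* The first term pairs with g(r) instead of g(t), so the middle term corrects it; g(r) is
       bounded in L^2 because it tends to g(t). *)
    have -> : (ip (f r) (g r) - ip (f t) (g t)) / (r - t) - (ip w (g t) + ip (f t) z) =
       ip (fun x => (f r x - f t x) / (r - t) - w x) (g r) +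
       ip w (fun x => g r x - g t x) +
       ip (f t) (fun x => (g r x - g t x) / (r - t) - z x).
      have e1 : ip (fun x => (f r x - f t x) / (r - t)) (g r) =
          (ip (f r) (g r) - ip (f t) (g r)) / (r - t).
        under [X in ip X _]eq_fun do rewrite mulrC.
        by rewrite ipZl//; [rewrite ipBl// mulrC|exact: L2B].
      have e2 : ip (f t) (fun x => (g r x - g t x) / (r - t)) =
          (ip (f t) (g r) - ip (f t) (g t)) / (r - t).
        under [X in ip _ X]eq_fun do rewrite mulrC.
        by rewrite ipZr//; [rewrite ipBr// mulrC|exact: L2B].
      rewrite ipBl// ipBr// ipBr// e1 e2; field.
      by rewrite subr_eq0.
    have c1 := cauchy_schwarz (L2B qf lw) lgr.
    have c2 := cauchy_schwarz lw (L2B lgr lgt).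
    have c3 := cauchy_schwarz lft (L2B qg lz).
    have c4 : nrm (g r) <= B r + nrm (g t).
      by have := nrmD (L2B lgr lgt) lgt; under [X in nrm X <= _ -> _]eq_fun do rewrite subrK.
    apply: (le_trans (ler_normD _ _)); apply: lerD => //.
    apply: (le_trans (ler_normD _ _)); apply: lerD => //.
    by apply: (le_trans c1); rewrite ler_wpM2l// nrm_ge0.
  have K := plim_cst t.
  have := plimD (plimD (plimM limf (plimD gdiff (K (nrm (g t))))) (plimM (K (nrm w)) gdiff))
     (plimM (K (nrm (f t))) limg).
  by rewrite !mulr0 mul0r !addr0.
Qed.

Definition H1_derivative t g g1 (z z1 : R -> R) : Prop :=
  [/\ forall r, lifespan T r -> H1 (g r) (g1 r), L2_derivative t g z & L2_derivative t g1 z1].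

(** Multiplication is not continuous on L^2: one factor must converge uniformly. The derivative of
    [g1] is assumed so that g(r) - g(t) tends to 0 in H^1, hence in sup norm; in the estimate [f]
    only has to be bounded at time t. *)
Lemma L2_derivativeM t f f1 g g1 (w z z1 : R -> R) : lifespan T t ->
  (forall r, lifespan T r -> H1 (f r) (f1 r)) -> L2_derivative t f w ->
  H1_derivative t g g1 z z1 ->
  L2_derivative t (fun r x => f r x * g r x) (fun x => w x * g t x + f t x * z x).
Proof.
move=> Tt hf df [hg dg dg1]; have [lf lw limf] := df; have [lg lz limg] := dg.
have gdiff := L2_derivative_diff Tt dg; have g1diff := L2_derivative_diff Tt dg1.
have hgt := hg _ Tt; have hft := hf _ Tt.
have [Bg Bg0 HBg] := H1_bounded hgt; have [Bf Bf0 HBf] := H1_bounded hft.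
have mfun_H1 (u u1 : R -> R) : H1 u u1 -> measurable_fun [set: R] u.
  by case=> _ /L2_measurable.
have lwg : L2 (fun x => w x * g t x) by apply: L2M_bounded HBg lw; exact: mfun_H1 hgt.
have lfz : L2 (fun x => f t x * z x).
  under eq_fun do rewrite mulrC.
  by apply: L2M_bounded HBf lz; exact: mfun_H1 hft.
split; [|exact: L2D|].
  by move=> r Tr; have [] := H1M (hf _ Tr) (hg _ Tr).
pose A r := nrm (fun x => (f r x - f t x) / (r - t) - w x).
pose B r := nrm (fun x => g r x - g t x) + nrm (fun x => g1 r x - g1 t x).
pose C r := nrm (fun x => (g r x - g t x) / (r - t) - z x).
apply: (@squeeze_plim _ (fun r => (B r + Bg) * A r + B r * nrm w + Bf * C r)).
  move=> r Tr rt; rewrite ger0_norm ?nrm_ge0//.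
  have qf := L2_quotient Tt Tr lf; have qg := L2_quotient Tt Tr lg.
  have supg x : `|g r x - g t x| <= B r := H1_sup_norm x (H1B (hg _ Tr) hgt).
  have supgr x : `|g r x| <= B r + Bg.
    have := ler_normD (g r x - g t x) (g t x); rewrite subrK.
    by have := supg x; have := HBg x; lra.
  have B0 : 0 <= B r by rewrite addr_ge0 ?nrm_ge0.
  have mgr := mfun_H1 _ _ (hg _ Tr); have mgt := mfun_H1 _ _ hgt.
  have l1 : L2 (fun x => ((f r x - f t x) / (r - t) - w x) * g r x).
    by apply: L2M_bounded supgr _ => //; exact: L2B.
  have l2 : L2 (fun x => w x * (g r x - g t x)).
    by apply: L2M_bounded supg _ => //; exact: measurable_funB.
  have l3 : L2 (fun x => ((g r x - g t x) / (r - t) - z x) * f t x).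
    by apply: L2M_bounded HBf _; [exact: mfun_H1 hft|exact: L2B].
  have -> : (fun x => (f r x * g r x - f t x * g t x) / (r - t) -
       (w x * g t x + f t x * z x)) = (fun x =>
      (((f r x - f t x) / (r - t) - w x) * g r x + w x * (g r x - g t x)) +
      ((g r x - g t x) / (r - t) - z x) * f t x).
    by apply/funext => x; field; rewrite subr_eq0.
  apply: (le_trans (nrmD (L2D l1 l2) l3)); apply: lerD.
    apply: (le_trans (nrmD l1 l2)); apply: lerD.
      apply: nrm_le; [exact: L2_measurable|exact: L2B|by rewrite addr_ge0|].
      by move=> x; rewrite normrM mulrC ler_wpM2r.
    apply: nrm_le; [exact: L2_measurable|by []|by []|].
    by move=> x; rewrite normrM mulrC ler_wpM2r.
  apply: nrm_le; [exact: L2_measurable|exact: L2B|by []|].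
  by move=> x; rewrite normrM mulrC ler_wpM2r.
have K := plim_cst t.
have limB := plimD gdiff g1diff.
have := plimD (plimD (plimM (plimD limB (K Bg)) limf) (plimM limB (K (nrm w)))) (plimM (K Bf) limg).
by rewrite !addr0 !mulr0 !mul0r !addr0.
Qed.

(** The Taylor remainder integrates to at most C times the squared L^2 norm of f(r) - f(t), which
    divided by r - t is C |r - t| times the square of a bounded quotient norm. *)
Lemma Int_comp_derivative t f (w : R -> R) (phi phi' : R -> R) C : lifespan T t ->
  0 <= C -> measurable_fun [set: R] phi -> measurable_fun [set: R] phi' ->
  phi 0 = 0 -> phi' 0 = 0 ->
  (forall x y, `|phi y - phi x - phi' x * (y - x)| <= C * (y - x) ^+ 2) ->
  (forall x y, `|phi' y - phi' x| <= C * `|y - x|) ->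
  L2_derivative t f w ->
  plim t (fun r => (\int[mu]_x phi (f r x) - \int[mu]_x phi (f t x))%R / (r - t))
    (ip (fun x => phi' (f t x)) w).
Proof.
move=> Tt C0 mphi mphi' p0 p'0 h1 h2 df; have [lf lw limf] := df.
have lft := lf _ Tt.
have Iphi (u : R -> R) : L2 u -> L1 setT (fun x => phi (u x)).
  move=> lu; apply: (@L1_le _ _ _ (fun x => C * u x ^+ 2)) => //.
  - by apply: measurableT_comp => //; exact: L2_measurable.
  - by apply: L1Z => //; case: lu.
  - by move=> x _; have := h1 0 (u x); rewrite p0 p'0 mul0r !subr0.
have lphi' (u : R -> R) : L2 u -> L2 (fun x => phi' (u x)).
  move=> lu; apply: (@L2_bound _ u _ C) => //.
    by apply: measurableT_comp => //; exact: L2_measurable.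
  by move=> x; have := h2 0 (u x); rewrite p'0 !subr0.
pose Q r := nrm (fun x => (f r x - f t x) / (r - t) - w x).
apply: plim_sub0.
  apply: (@squeeze_plim _ (fun r => C * `|r - t| * (Q r + nrm w) ^+ 2 +
     nrm (fun x => phi' (f t x)) * Q r)).
    move=> r Tr rt; have lfr := lf _ Tr; have qf := L2_quotient Tt Tr lf.
    have rt0 : r - t != 0 by rewrite subr_eq0.
    pose rem x := phi (f r x) - phi (f t x) - phi' (f t x) * (f r x - f t x).
    have ld := L2B lfr lft; have lp := lphi' _ lft.
    have I1 := Iphi _ lfr; have I2 := Iphi _ lft.
    have I3 : L1 setT (fun x => phi' (f t x) * (f r x - f t x)) by exact: L2_L1M.
    have Irem : L1 setT rem by apply: L1B => //; exact: L1B.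
    have -> : (\int[mu]_x phi (f r x) - \int[mu]_x phi (f t x))%R / (r - t) -
        ip (fun x => phi' (f t x)) w = (\int[mu]_x rem x)%R / (r - t) +
        ip (fun x => phi' (f t x)) (fun x => (f r x - f t x) / (r - t) - w x).
      rewrite ipBr// /rem RintegralB//; last exact: L1B.
      rewrite RintegralB//.
      under [X in _ + (ip _ X - _)]eq_fun do rewrite mulrC.
      by rewrite ipZr// /ip; field.
    apply: (le_trans (ler_normD _ _)); apply: lerD; last first.
      by apply: cauchy_schwarz => //; exact: L2B.
    have nq : nrm (fun x => (f r x - f t x) / (r - t)) <= Q r + nrm w.
      by have := nrmD (L2B qf lw) lw; under [X in nrm X <= _ -> _]eq_fun do rewrite subrK.
    have le1 : `|\int[mu]_x rem x| <= C * (`|r - t| * (Q r + nrm w)) ^+ 2.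
      apply: (@le_trans _ _ (C * ip (fun x => f r x - f t x) (fun x => f r x - f t x))).
        have Isq : L1 setT (fun x => (f r x - f t x) * (f r x - f t x)) by exact: L2_L1M.
        rewrite /ip -RintegralZl//; apply: abs_Int_le => //; first exact: L1Z.
        by move=> x _; rewrite -expr2; exact: h1.
      rewrite ler_wpM2l// -sqr_nrm ler_pXn2r ?nnegrE ?nrm_ge0//; last first.
        by rewrite mulr_ge0// (le_trans (nrm_ge0 _) nq).
      have -> : (fun x => f r x - f t x) = (fun x => (r - t) * ((f r x - f t x) / (r - t))).
        by apply/funext => x; rewrite mulrC divfK.
      by rewrite nrmZ// ler_wpM2l.
    rewrite normrM normfV ler_pdivrMr ?normr_gt0//.
    apply: (le_trans le1); rewrite exprMn; lra.
  have K := plim_cst t.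
  have labs := plim_dist t.
  have lsum := plimD limf (K (nrm w)).
  have := plimD (plimM (plimM (K C) labs) (plimM lsum lsum))
    (plimM (K (nrm (fun x => phi' (f t x)))) limf).
  by rewrite !mulr0 mul0r addr0; apply: eq_plim => r _ _; rewrite expr2.
Qed.

Lemma L2_derivativeB t f g (w z : R -> R) : lifespan T t ->
  L2_derivative t f w -> L2_derivative t g z ->
  L2_derivative t (fun r x => f r x - g r x) (fun x => w x - z x).
Proof.
move=> Tt [lf lw limf] [lg lz limg]; split.
- by move=> r Tr; apply: L2B; [exact: lf|exact: lg].
- exact: L2B.
- have := plimD limf limg; rewrite addr0; apply: squeeze_plim => r Tr rt.
  rewrite ger0_norm ?nrm_ge0//.
  have := nrmB (L2B (L2_quotient Tt Tr lf) lw) (L2B (L2_quotient Tt Tr lg) lz).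
  congr (nrm _ <= _); apply/funext => x.
  by field; rewrite subr_eq0.
Qed.

(** Derivatives are found time by time; [Q] records what is known of each value before choice
    assembles them into a function. *)
Lemma time_derivative_exists (E : R -> R) (Q : R -> R -> Prop) :
  (forall t, lifespan T t -> exists2 l, plim t (fun r => (E r - E t) / (r - t)) l & Q t l) ->
  exists2 D, time_derivative E D & forall t, lifespan T t -> Q t (D t).
Proof.
move=> H.
have /choice[D HD] : forall t, exists l, lifespan T t ->
    plim t (fun r => (E r - E t) / (r - t)) l /\ Q t l.
  move=> t; have [Tt|nTt] := pselect (lifespan T t); last by exists 0.
  by have [l h q] := H t Tt; exists l.
by exists D => t Tt; have [] := HD t Tt.
Qed.

Lemma nrm_time_bounded f (w : R -> R -> R) t0 : lifespan T t0 ->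
  (forall t, lifespan T t -> L2_derivative t f (w t)) ->
  exists B, forall t, 0 <= t -> t <= t0 -> nrm (f t) <= B.
Proof.
move=> Tt0 df; have [t00 _] := Tt0.
have c : {within `[0, t0], continuous (fun r => nrm (f r))}.
  apply: time_derivative_continuous => // t Tt; have [lf _ _] := df t Tt.
  apply: (squeeze_plim _ (L2_derivative_diff Tt (df t Tt))) => r Tr _.
  have lr := lf _ Tr; have lt := lf _ Tt.
  have := nrmD (L2B lr lt) lt; under [X in nrm X <= _ -> _]eq_fun do rewrite subrK.
  have := nrmD (L2B lt lr) lr; under [X in nrm X <= _ -> _]eq_fun do rewrite subrK.
  have -> : nrm (fun x => f t x - f r x) = nrm (fun x => f r x - f t x).
    by rewrite -(nrmN (L2B lt lr)); congr nrm; apply/funext => x; rewrite opprB.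
  by move=> h1 h2; rewrite ler_norml; apply/andP; split; lra.
have [c0 _ Hc] := EVT_max t00 c.
by exists (nrm (f c0)) => t t1 t2; apply: Hc; rewrite in_itv/= t1.
Qed.

End Time_calculus.

(** * Regularity of strong solutions *)

Section Strong_solutions.
Context {R : realType}.
Implicit Types (f g : R -> R) (a b c s t r : R) (T : \bar R).

Local Notation mu := (@lebesgue_measure R).

Lemma H1_derive1 f g : H1 f g -> continuous g -> derive1 f = g.
Proof.
move=> [ac _ _] cg; apply/funext => x; rewrite derive1E.
by have [_ ->] := AC_is_derive ac (cg x).
Qed.

Lemma H1_ext f F g : H1 F g -> (forall x, f x = F x) -> H1 f g.
Proof. by move=> h /funext ->. Qed.

Lemma weak_chain2 f f1 f2 : is_weak_derivative f f1 -> is_weak_derivative f1 f2 ->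
  L2 f -> L2 f1 -> L2 f2 ->
  exists F F1, [/\ H1 F F1, H1 F1 f2, {ae mu, forall x, f x = F x} &
     {ae mu, forall x, f1 x = F1 x}].
Proof.
move=> w w1 lf lf1 lf2.
have [F1 hF1 e1] := weak_derivative_H1 w1 lf1 lf2.
have [F hF e] := weak_derivative_H1 w lf lf1.
exists F, F1; split => //; apply: (H1_ae hF) => //.
by apply: L2_measurable; case: hF1.
Qed.

(** Since [f] is continuous, it equals the representative of its class and its first two derivatives
    are classical. The third remains a weak one, which is all that s = 3 provides. *)
Lemma sobolev3_chain s f : 3 <= s -> sobolev s f -> continuous f ->
  [/\ H1 f (derive1 f), H1 (derive1 f) (derive1 (derive1 f)),
      H1 (derive1 (derive1 f)) (wderivn 3 f),
      {ae mu, forall x, wderivn 1 f x = derive1 f x} &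
      {ae mu, forall x, wderivn 2 f x = derive1 (derive1 f) x}].
Proof.
move=> s3 sf cf.
have k3 : (3 <= Num.truncn s)%N by rewrite truncn_gt_nat.
have lj j : (j <= 3)%N -> L2 (wderivn j f).
  by move=> j3; apply: sobolev_L2 sf _; exact: leq_trans k3.
have wj j : (j < 3)%N -> is_weak_derivative (wderivn j f) (wderivn j.+1 f).
  by move=> j3; apply: sobolev_weak sf _; exact: leq_trans k3.
have [F2 hF2 e2] := weak_derivative_H1 (wj 2%N isT) (lj 2%N isT) (lj 3%N isT).
have [F [F1 [hF hF1 e0 e1]]] := weak_chain2 (wj 0%N isT) (wj 1%N isT)
  (lj 0%N isT) (lj 1%N isT) (lj 2%N isT).
have hF12 : H1 F1 F2.
  by apply: (H1_ae hF1) => //; apply: L2_measurable; case: hF2.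
have fF : forall x, f x = F x.
  by apply: continuous_ae_eq => //; exact: H1_continuous hF.
have hf : H1 f F1 := H1_ext hF fF.
have d1 : derive1 f = F1 by apply: (H1_derive1 hf); exact: H1_continuous hF12.
have d2 : derive1 F1 = F2 by apply: (H1_derive1 hF12); exact: H1_continuous hF2.
by rewrite d1 d2; split.
Qed.

Lemma L2_derivative_unique T t (f g : R -> R -> R) (w z : R -> R) : lifespan T t ->
  L2_derivative T t f w -> L2_derivative T t g z ->
  (forall r, lifespan T r -> {ae mu, forall x, f r x = g r x}) ->
  {ae mu, forall x, w x = z x}.
Proof.
move=> Tt [lf lw limf] [lg lz limg] fg.
have n0 : nrm (fun x => w x - z x) = 0.
  apply/eqP; rewrite eq_le nrm_ge0 andbT leNgt; apply/negP => n0.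
  have n2 : 0 < nrm (fun x => w x - z x) / 2 by rewrite divr_gt0.
  have [d1 d10 H1] := limf _ n2; have [d2 d20 H2] := limg _ n2.
  (* The interval [0, T) is open on the right, so later times arbitrarily close to t exist, even for
     t = 0. *)
  have [r [tr Tr rd1 rd2]] : exists r, [/\ t < r, lifespan T r, r - t < d1 & r - t < d2].
    have [t0 tT] := Tt.
    case: T tT {Tt lf lw limf lg lz limg fg H1 H2} => [T0| |] //; last first.
      move=> _; exists (t + Num.min d1 d2 / 2).
      have m0 : 0 < Num.min d1 d2 by rewrite lt_min d10.
      have m1 : Num.min d1 d2 <= d1 by rewrite ge_min lexx.
      have m2 : Num.min d1 d2 <= d2 by rewrite ge_min lexx orbT.
      split; [lra|split; [lra|by rewrite ltry]|lra|lra].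
    rewrite lte_fin => tT; exists (t + Num.min (Num.min d1 d2) (T0 - t) / 2).
    have m0 : 0 < Num.min (Num.min d1 d2) (T0 - t) by rewrite !lt_min d10 d20 subr_gt0.
    have m1 : Num.min (Num.min d1 d2) (T0 - t) <= d1 by rewrite !ge_min lexx.
    have m2 : Num.min (Num.min d1 d2) (T0 - t) <= d2 by rewrite !ge_min lexx orbT.
    have m3 : Num.min (Num.min d1 d2) (T0 - t) <= T0 - t by rewrite !ge_min lexx !orbT.
    split; [lra|split; [lra|by rewrite lte_fin; lra]|lra|lra].
  have rt : r != t by rewrite gt_eqF.
  have ab : `|r - t| = r - t by rewrite gtr0_norm ?subr_gt0.
  have := H1 r Tr rt; have := H2 r Tr rt; rewrite ab !subr0 !ger0_norm ?nrm_ge0// => /(_ rd2) h2 /(_ rd1) h1.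
  have qf := L2_quotient Tt Tr lf; have qg := L2_quotient Tt Tr lg.
  have E : nrm (fun x => (g r x - g t x) / (r - t) - z x) =
     nrm (fun x => (f r x - f t x) / (r - t) - z x).
    apply: nrm_ae; [by apply: L2_measurable; exact: L2B|by apply: L2_measurable; exact: L2B|].
    by apply: (ae_imp2 (fg _ Tr) (fg _ Tt)) => x -> ->.
  rewrite E in h2.
  have := nrm_triangle lw qf lz.
  have -> : nrm (fun x => w x - (f r x - f t x) / (r - t)) =
     nrm (fun x => (f r x - f t x) / (r - t) - w x).
    by rewrite -(nrmN (L2B lw qf)); congr nrm; apply/funext => x; rewrite opprB.
  lra.
by apply: (ae_imp (nrm_eq0 (L2B lw lz) n0)) => x /eqP; rewrite subr_eq0 => /eqP.
Qed.

Lemma sobolev_L2_derivative s T (w wt : R -> R -> R) t j :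
  sobolev_time_derivative s T w wt -> lifespan T t -> (j <= Num.truncn s)%N ->
  L2_derivative T t (fun r => wderivn j (w r)) (wderivn j (wt t)).
Proof.
move=> [sw lim] Tt jk.
have lw r : lifespan T r -> L2 (wderivn j (w r)).
  by move=> Tr; have [h _] := sw _ Tr; exact: sobolev_L2 h jk.
have [swt swtt] := sw _ Tt; have lwt := sobolev_L2 swtt jk.
split => //.
have /plimP := lim _ Tt; apply: squeeze_plim => r Tr rt.
rewrite ger0_norm ?nrm_ge0//.
have [swr _] := sw _ Tr.
(* The difference quotient is presented as two nested linear combinations, the form treated by
   [sobolev_lin]. *)
pose h1 x := 1 * w r x + (- 1) * w t x.
have [sh1 eh1] := sobolev_lin 1 (- 1) swr swt.
have [sh eh] := sobolev_lin ((r - t)^-1) (- 1) sh1 swtt.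
have -> : (fun x => (w r x - w t x) / (r - t) - wt t x) =
   (fun x => (r - t)^-1 * (1 * w r x + (- 1) * w t x) + (- 1) * wt t x).
  by apply/funext => x; rewrite !mulN1r mul1r mulrC.
apply: le_trans (nrm_wderivn_sobolev sh jk).
have -> // : nrm (fun x => (wderivn j (w r) x - wderivn j (w t) x) / (r - t) - wderivn j (wt t) x)
  = nrm (wderivn j (fun x => (r - t)^-1 * (1 * w r x + (- 1) * w t x) + (- 1) * wt t x)).
apply: nrm_ae.
- apply: L2_measurable; apply: L2B => //.
  by have := L2_quotient Tt Tr lw.
- by apply: L2_measurable; exact: sobolev_L2 sh jk.
- apply: (ae_imp2 (eh1 j jk) (eh j jk)) => x e1 e2.
  by rewrite e2 e1 !mulN1r mul1r [RHS]addrC addrC mulrC.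
Qed.

Lemma ae_imp3 (P1 P2 P3 Q : R -> Prop) : {ae mu, forall x, P1 x} ->
  {ae mu, forall x, P2 x} -> {ae mu, forall x, P3 x} ->
  (forall x, P1 x -> P2 x -> P3 x -> Q x) -> {ae mu, forall x, Q x}.
Proof.
move=> h1 h2 h3 H.
have h12 : {ae mu, forall x, P1 x /\ P2 x} by apply: (ae_imp2 h1 h2).
by apply: (ae_imp2 h12 h3) => x [p1 p2]; exact: H.
Qed.

Lemma L2_derivative_ae T t (f g : R -> R -> R) (w z : R -> R) : lifespan T t ->
  L2_derivative T t f w ->
  (forall r, lifespan T r -> measurable_fun [set: R] (g r)) ->
  measurable_fun [set: R] z ->
  (forall r, lifespan T r -> {ae mu, forall x, f r x = g r x}) ->
  {ae mu, forall x, w x = z x} -> L2_derivative T t g z.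
Proof.
move=> Tt [lf lw lim] mg mz fg wz.
have lg r : lifespan T r -> L2 (g r).
  by move=> Tr; apply: (L2_ae (mg _ Tr) (lf _ Tr)); apply: (ae_imp (fg _ Tr)) => x ->.
have lz : L2 z by apply: (L2_ae mz lw); apply: (ae_imp wz) => x ->.
split => //; apply: eq_plim lim => r Tr rt.
have qf := L2_quotient Tt Tr lf; have qg := L2_quotient Tt Tr lg.
apply: nrm_ae; [by apply: L2_measurable; exact: L2B|by apply: L2_measurable; exact: L2B|].
by apply: (ae_imp3 (fg _ Tr) (fg _ Tt) wz) => x -> -> ->.
Qed.

Definition H3_curve T (u u1 u2 u3 : R -> R -> R) : Prop := forall t, lifespan T t ->
  [/\ H1 (u t) (u1 t), H1 (u1 t) (u2 t) & H1 (u2 t) (u3 t)].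

(* W is the time derivative of u at time t; the last clause is the first
   equation of the system, with u, v replaced by their spatial derivatives. *)
Definition evolves T (u u1 u2 u3 v v1 : R -> R -> R) t (W W1 W2 : R -> R) : Prop :=
  [/\ H1 W W1 /\ H1 W1 W2,
      L2_derivative T t u W, L2_derivative T t u1 W1, L2_derivative T t u2 W2 &
      0 < t -> {ae mu, forall x, W x - W2 x + u t x * v t x * (u1 t x - u3 t x)
        + (2 * v t x * u1 t x + u t x * v1 t x) * (u t x - u2 t x) = 0}].

Lemma helmholtz_ae s f : 3 <= s -> sobolev s f -> continuous f ->
  {ae mu, forall x, helmholtz f x = f x - derive1 (derive1 f) x}.
Proof.
move=> s3 sf cf; have [_ _ _ _ e2] := sobolev3_chain s3 sf cf.
by apply: (ae_imp e2) => x e; rewrite /helmholtz -e.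
Qed.

Lemma strong_solution_H3 s T (u : R -> R -> R) : 3 <= s -> sobolev_C0 s T u ->
  (forall t, lifespan T t -> continuous (u t)) ->
  H3_curve T u (fun t => derive1 (u t)) (fun t => derive1 (derive1 (u t)))
    (fun t => wderivn 3 (u t)).
Proof.
move=> s3 [su _] cu t Tt.
by have [? ? ? _ _] := sobolev3_chain s3 (su _ Tt) (cu _ Tt).
Qed.

(** The equation provides m_t as a separate element of H^{s-3}. Being the L^2 derivative in time of
    m, it agrees almost everywhere with W - W_xx, computed from the derivative of u in H^{s-1},
    because such derivatives are unique. *)
Lemma strong_solution_evolves s T (u v : R -> R -> R) t : 3 <= s ->
  sobolev_C0 s T u -> sobolev_C1 (s - 1) T u ->
  (forall t, lifespan T t -> continuous (u t)) ->
  sobolev_C0 s T v -> (forall t, lifespan T t -> continuous (v t)) ->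
  novikov_equation s T u v -> lifespan T t ->
  exists W W1 W2, evolves T u (fun t => derive1 (u t)) (fun t => derive1 (derive1 (u t)))
    (fun t => wderivn 3 (u t)) v (fun t => derive1 (v t)) t W W1 W2.
Proof.
move=> s3 [su _] [ut dut _] cu [sv _] cv [mt dmt pde] Tt.
have k2 : (2 <= Num.truncn (s - 1))%N.
  by rewrite truncn_gt_nat; lra.
have dj j : (j <= 2)%N ->
    L2_derivative T t (fun r => wderivn j (u r)) (wderivn j (ut t)).
  by move=> j2; apply: (sobolev_L2_derivative dut) => //; exact: leq_trans k2.
have [_ sutt] := dut.1 _ Tt.
have lj j : (j <= 2)%N -> L2 (wderivn j (ut t)).
  by move=> j2; apply: sobolev_L2 sutt _; exact: leq_trans k2.
have wj j : (j < 2)%N -> is_weak_derivative (wderivn j (ut t)) (wderivn j.+1 (ut t)).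
  by move=> j2; apply: sobolev_weak sutt _; exact: leq_trans k2.
have [W [W1 [hW hW1 eW eW1]]] := weak_chain2 (wj 0%N isT) (wj 1%N isT)
  (lj 0%N isT) (lj 1%N isT) (lj 2%N isT).
exists W, W1, (wderivn 2 (ut t)).
have ch r (Tr : lifespan T r) := sobolev3_chain s3 (su _ Tr) (cu _ Tr).
have mH (f g : R -> R) : H1 f g -> measurable_fun [set: R] f.
  by case=> _ /L2_measurable.
have d0 : L2_derivative T t u W.
  apply: (L2_derivative_ae Tt (dj 0%N isT)) => //.
  - by move=> r Tr; have [h _ _ _ _] := ch _ Tr; exact: mH h.
  - exact: mH hW.
  - by move=> r Tr; exact: ae_all.
have d1 : L2_derivative T t (fun t => derive1 (u t)) W1.
  apply: (L2_derivative_ae Tt (dj 1%N isT)) => //.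
  - by move=> r Tr; have [_ h _ _ _] := ch _ Tr; exact: mH h.
  - exact: mH hW1.
  - by move=> r Tr; have [_ _ _ h _] := ch _ Tr.
have d2 : L2_derivative T t (fun t => derive1 (derive1 (u t))) (wderivn 2 (ut t)).
  apply: (L2_derivative_ae Tt (dj 2%N isT)) => //.
  - by move=> r Tr; have [_ _ h _ _] := ch _ Tr; exact: mH h.
  - by apply: L2_measurable; exact: lj.
  - by move=> r Tr; have [_ _ _ _ h] := ch _ Tr.
  - exact: ae_all.
split => // t0; have [_ tT] := Tt.
have dm := sobolev_L2_derivative dmt Tt (leq0n _).
have hm r (Tr : lifespan T r) := helmholtz_ae s3 (su _ Tr) (cu _ Tr).
have dd := L2_derivativeB Tt d0 d2.
have mtE : {ae mu, forall x, mt t x = W x - wderivn 2 (ut t) x}.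
  exact: (L2_derivative_unique Tt dm dd hm).
have [h1 h2 h3 e1 _] := ch _ Tt.
have e1v : {ae mu, forall x, wderiv (v t) x = derive1 (v t) x}.
  by have [_ _ _ h _] := sobolev3_chain s3 (sv _ Tt) (cv _ Tt).
have wm : {ae mu, forall x, wderiv (helmholtz (u t)) x = derive1 (u t) x - wderivn 3 (u t) x}.
  apply: (wderiv_eq_ae (H1_weak_derivative (H1B h1 h3))).
    by have [lm _ _] := dm; exact: L2_measurable (lm _ Tt).
  by apply: (ae_imp (hm _ Tt)) => x ->.
have P1 := pde t t0 tT.
have E1 : {ae mu, forall x, [/\ mt t x = W x - wderivn 2 (ut t) x,
   wderiv (helmholtz (u t)) x = derive1 (u t) x - wderivn 3 (u t) x &
   helmholtz (u t) x = u t x - derive1 (derive1 (u t)) x]}.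
  exact: (ae_imp3 mtE wm (hm _ Tt)).
have E2 : {ae mu, forall x, wderiv (u t) x = derive1 (u t) x /\ wderiv (v t) x = derive1 (v t) x}.
  exact: (ae_imp2 e1 e1v).
apply: (ae_imp3 P1 E1 E2) => x + [e1' e2' e3'] [e4 e5].
by rewrite e1' e2' e3' e4 e5.
Qed.

End Strong_solutions.

(** * Conservation laws and sign preservation *)

Section Integral_calculus.
Context {R : realType}.
Implicit Types (f g h : R -> R) (l k c : R).

Local Notation mu := (@lebesgue_measure R).

(** Integrability and value together, so that combinations of integral identities are built as terms
    and compared through a pointwise identity in [has_int_ae]. *)
Definition has_int h l : Prop := L1 setT h /\ \int[mu]_x h x = l.

Lemma has_intD h g l k : has_int h l -> has_int g k ->
  has_int (fun x => h x + g x) (l + k).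
Proof. by move=> [Ih <-] [Ig <-]; split; [exact: L1D|rewrite RintegralD]. Qed.

Lemma has_intZ h l c : has_int h l -> has_int (fun x => c * h x) (c * l).
Proof. by move=> [Ih <-]; split; [exact: L1Z|rewrite RintegralZl]. Qed.

Lemma has_intB h g l k : has_int h l -> has_int g k ->
  has_int (fun x => h x - g x) (l - k).
Proof. by move=> [Ih <-] [Ig <-]; split; [exact: L1B|rewrite RintegralB]. Qed.

Lemma has_int_ip f g : L2 f -> L2 g -> has_int (fun x => f x * g x) (ip f g).
Proof. by move=> lf lg; split => //; exact: L2_L1M. Qed.

Lemma has_int_H1 f f' g g' : H1 f f' -> H1 g g' ->
  has_int (fun x => f' x * g x + f x * g' x) 0.
Proof. by move=> hf hg; have [ac I1 I2] := H1_L1M hf hg; split => //; exact: (AC_IntT ac). Qed.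

Lemma has_int_ae h g l k : has_int h l -> has_int g k ->
  {ae mu, forall x, h x = g x} -> l = k.
Proof.
move=> [Ih <-] [Ig <-] hg; apply: Int_ae => //.
- exact: L1_measurable Ih.
- exact: L1_measurable Ig.
- by apply: (ae_imp hg).
Qed.

End Integral_calculus.

Section Conservation_laws.
Context {R : realType}.
Context (T : \bar R) (u u1 u2 u3 v v1 v2 v3 : R -> R -> R).
Implicit Types (t r c : R).

Local Notation mu := (@lebesgue_measure R).

Context (hu : H3_curve T u u1 u2 u3) (hv : H3_curve T v v1 v2 v3)
  (eu : forall t, lifespan T t -> exists W W1 W2, evolves T u u1 u2 u3 v v1 t W W1 W2)
  (ev : forall t, lifespan T t -> exists Z Z1 Z2, evolves T v v1 v2 v3 u u1 t Z Z1 Z2).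

Lemma H1_L2 (f g : R -> R) : H1 f g -> L2 f.
Proof. by case. Qed.

Lemma H1_L2' (f g : R -> R) : H1 f g -> L2 g.
Proof. by case. Qed.

(* u m_t = - (u^2 v m)_x *)
Lemma energy_conserved t0 : lifespan T t0 ->
  ip (u t0) (u t0) + ip (u1 t0) (u1 t0) = ip (u 0) (u 0) + ip (u1 0) (u1 0).
Proof.
move=> Tt0.
have [|D dD D0] := @time_derivative_exists _ T
  (fun t => ip (u t) (u t) + ip (u1 t) (u1 t)) (fun t l => 0 < t -> l = 0); last first.
  have D0' t : 0 < t -> lifespan T t -> D t = 0 by move=> tgt Tt; exact: D0.
  exact (time_derivative0_cst dD D0' Tt0).
move=> t Tt; have [W [W1 [W2 [[hW hW1] dW dW1 _ pde]]]] := eu Tt.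
have [h0 h1 h2] := hu Tt; have [g0 g1 _] := hv Tt.
exists (ip W (u t) + ip (u t) W + (ip W1 (u1 t) + ip (u1 t) W1)).
  apply: eq_plim (plimD (ip_derivative Tt dW dW) (ip_derivative Tt dW1 dW1)) => r _ _.
  by rewrite -mulrDl; congr (_ / _); ring.
move=> t_gt0; rewrite (ipC W) (ipC W1).
have i1 := has_int_ip (H1_L2 h0) (H1_L2 hW).
have i2 := has_int_ip (H1_L2 h1) (H1_L2 hW1).
(* u W + u_x W_x is u (W - W_xx) plus the derivative of u W_x, and by the equation u (W - W_xx) is
   minus the derivative of u^2 v m: these are [j1] and [j2]. *)
have j1 := has_int_H1 h0 hW1.
have hm := H1B h0 h2.
have j2 := has_int_H1 (H1M (H1M h0 h0) g0) hm.
have E := has_int_ae (has_intD (has_intD i1 i1) (has_intD i2 i2))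
  (has_intB (has_intZ 2 j1) (has_intZ 2 j2)).
rewrite E ?mulr0 ?subr0//.
apply: (ae_imp (pde t_gt0)) => x p.
have -> : W2 x = W x + u t x * v t x * (u1 t x - u3 t x) +
   (2 * v t x * u1 t x + u t x * v1 t x) * (u t x - u2 t x) by lra.
ring.
Qed.

(** The square of the negative part is C^{1,1}, as the chain rules above require; the negative part
    alone is not differentiable at 0. *)
Definition sqneg (y : R) : R := Num.min y 0 ^+ 2.
Definition sqneg' (y : R) : R := 2 * Num.min y 0.

Lemma sqneg_taylor x y : `|sqneg y - sqneg x - sqneg' x * (y - x)| <= 2 * (y - x) ^+ 2.
Proof.
rewrite /sqneg /sqneg' ler_norml.
have xx := sqr_ge0 x; have yy := sqr_ge0 y.
case: (leP y 0) => hy; case: (leP x 0) => hx.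
- by have := sqr_ge0 (y - x) => ?; apply/andP; split; nra.
- by have := mulr_ge0_le0 (ltW hx) hy => ?; apply/andP; split; nra.
- by have := mulr_le0_ge0 hx (ltW hy) => ?; apply/andP; split; nra.
- by have := sqr_ge0 (y - x) => ?; apply/andP; split; nra.
Qed.

Lemma sqneg'_lipschitz x y : `|sqneg' y - sqneg' x| <= 2 * `|y - x|.
Proof.
rewrite /sqneg' -mulrBr normrM ger0_norm// ler_wpM2l//.
case: (leP y 0) => hy; case: (leP x 0) => hx; rewrite ?subr0 ?sub0r ?normr0 ?normrN//.
- by rewrite (ler0_norm hy) ler0_norm; lra.
- by rewrite (ler0_norm hx) ger0_norm; lra.
Qed.

Lemma measurable_sqneg : measurable_fun [set: R] sqneg.
Proof. by apply: measurable_funX; apply: measurable_minr. Qed.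

Lemma measurable_sqneg' : measurable_fun [set: R] sqneg'.
Proof. by apply: measurable_funM => //; apply: measurable_minr. Qed.

(** Sup norms are dominated by H^1 norms, so a bound on u_x involves u_xx; the L^2 norms are
    continuous in time, hence bounded on [0, t0]. *)
Lemma sup_time_bounded t0 : lifespan T t0 -> exists2 B, 0 <= B & forall t x, 0 <= t -> t <= t0 ->
  [/\ `|u t x| <= B, `|u1 t x| <= B, `|v t x| <= B & `|v1 t x| <= B].
Proof.
move=> Tt0.
have /choice[W HW] : forall t, exists w : (R -> R) * (R -> R) * (R -> R), lifespan T t ->
    [/\ L2_derivative T t u w.1.1, L2_derivative T t u1 w.1.2 & L2_derivative T t u2 w.2].
  move=> t; have [Tt|nTt] := pselect (lifespan T t); last by exists (cst 0, cst 0, cst 0).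
  by have [w [w1 [w2 [_ d0 d1 d2 _]]]] := eu Tt; exists (w, w1, w2).
have /choice[Z HZ] : forall t, exists w : (R -> R) * (R -> R) * (R -> R), lifespan T t ->
    [/\ L2_derivative T t v w.1.1, L2_derivative T t v1 w.1.2 & L2_derivative T t v2 w.2].
  move=> t; have [Tt|nTt] := pselect (lifespan T t); last by exists (cst 0, cst 0, cst 0).
  by have [w [w1 [w2 [_ d0 d1 d2 _]]]] := ev Tt; exists (w, w1, w2).
have [b0 Hb0] : exists B, forall t, 0 <= t -> t <= t0 -> nrm (u t) <= B.
  apply: (@nrm_time_bounded _ T u (fun t => (W t).1.1) t0 Tt0) => t Tt.
  by have [h _ _] := HW t Tt.
have [b1 Hb1] : exists B, forall t, 0 <= t -> t <= t0 -> nrm (u1 t) <= B.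
  apply: (@nrm_time_bounded _ T u1 (fun t => (W t).1.2) t0 Tt0) => t Tt.
  by have [_ h _] := HW t Tt.
have [b2 Hb2] : exists B, forall t, 0 <= t -> t <= t0 -> nrm (u2 t) <= B.
  apply: (@nrm_time_bounded _ T u2 (fun t => (W t).2) t0 Tt0) => t Tt.
  by have [_ _ h] := HW t Tt.
have [c0 Hc0] : exists B, forall t, 0 <= t -> t <= t0 -> nrm (v t) <= B.
  apply: (@nrm_time_bounded _ T v (fun t => (Z t).1.1) t0 Tt0) => t Tt.
  by have [h _ _] := HZ t Tt.
have [c1 Hc1] : exists B, forall t, 0 <= t -> t <= t0 -> nrm (v1 t) <= B.
  apply: (@nrm_time_bounded _ T v1 (fun t => (Z t).1.2) t0 Tt0) => t Tt.
  by have [_ h _] := HZ t Tt.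
have [c2 Hc2] : exists B, forall t, 0 <= t -> t <= t0 -> nrm (v2 t) <= B.
  apply: (@nrm_time_bounded _ T v2 (fun t => (Z t).2) t0 Tt0) => t Tt.
  by have [_ _ h] := HZ t Tt.
have bd t : 0 <= t -> t <= t0 ->
    [/\ 0 <= nrm (u t) <= b0, 0 <= nrm (u1 t) <= b1 & 0 <= nrm (u2 t) <= b2] /\
    [/\ 0 <= nrm (v t) <= c0, 0 <= nrm (v1 t) <= c1 & 0 <= nrm (v2 t) <= c2].
  by move=> t1 t2; do 2!split; rewrite nrm_ge0/=; auto.
have [t00 _] := Tt0.
exists (b0 + b1 + b2 + (c0 + c1 + c2)).
  have [[/andP[p1 p2] /andP[p3 p4] /andP[p5 p6]]
    [/andP[p7 p8] /andP[p9 p10] /andP[p11 p12]]] := bd t0 t00 (lexx _).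
  by move: p1 p2 p3 p4 p5 p6 p7 p8 p9 p10 p11 p12; lra.
move=> t x t1 t2.
have [[/andP[p1 p2] /andP[p3 p4] /andP[p5 p6]]
    [/andP[p7 p8] /andP[p9 p10] /andP[p11 p12]]] := bd t t1 t2.
have Tt := lifespan_itv Tt0 t1 t2.
have [h0 h1 _] := hu Tt; have [g0 g1 _] := hv Tt.
have := H1_sup_norm x h0; have := H1_sup_norm x h1.
have := H1_sup_norm x g0; have := H1_sup_norm x g1.
move: p1 p2 p3 p4 p5 p6 p7 p8 p9 p10 p11 p12; clear; move=> *; split; lra.
Qed.

(* Gronwall for the integral of the squared negative part of m: after integrating
   the transport term by parts, its derivative is at most 4 B^2 times itself. *)
Lemma momentum_nonneg t0 : lifespan T t0 ->
  {ae mu, forall x, 0 <= u 0 x - u2 0 x} -> forall x, 0 <= u t0 x - u2 t0 x.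
Proof.
move=> Tt0 m0; have [B B0 HB] := sup_time_bounded Tt0.
have T0 : lifespan T 0 by apply: (lifespan_itv Tt0) => //; case: Tt0.
have s0 : sqneg 0 = 0 by rewrite /sqneg minxx expr0n.
have s'0 : sqneg' 0 = 0 by rewrite /sqneg' minxx mulr0.
pose G t : R := (\int[mu]_x sqneg (u t x - u2 t x))%R.
have two0 : (0 : R) <= 2 by [].
have mL2 t : lifespan T t -> H1 (fun x => u t x - u2 t x) (fun x => u1 t x - u3 t x).
  by move=> Tt; have [h0 _ h2] := hu Tt; exact: H1B.
have sqI t : lifespan T t -> has_int (fun x => sqneg (u t x - u2 t x)) (G t).
  move=> Tt; split => //; have [lm _] := H1_L2 (mL2 t Tt).
  have l2 := H1_L2 (mL2 t Tt).
  apply: (@L1_le _ _ _ (fun x => 2 * ((u t x - u2 t x) * (u t x - u2 t x)))) => //.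
  - by apply: measurableT_comp lm; exact: measurable_sqneg.
  - by apply: L1Z => //; exact: L2_L1M.
  - move=> x _; have := sqneg_taylor 0 (u t x - u2 t x).
    by rewrite s0 s'0 mul0r !subr0 expr2.
have [|D dD DB] := @time_derivative_exists _ T G
  (fun t l => 0 < t -> t < t0 -> l <= 4 * B ^+ 2 * G t); last first.
  have G0 : G t0 = 0.
    apply: (time_gronwall dD (K := 4 * B ^+ 2)) => //.
    - by move=> t t1 t2; apply: DB => //; apply: (lifespan_itv Tt0); exact: ltW.
    - by move=> t; apply: Rintegral_ge0 => x _; exact: sqr_ge0.
    - have z : has_int (fun _ : R => 0 : R) 0.
        by split; [exact: integrable0|rewrite Rintegral_cst// mul0r].
      apply: (has_int_ae (sqI _ T0) z).
      by apply: (ae_imp m0) => x x0; rewrite /sqneg min_r// expr0n.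
  have [Isq _] := sqI _ Tt0.
  have ae0 := Int_ge0_eq0 Isq (fun x => sqr_ge0 _) G0.
  (* (m - |m|) / 2 is min(m, 0) as an explicitly continuous function, so that vanishing almost
     everywhere becomes vanishing everywhere. *)
  have cm : continuous (fun x => 2^-1 * ((u t0 x - u2 t0 x) - `|u t0 x - u2 t0 x|)).
    have c := H1_continuous (mL2 _ Tt0).
    move=> x; apply: cvgM; first exact: cvg_cst.
    by apply: cvgB; [exact: c|apply: cvg_norm; exact: c].
  have c0 : continuous (fun _ : R => 0 : R) by move=> x; exact: cvg_cst.
  move=> x; have h : {ae mu, forall x,
      2^-1 * ((u t0 x - u2 t0 x) - `|u t0 x - u2 t0 x|) = 0}.
    apply: (ae_imp ae0) => y /eqP; rewrite sqrf_eq0.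
    case: leP => hy /eqP; first by move=> ->; rewrite normr0 subrr mulr0.
    by rewrite (gtr0_norm hy) subrr mulr0.
  have /eqP := continuous_ae_eq cm c0 h x.
  rewrite mulf_eq0 invr_eq0 pnatr_eq0/= subr_eq0 => /eqP ->.
  exact: normr_ge0.
move=> t Tt; have [W [W1 [W2 [[hW hW1] dW dW1 dW2 pde]]]] := eu Tt.
have [h0 h1 h2] := hu Tt; have [g0 g1 _] := hv Tt.
have dm := L2_derivativeB Tt dW dW2.
have dG := Int_comp_derivative Tt two0 measurable_sqneg measurable_sqneg' s0 s'0
  sqneg_taylor sqneg'_lipschitz dm.
exists (ip (fun x => sqneg' (u t x - u2 t x)) (fun x => W x - W2 x)) => // t1 t2.
have hm := mL2 _ Tt.
have hphi := H1_comp two0 measurable_sqneg' s0 s'0 sqneg_taylor sqneg'_lipschitz hm.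
(* The derivative of u v times the squared negative part integrates to 0; adding it removes m_x from
   the time derivative. *)
have j := has_int_H1 (H1M h0 g0) hphi.
have lphi : L2 (fun x => sqneg' (u t x - u2 t x)).
  apply: (@L2_bound _ (fun x => u t x - u2 t x) _ 2).
  - by apply: measurableT_comp; [exact: measurable_sqneg'|apply: L2_measurable; exact: H1_L2 hm].
  - exact: H1_L2 hm.
  - by move=> x; have := sqneg'_lipschitz 0 (u t x - u2 t x); rewrite s'0 !subr0.
have i1 := has_int_ip lphi (L2B (H1_L2 hW) (H1_L2' hW1)).
have i2 := has_intZ (4 * B ^+ 2) (sqI _ Tt).
rewrite -[leLHS]addr0.
have [Is _] := has_intD i1 j; have [I2 E2] := i2.
have [_ <-] := has_intD i1 j; rewrite -E2.
apply: Int_le_ae => //.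
apply: (ae_imp (pde t1)) => x p.
have -> : W x - W2 x = - (u t x * v t x * (u1 t x - u3 t x)) -
   (2 * v t x * u1 t x + u t x * v1 t x) * (u t x - u2 t x) by lra.
(* Homogeneity of degree 2: with m_x gone, the integrand becomes a bounded coefficient times
   [sqneg]. *)
have sm : sqneg' (u t x - u2 t x) * (u t x - u2 t x) = 2 * sqneg (u t x - u2 t x).
  by rewrite /sqneg' /sqneg; case: leP => _; ring.
have -> : sqneg' (u t x - u2 t x) * (- (u t x * v t x * (u1 t x - u3 t x)) -
     (2 * v t x * u1 t x + u t x * v1 t x) * (u t x - u2 t x)) +
   ((u1 t x * v t x + u t x * v1 t x) * sqneg (u t x - u2 t x) +
    u t x * v t x * (sqneg' (u t x - u2 t x) * (u1 t x - u3 t x))) =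
   (u1 t x * v t x + u t x * v1 t x) * sqneg (u t x - u2 t x) -
   (2 * v t x * u1 t x + u t x * v1 t x) *
     (sqneg' (u t x - u2 t x) * (u t x - u2 t x)) by ring.
rewrite sm.
have -> : (u1 t x * v t x + u t x * v1 t x) * sqneg (u t x - u2 t x) -
   (2 * v t x * u1 t x + u t x * v1 t x) * (2 * sqneg (u t x - u2 t x)) =
   (- 3 * (u1 t x * v t x) - u t x * v1 t x) * sqneg (u t x - u2 t x) by ring.
apply: ler_wpM2r; first exact: sqr_ge0.
have [b1 b2 b3 b4] := HB t x (ltW t1) (ltW t2).
have p1 : `|u1 t x * v t x| <= B ^+ 2 by rewrite normrM expr2 ler_pM.
have p2 : `|u t x * v1 t x| <= B ^+ 2 by rewrite normrM expr2 ler_pM.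
by move: p1 p2; rewrite !ler_norml => /andP[p3 p4] /andP[p5 p6]; lra.
Qed.

(* Conserved by the flow; equal to 4 a^2 b^2 at the peakons. *)
Definition quartic (f f' g g' : R -> R) : R :=
  3 * ip (fun x => f x * g x) (fun x => f x * g x)
  + ip (fun x => f x * g' x) (fun x => f x * g' x)
  + ip (fun x => f' x * g x) (fun x => f' x * g x)
  + 4 * ip (fun x => f x * g x) (fun x => f' x * g' x)
  - ip (fun x => f' x * g' x) (fun x => f' x * g' x).

Lemma quartic_conserved t0 : lifespan T t0 ->
  quartic (u t0) (u1 t0) (v t0) (v1 t0) = quartic (u 0) (u1 0) (v 0) (v1 0).
Proof.
move=> Tt0.
have [|D dD D0] := @time_derivative_exists _ T
  (fun t => quartic (u t) (u1 t) (v t) (v1 t)) (fun t l => 0 < t -> l = 0); last first.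
  have D0' t : 0 < t -> lifespan T t -> D t = 0 by move=> tgt Tt; exact: D0.
  exact (time_derivative0_cst dD D0' Tt0).
move=> t Tt.
have [W [W1 [W2 [[hW hW1] dW dW1 dW2 pdeu]]]] := eu Tt.
have [Z [Z1 [Z2 [[hZ hZ1] dZ dZ1 dZ2 pdev]]]] := ev Tt.
have [h0 h1 h2] := hu Tt; have [g0 g1 g2] := hv Tt.
have cv : H1_derivative T t v v1 Z Z1 by split => // r Tr; have [] := hv Tr.
have cv1 : H1_derivative T t v1 v2 Z1 Z2 by split => // r Tr; have [] := hv Tr.
have hu0 r : lifespan T r -> H1 (u r) (u1 r) by move=> Tr; have [] := hu Tr.
have hu1 r : lifespan T r -> H1 (u1 r) (u2 r) by move=> Tr; have [] := hu Tr.
have d1 := L2_derivativeM Tt hu0 dW cv.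
have d2 := L2_derivativeM Tt hu0 dW cv1.
have d3 := L2_derivativeM Tt hu1 dW1 cv.
have d4 := L2_derivativeM Tt hu1 dW1 cv1.
have K3 := plim_cst T t 3; have K4 := plim_cst T t 4; have KN := plim_cst T t (-1).
have lim := plimD (plimD (plimD (plimD (plimM K3 (ip_derivative Tt d1 d1))
   (ip_derivative Tt d2 d2)) (ip_derivative Tt d3 d3))
   (plimM K4 (ip_derivative Tt d1 d4))) (plimM KN (ip_derivative Tt d4 d4)).
refine (ex_intro2 _ _ _ (eq_plim _ lim) _).
  by move=> r _ rt; rewrite /quartic; field; rewrite subr_eq0.
move=> t_gt0.
have [_ l1 _] := d1; have [_ l2 _] := d2; have [_ l3 _] := d3; have [_ l4 _] := d4.
have p1 := H1_L2 (H1M h0 g0); have p2 := H1_L2 (H1M h0 g1).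
have p3 := H1_L2 (H1M h1 g0); have p4 := H1_L2 (H1M h1 g1).
have I := has_intD (has_intD (has_intD (has_intD
  (has_intZ 3 (has_intD (has_int_ip l1 p1) (has_int_ip p1 l1)))
  (has_intD (has_int_ip l2 p2) (has_int_ip p2 l2)))
  (has_intD (has_int_ip l3 p3) (has_int_ip p3 l3)))
  (has_intZ 4 (has_intD (has_int_ip l1 p4) (has_int_ip p1 l4))))
  (has_intZ (-1) (has_intD (has_int_ip l4 p4) (has_int_ip p4 l4))).
(* The time derivative of the density is the x-derivative of a flux which is a
   polynomial in u, v, u_x, v_x, w = u_t, z = v_t and in wt = w + (u v) u_x,
   zt = z + (u v) v_x and their x-derivatives; n1, ..., n7 are its terms. *)
have hk := H1M h0 g0.
have hk1 := H1D (H1M h1 g0) (H1M h0 g1).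
have hwt := H1D hW (H1M hk h1).
have hwt1 := H1D hW1 (H1D (H1M hk1 h1) (H1M hk h2)).
have hzt := H1D hZ (H1M hk g1).
have hzt1 := H1D hZ1 (H1D (H1M hk1 g1) (H1M hk g2)).
have hQ := H1B (H1M g0 g0) (H1M g1 g1).
have hS := H1B (H1M h0 h0) (H1M h1 h1).
have hR := H1B hk (H1M h1 g1).
have hx1 := H1D (H1D (H1M (H1M h0 h0) g0) (H1M (H1M h0 h1) g1)) (H1Z 2^-1 (H1M (H1M h1 h1) g0)).
have hx2 := H1D (H1D (H1M (H1M g0 g0) h0) (H1M (H1M g0 g1) h1)) (H1Z 2^-1 (H1M (H1M g1 g1) h0)).
have hy1 := H1Z 2^-1 (H1M (H1M h1 h1) g1).
have hy2 := H1Z 2^-1 (H1M (H1M g1 g1) h1).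
have hg := H1M h0 (H1M g0 g0).
have hg' := H1D (H1M h1 (H1M g0 g0)) (H1Z 2 (H1M h0 (H1M g0 g1))).
have hh := H1M g0 (H1M h0 h0).
have hh' := H1D (H1M g1 (H1M h0 h0)) (H1Z 2 (H1M g0 (H1M h0 h1))).
(* The functions in [hfp] and [hfq] are the partial derivatives of the density of [quartic] in u_x
   and v_x; [n1] integrates the terms in W_x and Z_x by parts. *)
have hfp := H1B (H1D (H1Z 2 (H1M (H1M g0 g0) h1)) (H1Z 4 (H1M hk g1))) (H1Z 2 (H1M h1 (H1M g1 g1))).
have hfq := H1B (H1D (H1Z 2 (H1M (H1M h0 h0) g1)) (H1Z 4 (H1M hk h1))) (H1Z 2 (H1M g1 (H1M h1 h1))).
have n1 := has_intD (has_int_H1 hfp hW) (has_int_H1 hfq hZ).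
have n2 := has_int_H1 hk (H1D (H1M hQ hS) (H1Z 2 (H1M hR hR))).
have n3 := has_intZ 2 (has_intD (has_intB (has_int_H1 hg hwt1) (has_int_H1 hg' hwt))
  (has_intB (has_int_H1 hh hzt1) (has_int_H1 hh' hzt))).
have n4 := has_intZ 4 (has_intD (has_intD (has_intD (has_int_H1 hy2 hwt) (has_int_H1 hy1 hzt))
  (has_intD (has_int_H1 hx2 hwt1) (has_int_H1 hx1 hzt1)))
  (has_intB (has_int_H1 hwt hzt) (has_int_H1 hwt1 hzt1))).
have n5 := has_intZ 2 (has_intD (has_int_H1 hg hx1) (has_int_H1 hh hx2)).
have n6 := has_intZ 4 (has_int_H1 hx1 hx2).
have n7 := has_intZ 3 (has_int_H1 (H1M hk hk) hk).
have J := has_intD (has_intB (has_intB (has_intD (has_intD (has_intB n1 n2) n3) n4) n5) n6) n7.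
refine (eq_trans (has_int_ae I J _) _); last by rewrite !(mulr0, addr0, subr0).
apply: (ae_imp2 (pdeu t_gt0) (pdev t_gt0)) => x pu pv.
(* The equations express W_xx and Z_xx through the other quantities, in which the identity is purely
   algebraic. *)
have -> : W2 x = W x + u t x * v t x * (u1 t x - u3 t x) +
   (2 * v t x * u1 t x + u t x * v1 t x) * (u t x - u2 t x) by lra.
have -> : Z2 x = Z x + v t x * u t x * (v1 t x - v3 t x) +
   (2 * u t x * v1 t x + v t x * u1 t x) * (v t x - v2 t x) by lra.
move: (u t x) (u1 t x) (u2 t x) (u3 t x) (v t x) (v1 t x) (v2 t x) (v3 t x)
  (W x) (W1 x) (Z x) (Z1 x) => *; by field.
Qed.

End Conservation_laws.

(** * The inequality at the maximum of the product *)

Section Pointwise_bounds.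
Context {R : realType}.
Implicit Types (f g : R -> R) (x y s B : R).

Local Notation mu := (@lebesgue_measure R).

Lemma AC_exp s x0 c : AC (fun x : R => c * expR (s * (x - x0))) (fun x => s * (c * expR (s * (x - x0)))).
Proof.
have d (x : R) : is_derive x 1 (fun x : R => c * expR (s * (x - x0))) (s * (c * expR (s * (x - x0)))).
  have d1 : is_derive x 1 (fun x : R => s * (x - x0)) s.
    have := is_deriveZ s (is_deriveB (is_derive_id x 1) (is_derive_cst x0 x 1)).
    by rewrite /GRing.scale/= subr0 mulr1.
  have d2 := @is_derive1_comp _ _ _ x _ _ (is_derive_expR (s * (x - x0))) d1.
  by apply: (is_derive_eq (is_deriveZ c d2)); rewrite /GRing.scale/=; ring.
have cE : continuous (fun x : R => c * expR (s * (x - x0))).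
  by move=> x; apply: differentiable_continuous; apply/derivable1_diffP; case: (d x).
apply: AC_C1 => // x; apply: cvgM; first exact: cvg_cst.
exact: cE.
Qed.

Lemma AC_nondecreasing f f' x y : AC f f' -> x <= y ->
  (forall t, 0 <= f' t) -> f x <= f y.
Proof.
by move=> [_ h] xy f'0; rewrite -subr_ge0 h// Rintegral_ge0.
Qed.

(* exp(s x) g(x) is monotone and g is bounded. *)
Lemma bounded_growth_ge0 s g g' B : (s = 1 \/ s = -1) -> AC g g' ->
  (forall x, `|g x| <= B) -> (forall x, 0 <= s * (g' x + s * g x)) ->
  forall x, 0 <= g x.
Proof.
move=> s1 acg gB sg x; rewrite leNgt; apply/negP => gx0.
have ss : s * s = 1 by case: s1 => ->; ring.
have B0 : 0 <= B by rewrite (le_trans _ (gB 0)).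
(* Moving by this distance multiplies the negative value g(x) by at least e^d >= 1 + d, and (1 + d)
   g(x) = g(x) - B lies below the bound -B. *)
pose d := B / (- g x).
have d0 : 0 <= d by rewrite divr_ge0// oppr_ge0 ltW.
pose y := x - s * d.
pose E t := 1 * expR (s * (t - x)).
have acE : AC E (fun t => s * E t) := AC_exp s x 1.
have E0 t : 0 <= E t by rewrite /E mul1r expR_ge0.
have acP := ACZ s (ACM acE acg).
have P'0 t : 0 <= s * ((s * E t) * g t + E t * g' t).
  have -> : s * ((s * E t) * g t + E t * g' t) = E t * (s * (g' t + s * g t)) by ring.
  by rewrite mulr_ge0.
have main : E y * g y <= E x * g x.
  case: s1 => s1; rewrite s1 in acP P'0.
    have yx : y <= x by rewrite /y s1; lra.
    by have := AC_nondecreasing acP yx P'0; rewrite !mul1r.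
  have xy : x <= y by rewrite /y s1; lra.
  by have := AC_nondecreasing acP xy P'0; rewrite !mulN1r lerN2.
have Ex : E x = 1 by rewrite /E subrr mulr0 expR0 mulr1.
have Ey : E y = expR (- d).
  rewrite /E mul1r /y; congr expR.
  have -> : s * (x - s * d - x) = - (s * s) * d by ring.
  by rewrite ss mulN1r.
move: main; rewrite Ex Ey mul1r expRN => main.
have ed := expR_gt0 d.
have : - B <= expR d * g x.
  have gy : - B <= g y by have := gB y; rewrite ler_norml => /andP[].
  apply: (le_trans gy); rewrite mulrC -ler_pdivrMr// mulrC.
  exact: main.
have e1 := expR_ge1Dx d.
have : expR d * g x <= (1 + d) * g x by rewrite ler_wnM2r// ltW.
have -> : (1 + d) * g x = g x - B by rewrite /d; field; rewrite lt_eqF.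
lra.
Qed.

(** Both f + f' and f - f' are bounded; (f + f')' - (f + f') = f'' - f is nonpositive and (f - f')'
    + (f - f') = f - f'' is nonnegative, the two cases of [bounded_growth_ge0]. *)
Lemma momentum_derivative_bound f f1 f2 : H1 f f1 -> H1 f1 f2 ->
  (forall x, 0 <= f x - f2 x) -> forall x, `|f1 x| <= f x.
Proof.
move=> h h1 m0 x.
have [B1 B10 HB1] := H1_bounded h; have [B2 B20 HB2] := H1_bounded h1.
have [hac _ _] := h; have [h1ac _ _] := h1.
have p : 0 <= f x + f1 x.
  apply: (@bounded_growth_ge0 (-1) (fun x => f x + f1 x) (fun x => f1 x + f2 x) (B1 + B2)).
  - by right.
  - exact: ACD.
  - by move=> y; rewrite (le_trans (ler_normD _ _))// lerD.
  - by move=> y; have := m0 y; lra.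
have q : 0 <= f x + (-1) * f1 x.
  apply: (@bounded_growth_ge0 1 (fun x => f x + (-1) * f1 x) (fun x => f1 x + (-1) * f2 x) (B1 + B2)).
  - by left.
  - by apply: ACD => //; exact: ACZ.
  - by move=> y; rewrite (le_trans (ler_normD _ _))// lerD// normrM normrN1 mul1r.
  - by move=> y; have := m0 y; lra.
by rewrite ler_norml; apply/andP; split; lra.
Qed.

(** The product tends to 0 at infinity, so unless it vanishes identically its maximum is attained on
    a compact interval containing a point where it is positive. *)
Lemma max_point_exists f f1 g g1 : H1 f f1 -> H1 g g1 ->
  (forall x, 0 <= f x) -> (forall x, 0 <= g x) ->
  exists z, is_max_point (fun x => f x * g x) z.
Proof.
move=> hf hg f0 g0.
have k0 x : 0 <= f x * g x by rewrite mulr_ge0.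
have [kz|] := pselect (forall x, f x * g x <= 0).
  by exists 0 => x; rewrite (le_trans (kz x)).
move=> /existsNP[x0 /negP]; rewrite -ltNge => kx0.
have [M M0 HM] := H1_decay hf hg kx0.
pose M' := M + `|x0|.
have M'0 : - M' <= M' by have := normr_ge0 x0; rewrite /M'; lra.
have ck : {within `[- M', M'], continuous (fun x => f x * g x)}.
  apply: continuous_subspaceT => x; apply: cvgM; [exact: (H1_continuous hf)|exact: (H1_continuous hg)].
have [z _ Hz] := EVT_max M'0 ck; exists z => x.
have x0M : x0 \in `[- M', M'].
  rewrite in_itv/= -ler_norml /M'; lra.
have [xM|xM] := leP `|x| M'.
  by apply: Hz; rewrite in_itv/= -ler_norml.
have : `|f x * g x| < f x0 * g x0.
  by apply: HM; move: xM; rewrite /M'; have := normr_ge0 x0; lra.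
rewrite ger0_norm// => /ltW/le_trans; apply; exact: Hz.
Qed.

End Pointwise_bounds.

(** * Integration on the two sides of the maximum *)

Section Ray_integrals.
Context {R : realType}.
Implicit Types (f g h : R -> R) (D : set R) (l k c : R).

Local Notation mu := (@lebesgue_measure R).

Definition has_int_on D h l : Prop :=
  [/\ measurable D, L1 D h & \int[mu]_(x in D) h x = l].

Lemma has_int_onD D h g l k : has_int_on D h l -> has_int_on D g k ->
  has_int_on D (fun x => h x + g x) (l + k).
Proof. by move=> [mD Ih <-] [_ Ig <-]; split => //; [exact: L1D|rewrite RintegralD]. Qed.

Lemma has_int_onZ D h l c : has_int_on D h l -> has_int_on D (fun x => c * h x) (c * l).
Proof. by move=> [mD Ih <-]; split => //; [exact: L1Z|rewrite RintegralZl]. Qed.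

Lemma has_int_on_le D h g l k : has_int_on D h l -> has_int_on D g k ->
  (forall x, D x -> h x <= g x) -> l <= k.
Proof. by move=> [mD Ih <-] [_ Ig <-] hg; apply: le_Rintegral. Qed.

Lemma has_int_on_eq D h g l k : has_int_on D h l -> has_int_on D g k ->
  (forall x, D x -> h x = g x) -> l = k.
Proof.
move=> ih ig hg; apply/eqP; rewrite eq_le; apply/andP; split.
  by apply: (has_int_on_le ih ig) => x Dx; rewrite hg.
by apply: (has_int_on_le ig ih) => x Dx; rewrite hg.
Qed.

Lemma has_int_rays h l z : has_int h l -> exists lm lp, [/\ l = lm + lp,
  has_int_on `]-oo, z] h lm & has_int_on `[z, +oo[ h lp].
Proof.
move=> [Ih <-]; exists (\int[mu]_(x in `]-oo, z]) h x), (\int[mu]_(x in `[z, +oo[) h x).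
split; first exact: IntT_split.
- by split => //; exact: L1S Ih.
- by split => //; exact: L1S Ih.
Qed.

Lemma H1_has_int_rays f f' g g' z : H1 f f' -> H1 g g' ->
  has_int_on `]-oo, z] (fun x => f' x * g x + f x * g' x) (f z * g z) /\
  has_int_on `[z, +oo[ (fun x => f' x * g x + f x * g' x) (- (f z * g z)).
Proof.
move=> hf hg; have [_ _ I] := H1_L1M hf hg.
split; split => //; try exact: L1S I.
- exact: H1_rayNy.
- exact: H1_rayy.
Qed.

Lemma quartic_has_int f f' g g' : H1 f f' -> H1 g g' ->
  L2 (fun x => f x * g' x) -> L2 (fun x => f' x * g x) -> L2 (fun x => f' x * g' x) ->
  has_int (fun x => 3 * (f x * g x * (f x * g x)) + f x * g' x * (f x * g' x)
    + f' x * g x * (f' x * g x) + 4 * (f x * g x * (f' x * g' x))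
    + (-1) * (f' x * g' x * (f' x * g' x))) (quartic f f' g g').
Proof.
move=> hf hg l2 l3 l4; have l1 := H1_L2 (H1M hf hg).
have := has_intD (has_intD (has_intD (has_intD (has_intZ 3 (has_int_ip l1 l1))
  (has_int_ip l2 l2)) (has_int_ip l3 l3)) (has_intZ 4 (has_int_ip l1 l4)))
  (has_intZ (-1) (has_int_ip l4 l4)).
by rewrite /quartic mulN1r.
Qed.

(* With P = (p - s p')(q - s q') and h = 3 p q - s (p q' + p' q) - p' q', P h
   is the density of [quartic] up to a derivative, and h <= 4 p q. *)
Lemma quartic_density_bound (p p' q q' M s : R) : s = 1 \/ s = -1 ->
  `|p'| <= p -> `|q'| <= q -> p * q <= M ->
  3 * (p * q * (p * q)) + p * q' * (p * q') + p' * q * (p' * q)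
    + 4 * (p * q * (p' * q')) + (-1) * (p' * q' * (p' * q')) <=
  4 * M * (p * q + p' * q') + (- (4 * M) * s * (p' * q + p * q')
   + 2 * s * ((p' * q + p * q') * (p * q) + p * q * (p' * q + p * q'))).
Proof.
move=> s1; rewrite !ler_norml => /andP[p1 p2] /andP[q1 q2] pqM.
have f1 : 0 <= p - s * p' by case: s1 => ->; lra.
have f2 : 0 <= p + s * p' by case: s1 => ->; lra.
have g1 : 0 <= q - s * q' by case: s1 => ->; lra.
have g2 : 0 <= q + s * q' by case: s1 => ->; lra.
have P0 : 0 <= (p - s * p') * (q - s * q') by rewrite mulr_ge0.
have N0 : 0 <= (p + s * p') * (q + s * q') by rewrite mulr_ge0.
(* 4 p q - h = (p + s p')(q + s q'), so the difference of the two sides is four times the quantity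
   in [A1] plus the one in [A2]. *)
have A1 : 0 <= (M - p * q) * ((p - s * p') * (q - s * q')).
  by rewrite mulr_ge0// subr_ge0.
have A2 : 0 <= ((p + s * p') * (q + s * q')) * ((p - s * p') * (q - s * q')).
  by rewrite mulr_ge0.
rewrite -subr_ge0; case: s1 A1 A2 => -> A1 A2; clear -A1 A2; lra.
Qed.

(** With s = 1 to the left of [z] and s = -1 to the right, the exact derivatives contribute -4 M^2 +
    2 M^2 on each ray. These are the signs for which (f - s f')(g - s g') vanishes on peakons
    centred at [z], so that equality holds for them. *)
Lemma quartic_max_inequality f f' g g' z : H1 f f' -> H1 g g' ->
  (forall x, `|f' x| <= f x) -> (forall x, `|g' x| <= g x) ->
  is_max_point (fun x => f x * g x) z ->
  4 * (f z * g z) ^+ 2 - 4 * (f z * g z) * (ip f g + ip f' g') + quartic f f' g g' <= 0.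
Proof.
move=> hf hg ff gg zmax; set M := f z * g z.
have [Bf Bf0 HBf] := H1_bounded hf; have [Bg Bg0 HBg] := H1_bounded hg.
have lf := H1_L2 hf; have lf' := H1_L2' hf; have lg := H1_L2 hg; have lg' := H1_L2' hg.
have HBg' x : `|g' x| <= Bg.
  by apply: (le_trans (gg x)); apply: le_trans (HBg x); exact: ler_norm.
have l2 : L2 (fun x => f x * g' x).
  by apply: L2M_bounded HBg' lf; exact: L2_measurable.
have l3 : L2 (fun x => f' x * g x).
  by apply: L2M_bounded HBg lf'; exact: L2_measurable.
have l4 : L2 (fun x => f' x * g' x).
  by apply: L2M_bounded HBg' lf'; exact: L2_measurable.
have iq := quartic_has_int hf hg l2 l3 l4.
have i0 := has_intD (has_int_ip lf lg) (has_int_ip lf' lg').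
have hk := H1M hf hg.
have [qm [qp [-> Qm Qp]]] := has_int_rays z iq.
have [em [ep [-> Em Ep]]] := has_int_rays z i0.
have [Km Kp] := H1_has_int_rays z hf hg.
have [KKm KKp] := H1_has_int_rays z hk hk.
have key (s x : R) : s = 1 \/ s = -1 -> _ :=
  fun s1 => quartic_density_bound s1 (ff x) (gg x) (zmax x).
have Lm : qm <= 4 * M * em + (- (4 * M) * 1 * M + 2 * 1 * (M * M)).
  apply: (has_int_on_le Qm (has_int_onD (has_int_onZ (4 * M) Em)
    (has_int_onD (has_int_onZ (- (4 * M) * 1) Km) (has_int_onZ (2 * 1) KKm)))) => x _.
  by apply: key; left.
have Lp : qp <= 4 * M * ep + (- (4 * M) * -1 * - M + 2 * -1 * - (M * M)).
  apply: (has_int_on_le Qp (has_int_onD (has_int_onZ (4 * M) Ep)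
    (has_int_onD (has_int_onZ (- (4 * M) * -1) Kp) (has_int_onZ (2 * -1) KKp)))) => x _.
  by apply: key; right.
move: Lm Lp; rewrite expr2; lra.
Qed.

End Ray_integrals.

(** * Peakons and the stability estimate *)

Section Peakons.
Context {R : realType}.
Implicit Types (f g h k : R -> R) (a b c x z C : R).

Local Notation mu := (@lebesgue_measure R).

Definition glue z f g x : R := if x <= z then f x else g x.

Lemma L1_glue (D : set R) z f g : measurable D -> L1 D f -> L1 D g -> L1 D (glue z f g).
Proof.
move=> mD If Ig.
have -> : glue z f g = (fun x => f x * \1_(`]-oo, z]%classic) x + g x * \1_(`]z, +oo[%classic) x).
  apply/funext => x; rewrite /glue !indicE; have [xz|zx] := leP x z.
    rewrite mem_set; last by rewrite /= in_itv.
    rewrite memNset; first by rewrite mulr1 mulr0 addr0.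
    by rewrite /= in_itv/= andbT => /(le_lt_trans xz); rewrite ltxx.
  rewrite memNset; last by rewrite /= in_itv/= => /(lt_le_trans zx); rewrite ltxx.
  rewrite mem_set; first by rewrite mulr1 mulr0 add0r.
  by rewrite /= in_itv/= andbT.
have b01 (A : set R) x : `|\1_A x| <= 1 :> R.
  by rewrite indicE; case: (_ \in _); rewrite ?normr1 ?normr0.
by apply: L1D => //; apply: (@L1M_bounded _ _ _ _ 1) => //; exact: measurable_indic.
Qed.

Lemma ae_neq z : {ae mu, forall x, x != z}.
Proof.
exists [set z]; split => //; first exact: lebesgue_measure_set1.
by move=> x /= /negP; rewrite negbK => /eqP.
Qed.

Lemma AC_glue z f f' g g' : AC f f' -> AC g g' -> f z = g z ->
  AC (glue z f g) (glue z f' g').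
Proof.
move=> [If hf] [Ig hg] fgz.
have I a b : L1 `[a, b] (glue z f' g') by exact: L1_glue.
split => // a b ab.
have left p q : p <= q -> q <= z -> \int[mu]_(x in `[p, q]) glue z f' g' x = f q - f p.
  move=> pq qz; rewrite hf//; apply: eq_Rintegral => x.
  by rewrite inE /= in_itv/= => /andP[_ xq]; rewrite /glue (le_trans xq qz).
have right p q : p <= q -> z <= p -> \int[mu]_(x in `[p, q]) glue z f' g' x = g q - g p.
  move=> pq zp; rewrite hg//; apply: Int_ae => //.
  - exact: L1_measurable (I p q).
  - exact: L1_measurable (Ig p q).
  - apply: (ae_imp (ae_neq z)) => x xz; rewrite /= in_itv/= => /andP[px _].
    by rewrite /glue leNgt lt_neqAle eq_sym xz (le_trans zp px).
have E x : glue z f g x = if x < z then f x else g x.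
  by rewrite /glue; case: ltgtP => // ->.
have [bz|zb] := leP b z.
  by rewrite left// /glue bz (le_trans ab bz).
have [za|az] := leP z a.
  by rewrite right// !E !ltNge za (ltW zb).
rewrite (Int_itv_split (ltW az) (ltW zb) (I a b)) (left a z (ltW az) (lexx z)).
rewrite (right z b (ltW zb) (lexx z)).
rewrite /glue (ltW az) leNgt zb/= fgz; ring.
Qed.

(** By monotone convergence over [-n, n], where the integral is h(n) - h(-n) <= 2 C. An explicit
    bounded primitive thus makes peakons square integrable. *)
Lemma L1_bounded_primitive h k C : AC h k -> (forall x, 0 <= k x) ->
  (forall x, `|h x| <= C) -> measurable_fun [set: R] k -> L1 setT k.
Proof.
move=> [Ik hk] k0 hC mk; apply/integrableP; split; first exact/measurable_EFinP.
have -> : (\int[mu]_x `|(EFin \o k) x|)%E = (\int[mu]_x (k x)%:E)%E.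
  by apply: eq_integral => x _ /=; rewrite ger0_norm.
pose F (n : nat) : set R := `[- n%:R, n%:R]%classic.
have FT : \bigcup_n F n = [set: R].
  apply/seteqP; split => // x _; exists (Num.bound `|x|) => //.
  rewrite /F /= in_itv/= -ler_norml; apply: ltW.
  exact: archi_boundP.
have Fnd : {homo F : n m / (n <= m)%N >-> (n <= m)%O}.
  move=> n m nm; apply/subsetPset; apply: subset_itv; rewrite bnd_simp ?lerN2 ler_nat//.
have mF n : measurable (F n) by exact: measurable_itv.
have mkF n : measurable_fun (F n) (fun x => (k x)%:E).
  by apply/measurable_EFinP; exact: measurable_funTS.
have k0F n x : F n x -> (0 <= (k x)%:E)%E by rewrite lee_fin.
have lim : (\int[mu]_(x in F n) (k x)%:E)%E @[n --> \oo] -->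
    (\int[mu]_(x in \bigcup_n F n) (k x)%:E)%E.
  by apply: ge0_nondecreasing_set_cvg_integral.
rewrite FT in lim.
apply: (@le_lt_trans _ _ (2 * C)%:E); last exact: ltry.
rewrite -(cvg_lim _ lim)//; apply: lime_le.
  by apply/cvg_ex; eexists; exact: lim.
near=> n.
have n0 : - n%:R <= n%:R :> R by rewrite ge0_cp.
have -> : (\int[mu]_(x in F n) (k x)%:E)%E = (h n%:R - h (- n%:R))%:E.
  by rewrite hk// /Rintegral fineK//; apply: integrable_fin_num => //; exact: Ik.
rewrite lee_fin; have := hC n%:R; have := hC (- n%:R).
by rewrite !ler_norml => /andP[? ?] /andP[? ?]; lra.
Unshelve. all: by end_near.
Qed.

Definition pk a z x : R := peakon a (x - z).
(** The factors 1 and -1 follow [AC_exp]. At the crest the left derivative is taken, so formulas for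
    the right ray hold only off [z]. *)
Definition pk' a z : R -> R :=
  glue z (fun x => 1 * (a * expR (1 * (x - z)))) (fun x => -1 * (a * expR (-1 * (x - z)))).

Lemma pkE a z : pk a z = glue z (fun x => a * expR (1 * (x - z))) (fun x => a * expR (-1 * (x - z))).
Proof.
apply/funext => x; rewrite /pk /peakon /glue; case: leP => xz.
  by rewrite ler0_norm ?subr_le0// opprK mul1r.
by rewrite gtr0_norm ?subr_gt0// mulN1r.
Qed.

Lemma pk'E a z x : pk' a z x = if x <= z then pk a z x else - pk a z x.
Proof. by rewrite pkE /pk' /glue; case: leP => _; ring. Qed.

Lemma pk_z a z : pk a z z = a.
Proof. by rewrite /pk /peakon subrr normr0 oppr0 expR0 mulr1. Qed.

Lemma pk_bound a z x : 0 <= a -> 0 <= pk a z x <= a.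
Proof.
move=> a0; rewrite /pk /peakon mulr_ge0 ?expR_ge0//= ler_piMr//.
Qed.

Lemma pk'_bound a z x : 0 <= a -> `|pk' a z x| <= a.
Proof.
move=> a0; have /andP[h1 h2] := pk_bound z x a0.
by rewrite pk'E; case: ifP => _; rewrite ?normrN ger0_norm.
Qed.

Lemma AC_pk a z : AC (pk a z) (pk' a z).
Proof.
rewrite pkE; apply: AC_glue; [exact: AC_exp|exact: AC_exp|].
by rewrite subrr !mulr0.
Qed.

Lemma measurable_pk a z : measurable_fun [set: R] (pk a z).
Proof. by apply: continuous_mfun => //; exact: AC_continuous (AC_pk a z). Qed.

Lemma measurable_pk' a z : measurable_fun [set: R] (pk' a z).
Proof.
have -> : pk' a z = (fun x => pk a z x * (2 * \1_(`]-oo, z]%classic) x - 1)).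
  apply/funext => x; rewrite pk'E indicE; case: leP => xz.
    have -> : x \in `]-oo, z]%classic by rewrite mem_set//= in_itv.
    by rewrite /=; ring.
  have -> : (x \in `]-oo, z]%classic) = false.
    by rewrite memNset//= in_itv/= => /(lt_le_trans xz); rewrite ltxx.
  by rewrite /=; ring.
apply: measurable_funM; first exact: measurable_pk.
by apply: measurable_funB => //; apply: measurable_funM => //; exact: measurable_indic.
Qed.

Lemma L2_pk a z : 0 <= a -> L2 (pk a z).
Proof.
move=> a0; split; first exact: measurable_pk.
have acsq := ACM (AC_pk a z) (AC_pk a z).
(* The primitive of 2 pk^2 is pk^2 on the left and 2 a^2 - pk^2 on the right of z. *)
have acN : AC (fun x => 2 * a ^+ 2 + (-1) * (pk a z x * pk a z x))
   (fun x => 0 + (-1) * (pk' a z x * pk a z x + pk a z x * pk' a z x)).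
  by apply: ACD; [exact: AC_cst|exact: ACZ].
have ac := @AC_glue z _ _ _ _ acsq acN _.
have {ac}ac := ACZ 2^-1 (ac _).
have mk : measurable_fun [set: R] (fun x => pk a z x ^+ 2).
  by apply: measurable_funX; exact: measurable_pk.
apply: (@L1_bounded_primitive _ _ (a ^+ 2) _ _ _ mk).
- have <- : (fun x => 2^-1 * glue z (fun x => pk' a z x * pk a z x + pk a z x * pk' a z x)
     (fun x => 0 + (-1) * (pk' a z x * pk a z x + pk a z x * pk' a z x)) x) =
    (fun x => pk a z x ^+ 2).
    by apply/funext => x; rewrite /glue pk'E; case: leP => _; field.
  by apply: ac; rewrite !pk_z; ring.
- by move=> x; rewrite sqr_ge0.
- move=> x; have /andP[h1 h2] := pk_bound z x a0.
  have h3 : pk a z x * pk a z x <= a ^+ 2 by rewrite expr2 ler_pM.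
  have h4 : 0 <= pk a z x * pk a z x by rewrite mulr_ge0.
  rewrite ler_norml /glue; case: (leP x z) => _; apply/andP; split; lra.
Qed.

Lemma H1_pk a z : 0 <= a -> H1 (pk a z) (pk' a z).
Proof.
move=> a0; split; [exact: AC_pk|exact: L2_pk|].
apply: (@L2_bound _ (pk a z) _ 1); [exact: measurable_pk'|exact: L2_pk|].
by move=> x; rewrite pk'E mul1r; case: ifP => _; rewrite ?normrN.
Qed.

(* f pk + f' pk' is the derivative of f pk before z and of - f pk after z. *)
Lemma ip_pk f f' a z : 0 <= a -> H1 f f' ->
  ip f (pk a z) + ip f' (pk' a z) = 2 * a * f z.
Proof.
move=> a0 hf; have hp := H1_pk z a0.
have i := has_intD (has_int_ip (H1_L2 hf) (H1_L2 hp)) (has_int_ip (H1_L2' hf) (H1_L2' hp)).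
have [lm [lp [-> Im Ip]]] := has_int_rays z i.
have [Hm Hp] := H1_has_int_rays z hf hp.
rewrite pk_z in Hm Hp.
have -> : lm = f z * a.
  apply: (has_int_on_eq Im Hm) => x; rewrite /= in_itv/= => xz.
  by rewrite pk'E xz; ring.
have [_ _ Jp] := has_int_onZ (-1) Hp.
have [_ _ Ep] := Ip.
have -> : lp = -1 * - (f z * a); last ring.
rewrite -Ep -Jp; apply: Int_ae => //.
- by case: Ip => _ I _; exact: L1_measurable I.
- by case: (has_int_onZ (-1) Hp) => _ I _; exact: L1_measurable I.
- apply: (ae_imp (ae_neq z)) => x xz; rewrite /= in_itv/= andbT => zx.
  by rewrite pk'E leNgt lt_neqAle eq_sym xz zx/=; ring.
Qed.

(** As |pk'| = pk, the density is 8 k^2, where k is the product of the two peakons; this is 2 (k^2)'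
    before [z] and -2 (k^2)' after it, and each ray contributes 2 a^2 b^2. *)
Lemma quartic_pk a b z : 0 <= a -> 0 <= b ->
  quartic (pk a z) (pk' a z) (pk b z) (pk' b z) = 4 * a ^+ 2 * b ^+ 2.
Proof.
move=> a0 b0; have ha := H1_pk z a0; have hb := H1_pk z b0.
have mb := L2_measurable (H1_L2 hb); have mb' := L2_measurable (H1_L2' hb).
have Bb x : `|pk b z x| <= b.
  by have /andP[h1 h2] := pk_bound z x b0; rewrite ger0_norm.
have Bb' x := pk'_bound z x b0.
have l2 := L2M_bounded mb' Bb' (H1_L2 ha).
have l3 := L2M_bounded mb Bb (H1_L2' ha).
have l4 := L2M_bounded mb' Bb' (H1_L2' ha).
have i := quartic_has_int ha hb l2 l3 l4.
have [lm [lp [-> Im Ip]]] := has_int_rays z i.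
have hk := H1M ha hb.
have [Hm Hp] := H1_has_int_rays z hk hk.
rewrite !pk_z in Hm Hp.
have -> : lm = 2 * (a * b * (a * b)).
  apply: (has_int_on_eq Im (has_int_onZ 2 Hm)) => x; rewrite /= in_itv/= => xz.
  by rewrite !pk'E xz; ring.
have Jp := has_int_onZ (-2) Hp.
have -> : lp = -2 * - (a * b * (a * b)); last ring.
have [_ I1 <-] := Ip; have [_ I2 <-] := Jp.
apply: Int_ae => //; [exact: L1_measurable I1|exact: L1_measurable I2|].
apply: (ae_imp (ae_neq z)) => x xz; rewrite /= in_itv/= andbT => zx.
by rewrite !pk'E leNgt lt_neqAle eq_sym xz zx/=; ring.
Qed.

End Peakons.

(** * Distances in H^1 and continuity of the quartic functional *)

Section H1_distance.
Context {R : realType}.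
Implicit Types (f g : R -> R) (a b c x z B : R).

Local Notation mu := (@lebesgue_measure R).

(** [H1_norm] with the derivative as an argument instead of the choice [wderiv]; [H1_normE] relates
    the two. *)
Definition h1 f f' : R := Num.sqrt (ip f f + ip f' f').

Lemma h1_ge0 f f' : 0 <= h1 f f'.
Proof. exact: sqrtr_ge0. Qed.

Lemma sqr_h1 f f' : h1 f f' ^+ 2 = ip f f + ip f' f'.
Proof. by rewrite sqr_sqrtr// addr_ge0 ?ip_ge0. Qed.

Lemma nrm_le_h1 f f' : nrm f <= h1 f f' /\ nrm f' <= h1 f f'.
Proof. by split; rewrite ler_wsqrtr// ?lerDl ?lerDr ip_ge0. Qed.

(** The Cauchy-Schwarz inequality in L^2 followed by the one in the plane. It bounds the cross
    energy, which need not be conserved, by conserved norms. *)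
Lemma h1_cs f f' g g' : L2 f -> L2 f' -> L2 g -> L2 g' ->
  ip f g + ip f' g' <= h1 f f' * h1 g g'.
Proof.
move=> lf lf' lg lg'.
have c1 := le_trans (ler_norm _) (cauchy_schwarz lf lg).
have c2 := le_trans (ler_norm _) (cauchy_schwarz lf' lg').
apply: (le_trans (lerD c1 c2)).
rewrite -ler_sqr ?nnegrE ?addr_ge0 ?mulr_ge0 ?nrm_ge0 ?h1_ge0//.
rewrite exprMn !sqr_h1 -!sqr_nrm.
have := sqr_ge0 (nrm f * nrm g' - nrm f' * nrm g).
move: (nrm f) (nrm f') (nrm g) (nrm g') => p p' q q' h; rewrite -subr_ge0.
suff -> : (p ^+ 2 + p' ^+ 2) * (q ^+ 2 + q' ^+ 2) - (p * q + p' * q') ^+ 2 =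
  (p * q' - p' * q) ^+ 2 by []. 
ring.
Qed.

Lemma h1D f f' g g' : L2 f -> L2 f' -> L2 g -> L2 g' ->
  h1 (fun x => f x + g x) (fun x => f' x + g' x) <= h1 f f' + h1 g g'.
Proof.
move=> lf lf' lg lg'.
rewrite -ler_sqr ?nnegrE ?addr_ge0 ?h1_ge0// sqr_h1 sqrrD !sqr_h1.
have lD := L2D lf lg; have lD' := L2D lf' lg'.
rewrite !ipDl// !ipDr// (ipC g f) (ipC g' f').
have := h1_cs lf lf' lg lg'; rewrite mulr2n; lra.
Qed.

Lemma h1N f f' : L2 f -> L2 f' -> h1 (fun x => - f x) (fun x => - f' x) = h1 f f'.
Proof.
by move=> lf lf'; rewrite /h1 -!sqr_nrm !nrmN.
Qed.

Lemma h1_dist f f' g g' : L2 f -> L2 f' -> L2 g -> L2 g' ->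
  `|h1 f f' - h1 g g'| <= h1 (fun x => f x - g x) (fun x => f' x - g' x).
Proof.
move=> lf lf' lg lg'.
have e1 := h1D (L2B lf lg) (L2B lf' lg') lg lg'.
have e2 := h1D (L2N (L2B lf lg)) (L2N (L2B lf' lg')) lf lf'.
rewrite h1N in e2; [|exact: L2B|exact: L2B].
have E1 : h1 (fun x => f x - g x + g x) (fun x => f' x - g' x + g' x) = h1 f f'.
  by congr h1; apply/funext => x; rewrite subrK.
have E2 : h1 (fun x => - (f x - g x) + f x) (fun x => - (f' x - g' x) + f' x) = h1 g g'.
  by congr h1; apply/funext => x; ring.
by rewrite E1 in e1; rewrite E2 in e2; rewrite ler_norml; apply/andP; split; lra.
Qed.

Lemma H1_normE f f' g : H1 f f' -> measurable_fun [set: R] g ->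
  {ae mu, forall x, f x = g x} -> H1_norm g = h1 f f'.
Proof.
move=> hf mg fg; have w := H1_weak_derivative hf.
have dg := wderiv_eq_ae w mg fg.
have wg : is_weak_derivative g f'.
  apply: (weak_derivative_ae w) => //; last exact: ae_all.
  by apply: L2_measurable; exact: H1_L2' hf.
have [_ md] := weak_measurable (wderivP wg).
have [_ lf lf'] := hf.
have lg : L2 g by apply: (L2_ae mg lf); apply: (ae_imp fg) => x ->.
have ld : L2 (wderiv g) by exact: (L2_ae md lf').
rewrite /H1_norm /h1; congr Num.sqrt.
transitivity (ip g g + ip (wderiv g) (wderiv g)).
  rewrite /ip -RintegralD; [|exact: measurableT|exact: L2_L1M|exact: L2_L1M].
  by apply: eq_Rintegral => x _; rewrite !expr2.
have fg' : {ae mu, forall x, g x = f x} by apply: (ae_imp fg) => x ->.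
by congr (_ + _); apply: ip_ae => //; exact: L2_measurable.
Qed.

Lemma H1_dist_pk f f' a z : 0 <= a -> H1 f f' ->
  h1 (fun x => f x - pk a z x) (fun x => f' x - pk' a z x) ^+ 2 =
  h1 f f' ^+ 2 + 2 * a ^+ 2 - 4 * a * f z.
Proof.
move=> a0 hf; have hp := H1_pk z a0.
have [_ lf lf'] := hf; have [_ lp lp'] := hp.
have e1 := ip_pk z a0 hf; have e2 := ip_pk z a0 hp; rewrite pk_z in e2.
have l := L2B lf lp; have l' := L2B lf' lp'.
rewrite !sqr_h1 !ipBl// !ipBr// (ipC (pk a z) f) (ipC (pk' a z) f').
move: e1 e2; rewrite expr2; lra.
Qed.

Lemma ip_diff f g h k B d : L2 f -> L2 g -> L2 h -> L2 k -> 0 <= B -> 0 <= d ->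
  nrm (fun x => f x - h x) <= d -> nrm (fun x => g x - k x) <= d ->
  nrm g <= B -> nrm h <= B ->
  `|ip f g - ip h k| <= 2 * B * d.
Proof.
move=> lf lg lh lk B0 d0 fh gk gB hB.
have -> : ip f g - ip h k = ip (fun x => f x - h x) g + ip h (fun x => g x - k x).
  by rewrite ipBl// ipBr//; ring.
have c1 := cauchy_schwarz (L2B lf lh) lg; have c2 := cauchy_schwarz lh (L2B lg lk).
have m1 : nrm (fun x => f x - h x) * nrm g <= d * B by rewrite ler_pM ?nrm_ge0.
have m2 : nrm h * nrm (fun x => g x - k x) <= B * d by rewrite ler_pM ?nrm_ge0.
by apply: (le_trans (ler_normD _ _)); lra.
Qed.

Lemma nrm_product_diff f g h k B d : L2 f -> L2 g -> L2 h -> L2 k -> 0 <= B ->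
  (forall x, `|g x| <= B) -> (forall x, `|h x| <= B) -> (forall x, `|k x| <= B) ->
  nrm (fun x => f x - h x) <= d -> nrm (fun x => g x - k x) <= d ->
  nrm f <= B -> nrm h <= B ->
  [/\ L2 (fun x => f x * g x), L2 (fun x => h x * k x),
   nrm (fun x => f x * g x - h x * k x) <= 2 * B * d,
   nrm (fun x => f x * g x) <= B ^+ 2 & nrm (fun x => h x * k x) <= B ^+ 2].
Proof.
move=> lf lg lh lk B0 gB hB kB fh gk fn hn.
have mg := L2_measurable lg; have mh := L2_measurable lh; have mk := L2_measurable lk.
have lfg := L2M_bounded mg gB lf; have lhk := L2M_bounded mk kB lh.
have prod (p q : R -> R) : L2 p -> L2 q -> (forall x, `|q x| <= B) ->
    nrm (fun x => p x * q x) <= B * nrm p.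
  move=> lp lq qB; apply: nrm_le => //.
    by apply: measurable_funM; exact: L2_measurable.
  by move=> x; rewrite normrM mulrC ler_wpM2r.
split => //.
- have -> : (fun x => f x * g x - h x * k x) =
    (fun x => (f x - h x) * g x + (g x - k x) * h x) by apply/funext => x; ring.
  have l1 := L2M_bounded mg gB (L2B lf lh); have l2 := L2M_bounded mh hB (L2B lg lk).
  apply: (le_trans (nrmD l1 l2)).
  have p1 := prod _ _ (L2B lf lh) lg gB; have p2 := prod _ _ (L2B lg lk) lh hB.
  have q1 := ler_wpM2l B0 fh; have q2 := ler_wpM2l B0 gk; lra.
- apply: (le_trans (prod _ _ lf lg gB)); rewrite expr2 ler_wpM2l//.
- by apply: (le_trans (prod _ _ lh lk kB)); rewrite expr2 ler_wpM2l.
Qed.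

(** Each product of two factors moves by at most 2 B d in L^2 and has norm at most B^2, so each
    inner product moves by at most 4 B^3 d; the coefficients 3, 1, 1, 4, 1 add up to 10. *)
Lemma quartic_diff f f' g g' h h' k k' B d : L2 f -> L2 f' -> L2 g -> L2 g' ->
  L2 h -> L2 h' -> L2 k -> L2 k' -> 0 <= B -> 0 <= d ->
  (forall x, [/\ `|g x| <= B, `|g' x| <= B, `|h x| <= B & `|h' x| <= B]) ->
  (forall x, `|k x| <= B /\ `|k' x| <= B) ->
  nrm (fun x => f x - h x) <= d -> nrm (fun x => f' x - h' x) <= d ->
  nrm (fun x => g x - k x) <= d -> nrm (fun x => g' x - k' x) <= d ->
  nrm f <= B -> nrm f' <= B -> nrm h <= B -> nrm h' <= B ->
  quartic h h' k k' - 40 * B ^+ 3 * d <= quartic f f' g g'.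
Proof.
move=> lf lf' lg lg' lh lh' lk lk' B0 d0 sup1 sup2 n1 n2 n3 n4 b1 b2 b3 b4.
have gB x : `|g x| <= B by have [] := sup1 x.
have g'B x : `|g' x| <= B by have [] := sup1 x.
have hB x : `|h x| <= B by have [] := sup1 x.
have h'B x : `|h' x| <= B by have [] := sup1 x.
have kB x : `|k x| <= B by have [] := sup2 x.
have k'B x : `|k' x| <= B by have [] := sup2 x.
have [p1 q1 e1 u1 v1] := nrm_product_diff lf lg lh lk B0 gB hB kB n1 n3 b1 b3.
have [p2 q2 e2 u2 v2] := nrm_product_diff lf lg' lh lk' B0 g'B hB k'B n1 n4 b1 b3.
have [p3 q3 e3 u3 v3] := nrm_product_diff lf' lg lh' lk B0 gB h'B kB n2 n3 b2 b4.
have [p4 q4 e4 u4 v4] := nrm_product_diff lf' lg' lh' lk' B0 g'B h'B k'B n2 n4 b2 b4.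
have BB : 0 <= B ^+ 2 by rewrite sqr_ge0.
have dd : 0 <= 2 * B * d by rewrite !mulr_ge0.
have := ip_diff p1 p1 q1 q1 BB dd e1 e1 u1 v1.
have := ip_diff p2 p2 q2 q2 BB dd e2 e2 u2 v2.
have := ip_diff p3 p3 q3 q3 BB dd e3 e3 u3 v3.
have := ip_diff p1 p4 q1 q4 BB dd e1 e4 u4 v1.
have := ip_diff p4 p4 q4 q4 BB dd e4 e4 u4 v4.
have -> : 2 * B ^+ 2 * (2 * B * d) = 4 * B ^+ 3 * d by ring.
rewrite /quartic !ler_norml => /andP[a1 a2] /andP[a3 a4] /andP[a5 a6] /andP[a7 a8] /andP[a9 a10].
move: a1 a2 a3 a4 a5 a6 a7 a8 a9 a10; clear; move=> *; lra.
Qed.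

End H1_distance.

(** * From the quadratic inequality to the amplitudes *)

Section Amplitude.
Context {R : realType}.
Implicit Types (a b c s t d : R).

Local Notation mu := (@lebesgue_measure R).

(** Twice this number is at least 2 a + 1 and 2 b + 1, so for positive a and b it bounds the H^1
    norms of the peakons and of data at distance at most 1 from them. *)
Definition stability_scale a b : R := a + b + 1.

(* 320 S^3 is the constant 40 B^3 of [quartic_diff] for the bound B = 2 S. *)
Definition stability_gap a b : R :=
  let S := stability_scale a b in
  1 + 4 * S + 4 * a * (3 * S + (24 * S ^+ 3 + 320 * S ^+ 3 + 1)) / b.

(* From 4 M^2 - 4 M E0 + Q <= 0 with M = p q, the distance of 2 M to its value
   2 a b at the peakons is of the order of the square root of the defect r^2. *)
Lemma amplitude_gap (a b s r eu ev p q E0 Q : R) : 0 < a -> 0 < b ->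
  0 <= s -> s ^+ 2 = 2 -> 0 <= r -> r <= 1 ->
  `|eu - s * a| <= r ^+ 2 -> `|ev - s * b| <= r ^+ 2 ->
  0 <= eu -> 0 <= ev -> 0 <= p -> 0 <= q ->
  2 * p ^+ 2 <= eu ^+ 2 -> 2 * q ^+ 2 <= ev ^+ 2 -> E0 <= eu * ev ->
  4 * (p * q) ^+ 2 - 4 * (p * q) * E0 + Q <= 0 ->
  4 * a ^+ 2 * b ^+ 2 - 320 * stability_scale a b ^+ 3 * r ^+ 2 <= Q ->
  eu ^+ 2 + 2 * a ^+ 2 - 4 * a * p <= stability_gap a b * r.
Proof.
move=> a0 b0 s0 ss r0 r1 hu hv eu0 ev0 p0 q0 hp hq hE hM hQ.
rewrite /stability_gap; have [S eS] : exists S, S = stability_scale a b by eexists.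
rewrite -eS in hQ *; rewrite /stability_scale in eS.
have s1 : 1 <= s by rewrite -ler_sqr ?nnegrE// ss expr1n; lra.
have s2 : s <= 2 by rewrite -ler_sqr ?nnegrE// ss; lra.
(* In the application [r] is sqrt delta and [D] is delta. *)
have [D eD] : exists D, D = r ^+ 2 by eexists.
rewrite -eD in hu hv hQ; move: hp hq hE hM hQ.
have D0 : 0 <= D by rewrite eD sqr_ge0.
have Dr : D <= r by rewrite eD expr2 ler_piMr.
have S1 : 1 <= S by lra.
have aS : a <= S by lra.
have bS : b <= S by lra.
have aS1 : 2 * a + 1 <= 2 * S by lra.
have bS1 : 2 * b + 1 <= 2 * S by lra.
have sa : 0 <= s * a <= 2 * a by rewrite mulr_ge0 ?(ltW a0)//= ler_wpM2r// ltW.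
have sb : 0 <= s * b <= 2 * b by rewrite mulr_ge0 ?(ltW b0)//= ler_wpM2r// ltW.
move: hu hv; rewrite !ler_norml => /andP[hu1 hu2] /andP[hv1 hv2].
case/andP: sa => sa1 sa2; case/andP: sb => sb1 sb2.
have euS : eu <= 2 * S by lra.
have evS : ev <= 2 * S by lra.
pose X := eu * ev.
have X0 : 0 <= X by rewrite mulr_ge0.
have X4 : X <= 4 * S ^+ 2.
  by have := ler_pM eu0 ev0 euS evS; rewrite -/X expr2; lra.
have saX : (s * a) * (s * b) = 2 * (a * b) by rewrite mulrACA -expr2 ss.
have ab0 : 0 <= a * b by rewrite mulr_ge0 ?ltW.
have abS : a * b <= S ^+ 2 by rewrite expr2; apply: ler_pM => //; exact: ltW.
have dX : `|X - 2 * (a * b)| <= 4 * S * D.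
  have -> : X - 2 * (a * b) = (eu - s * a) * ev + (s * a) * (ev - s * b).
    by rewrite -saX /X; ring.
  apply: (le_trans (ler_normD _ _)); rewrite (normrM (eu - _)) (normrM (s * a)).
  have n1 : `|eu - s * a| <= D by rewrite ler_norml hu1.
  have n2 : `|ev - s * b| <= D by rewrite ler_norml hv1.
  have m1 : `|eu - s * a| * `|ev| <= D * (2 * S).
    by rewrite ler_pM// ger0_norm.
  have m2 : `|s * a| * `|ev - s * b| <= (2 * S) * D.
    by rewrite ler_pM// ger0_norm//; lra.
  lra.
move: dX; rewrite ler_norml => /andP[dX1 dX2].
pose M := p * q.
move=> hp hq hE hM hQ.
have M0 : 0 <= M by rewrite mulr_ge0.
(* As M >= 0, the cross energy may be replaced by its upper bound X, the product of the norms, which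
   is close to 2 a b. *)
have hM' : 4 * M ^+ 2 - 4 * M * X + Q <= 0.
  have := ler_wpM2l M0 hE; move: hM; rewrite -/M -/X; lra.
clear hM hE.
have S3 : 0 <= S ^+ 3 by rewrite exprn_ge0//; lra.
have X2 : X ^+ 2 - 4 * a ^+ 2 * b ^+ 2 <= 24 * S ^+ 3 * D.
  have -> : X ^+ 2 - 4 * a ^+ 2 * b ^+ 2 = (X - 2 * (a * b)) * (X + 2 * (a * b)) by ring.
  have Y0 : 0 <= X + 2 * (a * b) by lra.
  have Y1 : X + 2 * (a * b) <= 6 * S ^+ 2 by lra.
  have Z0 : 0 <= 4 * S * D by rewrite !mulr_ge0//; lra.
  have h1 := ler_wpM2r Y0 dX2; have h2 := ler_wpM2l Z0 Y1.
  apply: (le_trans h1); apply: (le_trans h2).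
  have -> : 4 * S * D * (6 * S ^+ 2) = 24 * S ^+ 3 * D by ring.
  exact: lexx.
(* (2 M - X)^2 <= X^2 - Q is at most (rho - 1) D. The added 1 ensures rho <= rho^2, so that |2 M -
   X| is at most rho r. *)
set rho := 24 * S ^+ 3 + 320 * S ^+ 3 + 1.
have rho1 : 1 <= rho by rewrite /rho; lra.
have sqM : (2 * M - X) ^+ 2 <= (rho * r) ^+ 2.
  have e1 : (2 * M - X) ^+ 2 = 4 * M ^+ 2 - 4 * M * X + X ^+ 2 by ring.
  have e2 : (2 * M - X) ^+ 2 <= (24 * S ^+ 3 + 320 * S ^+ 3) * D.
    rewrite e1 mulrDl; move: hM' hQ X2; lra.
  apply: (le_trans e2); rewrite exprMn -eD ler_wpM2r//.
  have e3 : rho <= rho ^+ 2 by rewrite expr2 ler_peMr//; lra.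
  by apply: le_trans e3; rewrite /rho; lra.
clear hM' hQ X2.
have rr0 : 0 <= rho * r by rewrite mulr_ge0//; lra.
have absM : `|2 * M - X| <= rho * r.
  rewrite -[leRHS]ger0_norm// -ler_sqr ?nnegrE ?normr_ge0//.
  by rewrite -!normrX !ger0_norm ?sqr_ge0.
move: absM; rewrite ler_norml => /andP[mM _].
have pS : p <= S.
  have : s * p <= s * S.
    apply: (@le_trans _ _ eu); last first.
      have h : s * a + 1 <= s * S.
        by rewrite eS !mulrDr mulr1; have := sb1; lra.
      lra.
    by rewrite -ler_sqr ?nnegrE ?mulr_ge0// exprMn ss.
  by rewrite ler_pM2l//; lra.
have qb : q <= b + D.
  have : s * q <= s * (b + D).
    apply: (@le_trans _ _ ev).
      by rewrite -ler_sqr ?nnegrE ?mulr_ge0// exprMn ss.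
    have h : D <= s * D by rewrite ler_peMl.
    by rewrite mulrDr; lra.
  by rewrite ler_pM2l//; lra.
have pq : M <= p * b + S * D.
  have h1 := ler_wpM2l p0 qb; have h2 := ler_wpM2r D0 pS.
  by rewrite /M; move: h1; rewrite mulrDr; lra.
have SD : S * D <= S * r by rewrite ler_wpM2l//; lra.
(* The 3 S collects 2 S from the deviation of X / 2 from a b and S from the excess of [q] over
   [b]. *)
have pb : a * b - (3 * S + rho) * r <= p * b.
  have := mulr_ge0 (le_trans ler01 rho1) r0.
  by rewrite mulrDl; move: mM dX1 pq SD; rewrite -!mulrA; lra.
have ap : a - p <= (3 * S + rho) * r / b.
  by rewrite ler_pdivlMr// mulrBl; lra.
have a40 : 0 <= 4 * a by lra.
have main := ler_wpM2l a40 ap.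
(* The left side of the goal equals (eu - s a)^2 + 2 s a eu - 4 a p, and s a eu exceeds 2 a^2 by at
   most 2 a D. *)
have su : (s * a) * eu <= (2 * a + 2 * D) * a.
  have h : s * eu <= 2 * a + 2 * D.
    have h1 : s * eu <= s * (s * a + D) by rewrite ler_wpM2l//; lra.
    have h2 : s * (s * a + D) = 2 * a + s * D by rewrite mulrDr mulrA -expr2 ss.
    have h3 : s * D <= 2 * D by rewrite ler_wpM2r.
    lra.
  have -> : s * a * eu = s * eu * a by ring.
  by rewrite ler_wpM2r// ltW.
have sq : (eu - s * a) ^+ 2 <= r.
  have h : (eu - s * a) ^+ 2 <= D ^+ 2.
    rewrite -[leLHS]ger0_norm ?sqr_ge0// normrX ler_pXn2r ?nnegrE//.
    by rewrite ler_norml hu1.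
  have D1 : D <= 1 by lra.
  apply: (le_trans h); apply: le_trans Dr; by rewrite expr2 ler_piMr.
have sq2 : (eu - s * a) ^+ 2 = eu ^+ 2 - 2 * (s * a * eu) + 2 * a ^+ 2.
  have -> : (eu - s * a) ^+ 2 = eu ^+ 2 - 2 * (s * a * eu) + s ^+ 2 * a ^+ 2 by ring.
  by rewrite ss.
rewrite sq2 in sq.
have aD : a * D <= S * r by apply: ler_pM => //; exact: ltW.
have -> : (1 + 4 * S + 4 * a * (3 * S + rho) / b) * r =
   r + 4 * (S * r) + 4 * a * ((3 * S + rho) * r / b) by ring.
move: main sq su aD; rewrite mulrDl mulrBr !expr2 -!mulrA; lra.
Qed.

End Amplitude.

(** * Transport of the initial closeness by the conservation laws *)

Section Stability_estimate.
Context {R : realType}.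
Implicit Types (a b c s t d Nu Nv z : R).

Local Notation mu := (@lebesgue_measure R).

(** The square roots serve for delta <= 1, the remaining terms for delta > 1. The absolute values
    keep the sum nonnegative for all real arguments. *)
Definition stability_constant (a b Nu Nv : R) : R :=
  Num.sqrt (stability_gap a b) + Num.sqrt (stability_gap b a)
  + 2 * `|Nu| + 2 * `|Nv| + 4 * `|a| + 4 * `|b|.

Lemma stability_constant_ge0 a b Nu Nv : 0 <= stability_constant a b Nu Nv.
Proof. by rewrite /stability_constant !addr_ge0 ?mulr_ge0 ?sqrtr_ge0. Qed.

Lemma sqrt2_bounds : 0 <= Num.sqrt (2 : R) <= 2.
Proof.
rewrite sqrtr_ge0/= -ler_sqr ?nnegrE ?sqrtr_ge0//.
by rewrite sqr_sqrtr//; lra.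
Qed.

Lemma h1_pkE a z : 0 <= a -> h1 (pk a z) (pk' a z) = Num.sqrt 2 * a.
Proof.
move=> a0; rewrite /h1 (ip_pk z a0 (H1_pk z a0)) pk_z -mulrA -expr2.
by rewrite sqrtrM// sqrtr_sqr ger0_norm.
Qed.

(* [f, g] at time 0 and [F, G] at a later time are related by the conservation
   laws and by the sign of the momentum densities only. *)
Lemma stability_estimate a b d Nu Nv z (f f' f'' g g' g'' F F' F'' G G' G'' : R -> R) :
  0 < a -> 0 < b -> 0 < d ->
  H1 f f' -> H1 f' f'' -> H1 g g' -> H1 g' g'' ->
  H1 F F' -> H1 F' F'' -> H1 G G' -> H1 G' G'' ->
  (forall x, 0 <= f x - f'' x) -> (forall x, 0 <= g x - g'' x) ->
  (forall x, 0 <= F x - F'' x) -> (forall x, 0 <= G x - G'' x) ->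
  h1 F F' = h1 f f' -> h1 G G' = h1 g g' ->
  quartic F F' G G' = quartic f f' g g' ->
  h1 f f' <= 2 * Nu -> h1 g g' <= 2 * Nv ->
  h1 (fun x => f x - pk a 0 x) (fun x => f' x - pk' a 0 x)
    + h1 (fun x => g x - pk b 0 x) (fun x => g' x - pk' b 0 x) < d ->
  is_max_point (fun x => F x * G x) z ->
  h1 (fun x => F x - pk a z x) (fun x => F' x - pk' a z x)
    + h1 (fun x => G x - pk b z x) (fun x => G' x - pk' b z x)
    <= stability_constant a b Nu Nv * d `^ (1 / 4).
Proof.
move=> a0 b0 d0 hf hf' hg hg' hF hF' hG hG' mf mg mF mG eF eG eQ fN gN close zmax.
have a0' := ltW a0; have b0' := ltW b0.
set t := d `^ (1 / 4).
have t0 : 0 < t by rewrite powR_gt0.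
have t4 : t ^+ 4 = d.
  rewrite -powR_mulrn ?ltW// /t -powRrM.
  have -> : 1 / 4 * 4%:R = 1 :> R by field.
  by rewrite powRr1// ltW.
have [_ lf lf'] := hf; have [_ lg lg'] := hg.
have [_ lF lF'] := hF; have [_ lG lG'] := hG.
have hpa z' := H1_pk z' a0'; have hpb z' := H1_pk z' b0'.
have lpa z' := H1_L2 (hpa z'); have lpa' z' := H1_L2' (hpa z').
have lpb z' := H1_L2 (hpb z'); have lpb' z' := H1_L2' (hpb z').
have [d1 d2] : h1 (fun x => f x - pk a 0 x) (fun x => f' x - pk' a 0 x) <= d /\
    h1 (fun x => g x - pk b 0 x) (fun x => g' x - pk' b 0 x) <= d.
  have := h1_ge0 (fun x => f x - pk a 0 x) (fun x => f' x - pk' a 0 x).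
  have := h1_ge0 (fun x => g x - pk b 0 x) (fun x => g' x - pk' b 0 x).
  by move: close; move: (h1 _ _) (h1 _ _); clear; split; lra.
have eu := h1_dist lf lf' (lpa 0) (lpa' 0); have ev := h1_dist lg lg' (lpb 0) (lpb' 0).
rewrite h1_pkE// in eu; rewrite h1_pkE// in ev.
have eu1 := le_trans eu d1; have ev1 := le_trans ev d2.
have /andP[s0 s2] := sqrt2_bounds.
have sa : Num.sqrt 2 * a <= 2 * a by rewrite ler_wpM2r.
have sb : Num.sqrt 2 * b <= 2 * b by rewrite ler_wpM2r.
have f0 := momentum_derivative_bound hf hf' mf.
have g0 := momentum_derivative_bound hg hg' mg.
have F0 := momentum_derivative_bound hF hF' mF.
have G0 := momentum_derivative_bound hG hG' mG.
have Fz : 0 <= F z by apply: le_trans (F0 z).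
have Gz : 0 <= G z by apply: le_trans (G0 z).
(* For t > 1 the triangle inequality is enough, the conserved norms of [F] and [G] being bounded by
   those of the data. *)
have [tle|tgt] := leP t 1; last first.
  have t1 := ltW tgt.
  have n1 := h1D lF lF' (L2N (lpa z)) (L2N (lpa' z)).
  have n2 := h1D lG lG' (L2N (lpb z)) (L2N (lpb' z)).
  rewrite h1N ?h1_pkE// eF in n1; rewrite h1N ?h1_pkE// eG in n2.
  apply: (@le_trans _ _ (stability_constant a b Nu Nv)); last first.
    by rewrite ler_peMr// stability_constant_ge0.
  have := sqrtr_ge0 (stability_gap a b); have := sqrtr_ge0 (stability_gap b a).
  rewrite /stability_constant (ger0_norm a0') (ger0_norm b0').
  move: (ler_norm Nu) (ler_norm Nv) n1 n2 fN gN sa sb a0' b0'.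
  move: (h1 _ _) (h1 _ _) (h1 f f') (h1 g g'); clear; move=> *; lra.
have d1' : d <= 1 by rewrite -t4 expr_le1// ltW.
set S := stability_scale a b.
have Ss : S = stability_scale b a by rewrite /S /stability_scale; lra.
have S1 : 1 <= S by rewrite /S /stability_scale; lra.
have Sa : 2 * a + 1 <= 2 * S by rewrite /S /stability_scale; lra.
have Sb : 2 * b + 1 <= 2 * S by rewrite /S /stability_scale; lra.
have euS : h1 f f' <= 2 * S.
  by move: eu1; rewrite ler_norml => /andP[]; lra.
have evS : h1 g g' <= 2 * S.
  by move: ev1; rewrite ler_norml => /andP[]; lra.
have sup (h h' : R -> R) x : H1 h h' -> (forall x, `|h' x| <= h x) ->
    h1 h h' <= 2 * S -> `|h x| <= 2 * S /\ `|h' x| <= 2 * S.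
  move=> hh h'h hS; have h0 : 0 <= h x by apply: le_trans (h'h x).
  have hx : h x <= 2 * S.
    apply: le_trans hS; rewrite -ler_sqr ?nnegrE ?h1_ge0// sqr_h1.
    by have := H1_sup x hh; have := sqr_ge0 (h x); lra.
  by rewrite ger0_norm//; split => //; exact: le_trans (h'h x) hx.
have pkS c z' x : 0 <= c -> c <= 2 * S -> `|pk c z' x| <= 2 * S /\ `|pk' c z' x| <= 2 * S.
  move=> c0 cS; have /andP[h1 h2] := pk_bound z' x c0.
  rewrite ger0_norm//; split; first exact: le_trans h2 cS.
  by apply: le_trans cS; exact: pk'_bound.
have aS : a <= 2 * S by lra.
have bS : b <= 2 * S by lra.
have [nf nf'] := nrm_le_h1 f f'.
have [npa npa'] := nrm_le_h1 (pk a 0) (pk' a 0).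
rewrite h1_pkE// in npa npa'.
have [nd1 nd2] := nrm_le_h1 (fun x => f x - pk a 0 x) (fun x => f' x - pk' a 0 x).
have [nd3 nd4] := nrm_le_h1 (fun x => g x - pk b 0 x) (fun x => g' x - pk' b 0 x).
have B0 : 0 <= 2 * S by lra.
have saS : Num.sqrt 2 * a <= 2 * S by lra.
(* Closeness to the peakons is known at the initial time only; [quartic] is compared with its peakon
   value there and carried over by conservation. *)
have Q : 4 * a ^+ 2 * b ^+ 2 - 320 * S ^+ 3 * t ^+ 4 <= quartic F F' G G'.
  rewrite eQ t4 -(quartic_pk 0 a0' b0').
  have -> : 320 * S ^+ 3 * d = 40 * (2 * S) ^+ 3 * d by ring.
  apply: (quartic_diff lf lf' lg lg' (lpa 0) (lpa' 0) (lpb 0) (lpb' 0) B0 (ltW d0)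
    _ _ (le_trans nd1 d1) (le_trans nd2 d1) (le_trans nd3 d2) (le_trans nd4 d2)
    (le_trans nf euS) (le_trans nf' euS) (le_trans npa saS) (le_trans npa' saS)).
    move=> x; have [q1 q2] := sup g g' x hg g0 evS.
    by have [q3 q4] := pkS a 0 x a0' aS.
  by move=> x; exact: pkS.
have E0 := h1_cs lF lF' lG lG'.
have supF : 2 * F z ^+ 2 <= h1 F F' ^+ 2 by rewrite sqr_h1; exact: H1_sup.
have supG : 2 * G z ^+ 2 <= h1 G G' ^+ 2 by rewrite sqr_h1; exact: H1_sup.
have tt : t ^+ 4 = (t ^+ 2) ^+ 2 by rewrite -exprM.
have ss : Num.sqrt (2 : R) ^+ 2 = 2 by rewrite sqr_sqrtr.
have key := quartic_max_inequality hF hG F0 G0 zmax.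
rewrite -eF -t4 tt in eu1; rewrite -eG -t4 tt in ev1.
have gapF : h1 (fun x => F x - pk a z x) (fun x => F' x - pk' a z x) ^+ 2 <=
    stability_gap a b * t ^+ 2.
  rewrite H1_dist_pk//.
  apply: (@amplitude_gap _ a b _ (t ^+ 2) _ (h1 G G') _ (G z) _ _ a0 b0 s0 ss _ _ eu1 ev1
    (h1_ge0 _ _) (h1_ge0 _ _) Fz Gz supF supG E0 key); rewrite ?sqr_ge0 -?tt ?expr_le1 ?(ltW t0)//.
have gapG : h1 (fun x => G x - pk b z x) (fun x => G' x - pk' b z x) ^+ 2 <=
    stability_gap b a * t ^+ 2.
  rewrite H1_dist_pk//.
  rewrite mulrC in E0; rewrite (mulrC (F z)) in key.
  apply: (@amplitude_gap _ b a _ (t ^+ 2) _ (h1 F F') _ (F z) _ _ b0 a0 s0 ss _ _ ev1 eu1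
    (h1_ge0 _ _) (h1_ge0 _ _) Gz Fz supG supF E0 key); rewrite ?sqr_ge0 -?tt ?expr_le1 ?(ltW t0)//.
  by rewrite -Ss; move: Q; rewrite mulrAC.
have root x C : 0 <= x -> x ^+ 2 <= C * t ^+ 2 -> x <= Num.sqrt C * t.
  move=> x0 h; rewrite -[leLHS]ger0_norm// -sqrtr_sqr.
  apply: (@le_trans _ _ (Num.sqrt (C * t ^+ 2))); first exact: ler_wsqrtr.
  have [C0|C0] := leP 0 C.
    by rewrite sqrtrM// sqrtr_sqr gtr0_norm.
  rewrite (@ler0_sqrtr _ (C * _)) ?mulr_ge0 ?sqrtr_ge0 ?ltW//.
  by rewrite pmulr_llt0 ?exprn_gt0.
have rF := root _ _ (h1_ge0 _ _) gapF; have rG := root _ _ (h1_ge0 _ _) gapG.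
apply: (le_trans (lerD rF rG)); rewrite -mulrDl; apply: ler_wpM2r; first exact: ltW.
by rewrite /stability_constant; do 4!(apply: ler_wpDr; first exact: mulr_ge0).
Qed.

End Stability_estimate.

(** * From the prescribed data to the solution at time 0 *)

Section Solutions.
Context {R : realType}.
Implicit Types (a b c s t d : R).

Local Notation mu := (@lebesgue_measure R).

(** The data are known up to null sets and through chosen weak derivatives; sign and size are
    transferred to the continuous representative [w]. Its H^1 norm is at most the sum of two L^2
    norms, hence the factor 2. *)
Lemma sobolev_initial s (u0 w : R -> R) : 3 <= s -> sobolev s u0 ->
  H1 w (derive1 w) -> H1 (derive1 w) (derive1 (derive1 w)) ->
  {ae mu, forall x, w x = u0 x} ->
  {ae mu, forall x, 0 <= helmholtz u0 x} ->
  {ae mu, forall x, 0 <= w x - derive1 (derive1 w) x} /\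
  h1 w (derive1 w) <= 2 * sobolev_norm s u0.
Proof.
move=> s3 su hw hw' wu m0.
have k3 : (3 <= Num.truncn s)%N by rewrite truncn_gt_nat.
have [mu0 sw _] := su.
have e1 := wderiv_eq_ae (H1_weak_derivative hw) mu0 wu.
have mu1 : measurable_fun [set: R] (wderiv u0).
  by have [] := weak_measurable (sw 0%N (leq_trans (isT : (0 < 3)%N) k3)).
have e2 : {ae mu, forall x, wderiv (wderiv u0) x = derive1 (derive1 w) x}.
  apply: (wderiv_eq_ae (H1_weak_derivative hw') mu1).
  by apply: (ae_imp e1) => x ->.
split.
  apply: (ae_imp2 wu (ae_imp2 e2 m0 (fun x => @conj _ _))) => x e [e' h].
  by rewrite e -e'.
have n0 : nrm w <= sobolev_norm s u0.
  rewrite (nrm_ae (L2_measurable (H1_L2 hw)) mu0 wu).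
  exact: (@nrm_wderivn_sobolev _ _ _ 0%N su).
have n1 : nrm (derive1 w) <= sobolev_norm s u0.
  rewrite (nrm_ae (L2_measurable (H1_L2' hw)) mu1); last first.
    by apply: (ae_imp e1) => x ->.
  exact: (@nrm_wderivn_sobolev _ _ _ 1%N su (leq_trans (isT : (1 <= 3)%N) k3)).
apply: (@le_trans _ _ (nrm w + nrm (derive1 w))); last by lra.
have p0 := nrm_ge0 w; have p1 := nrm_ge0 (derive1 w).
rewrite -ler_sqr ?nnegrE ?h1_ge0 ?addr_ge0// sqr_h1 -!sqr_nrm sqrrD.
by have := mulr_ge0 p0 p1; lra.
Qed.

Lemma H1_norm_peakon a z f f' g : 0 <= a -> H1 f f' -> measurable_fun [set: R] g ->
  {ae mu, forall x, f x = g x} ->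
  H1_norm (fun x => g x - peakon a (x - z)) =
  h1 (fun x => f x - pk a z x) (fun x => f' x - pk' a z x).
Proof.
move=> a0 hf mg fg; have hp := H1_pk z a0.
apply: (H1_normE (H1B hf hp)); last by apply: (ae_imp fg) => x ->.
by apply: measurable_funB => //; exact: L2_measurable (H1_L2 hp).
Qed.

End Solutions.

Theorem theorem1p1 (R : realType) :
  exists A : R -> R -> R -> R -> R,
    (forall a b Nu Nv : R, 0 < A a b Nu Nv) /\
    forall (a b c s delta : R) (u0 v0 : R -> R) (T : \bar R)
           (u v : R -> R -> R),
      0 < a -> 0 < b -> c = a * b ->
      3 <= s -> sobolev s u0 -> sobolev s v0 ->
      {ae (@lebesgue_measure R), forall x, 0 <= helmholtz u0 x} ->
      {ae (@lebesgue_measure R), forall x, 0 <= helmholtz v0 x} ->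
      0 < delta ->
      H1_norm (fun x => u0 x - peakon a x)
        + H1_norm (fun x => v0 x - peakon b x) < delta ->
      maximal_strong_solution s T u0 v0 u v ->
      (forall t, lifespan T t ->
         exists z : R, is_max_point (fun x => u t x * v t x) z) /\
      (forall xi : R -> R,
         (forall t, lifespan T t ->
            is_max_point (fun x => u t x * v t x) (xi t)) ->
         (ereal_sup
            [set (H1_norm (fun x => u t x - peakon a (x - xi t))
                  + H1_norm (fun x => v t x - peakon b (x - xi t)))%:E
            | t in lifespan T]
          < (A a b (sobolev_norm s u0) (sobolev_norm s v0)
               * delta `^ (1 / 4))%:E)%E).
Proof.
(* The added 1 gives positivity and turns the bound on the supremum into a strict one. *)
exists (fun a b Nu Nv => stability_constant a b Nu Nv + 1); split.
  by move=> a b Nu Nv; rewrite ltr_wpDl ?stability_constant_ge0.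
move=> a b c s delta u0 v0 T u v a0 b0 _ s3 su sv mu0 mv0 delta0 close.
case=> T0 [[Cu Cv] [C1u C1v] cont [eqnu eqnv] [iu iv]] _.
have cu t : lifespan T t -> continuous (u t) by move=> /cont[].
have cv t : lifespan T t -> continuous (v t) by move=> /cont[].
have hu := strong_solution_H3 s3 Cu cu; have hv := strong_solution_H3 s3 Cv cv.
have eu t := @strong_solution_evolves _ _ _ _ _ t s3 Cu C1u cu Cv cv eqnu.
have ev t := @strong_solution_evolves _ _ _ _ _ t s3 Cv C1v cv Cu cu eqnv.
have T00 : lifespan T 0 by split.
have [hu0 hu1 _] := hu _ T00; have [hv0 hv1 _] := hv _ T00.
have [pu nu] := sobolev_initial s3 su hu0 hu1 iu mu0.
have [pv nv] := sobolev_initial s3 sv hv0 hv1 iv mv0.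
(* Applied at t = 0 too, where it upgrades the almost everywhere sign of the data to all points. *)
have mu t (Tt : lifespan T t) := momentum_nonneg hu hv eu ev Tt pu.
have mv t (Tt : lifespan T t) := momentum_nonneg hv hu ev eu Tt pv.
have u_ge0 t x : lifespan T t -> 0 <= u t x.
  move=> Tt; have [h h' _] := hu _ Tt.
  exact: le_trans (momentum_derivative_bound h h' (mu t Tt) x).
have v_ge0 t x : lifespan T t -> 0 <= v t x.
  move=> Tt; have [h h' _] := hv _ Tt.
  exact: le_trans (momentum_derivative_bound h h' (mv t Tt) x).
split.
  move=> t Tt; have [h _ _] := hu _ Tt; have [h' _ _] := hv _ Tt.
  by apply: (max_point_exists h h') => x; [exact: u_ge0|exact: v_ge0].
move=> xi ximax.
set K := stability_constant a b (sobolev_norm s u0) (sobolev_norm s v0).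
apply: (@le_lt_trans _ _ (K * delta `^ (1 / 4))%:E); last first.
  rewrite lte_fin ltr_pM2r ?powR_gt0//; exact: ltr_pwDr.
apply: ge_ereal_sup => _ [t Tt <-]; rewrite lee_fin.
have [hut hut' _] := hu _ Tt; have [hvt hvt' _] := hv _ Tt.
rewrite (H1_norm_peakon (xi t) (ltW a0) hut (L2_measurable (H1_L2 hut))); last exact: ae_all.
rewrite (H1_norm_peakon (xi t) (ltW b0) hvt (L2_measurable (H1_L2 hvt))); last exact: ae_all.
have close' : h1 (fun x => u 0 x - pk a 0 x) (fun x => derive1 (u 0) x - pk' a 0 x)
    + h1 (fun x => v 0 x - pk b 0 x) (fun x => derive1 (v 0) x - pk' b 0 x) < delta.
  have [ms _ _] := su; have [ms' _ _] := sv.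
  rewrite -(H1_norm_peakon 0 (ltW a0) hu0 ms iu) -(H1_norm_peakon 0 (ltW b0) hv0 ms' iv).
  by under eq_fun do rewrite subr0; under [X in _ + H1_norm X]eq_fun do rewrite subr0.
apply: (stability_estimate a0 b0 delta0 hu0 hu1 hv0 hv1 hut hut' hvt hvt'
  (mu 0 T00) (mv 0 T00) (mu t Tt) (mv t Tt) _ _ _ nu nv close' (ximax t Tt)).
- by rewrite /h1; have /= -> := energy_conserved hu hv eu Tt.
- by rewrite /h1; have /= -> := energy_conserved hv hu ev Tt.
- exact: (quartic_conserved hu hv eu ev Tt).
Qed.
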